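(* For every regular triangulation $\mathcal{T}$ of $\Omega$ it holds that $$W_h(\mathcal{T})=\Pi_{X_h(\mathcal{T})}\nabla H^1_0(\Omega).$$ Moreover, if $\mathcal{T}_\star$ is an admissible refinement of $\mathcal{T}$, then $$\Pi_{X_h(\mathcal{T})}W_h(\mathcal{T}_\star)=W_h(\mathcal{T}).$$
   Context: $\Omega\subseteq\mathbb{R}^2$ is a simply connected, bounded, polygonal Lipschitz domain. $L^2_0(\Omega)$ is the set of $L^2(\Omega)$ functions with vanishing integral mean. For scalar $\beta$, $\operatorname{Curl}\beta:=(\partial\beta/\partial x_2,-\partial\beta/\partial x_1)$. Set $Y:=H^1(\Omega)\cap L^2_0(\Omega)$. A regular triangulation $\mathcal{T}$ of $\Omega$ is a finite set of closed triangles with $\overline\Omega=\bigcup\mathcal{T}$ such that any two distinct triangles are either disjoint or share exactly one common edge or one vertex. An admissible refinement $\mathcal{T}_\star$ of $\mathcal{T}$ is a regular triangulation created from $\mathcal{T}$ by newest-vertex bisection (each triangle of $\mathcal T$ being equipped with a refinement edge); in particular every triangle of $\mathcal{T}$ is a union of triangles of $\mathcal{T}_\star$. For fixed $k\in\mathbb{N}\cup\{0\}$, $P_k(\mathcal{T})$ (resp. $P_k(\mathcal{T};\mathbb{R}^2)$) is the space of functions (resp. vector fields) which are, on each $T\in\mathcal{T}$, (componentwise) polynomials of total degree $\le k$. Set $X_h(\mathcal{T}):=P_k(\mathcal{T};\mathbb{R}^2)$, $Y_h(\mathcal{T}):=P_{k+1}(\mathcal{T})\cap Y$, and $$W_h(\mathcal{T}):=\{q_h\in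 X_h(\mathcal{T})\mid (q_h,\operatorname{Curl}\beta_h)_{L^2(\Omega)}=0\text{ for all }\beta_h\in Y_h(\mathcal{T})\}.$$ $\Pi_{X_h(\mathcal{T})}:L^2(\Omega;\mathbb{R}^2)\to X_h(\mathcal{T})$ denotes the $L^2$ projection; applied to a set it denotes the image of that set. *)

(* Defs.v *)
From HB Require Import structures.
From mathcomp Require Import all_boot all_order all_algebra.
From mathcomp Require Import all_classical all_reals all_analysis.
From Stdlib Require Import Relation_Operators.

Set Implicit Arguments.
Unset Strict Implicit.
Unset Printing Implicit Defensive.

Import Order.TTheory GRing.Theory Num.Theory.
Import numFieldNormedType.Exports.

Local Open Scope classical_set_scope.
Local Open Scope ring_scope.

(* The library puts the maximum norm on R * R; everything below that involves
   this norm (topology, boundedness, differentiability) is the same for the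
   Euclidean norm. *)

Section Geometry.
Context {R : realType}.
Implicit Types (Omega K L E A : set (R * R)) (a b c x y : R * R).

Definition dot x y : R := x.1 * y.1 + x.2 * y.2.

Definition rot90 x : R * R := (- x.2, x.1).

Definition segment a b : set (R * R) :=
  [set x | exists t : R, [/\ 0 <= t, t <= 1 & x = (1 - t) *: a + t *: b]].

Definition noncollinear a b c : Prop := dot (rot90 (b - a)) (c - a) != 0.

Definition triangle a b c : set (R * R) :=
  [set x | exists r s t : R, [/\ 0 <= r, 0 <= s, 0 <= t, r + s + t = 1 &
                              x = r *: a + s *: b + t *: c]].

Definition midpoint a b : R * R := 2^-1 *: (a + b).

Definition boundary A : set (R * R) := closure A `\` interior A.

Definition domain Omega : Prop :=
  [/\ Omega !=set0, open Omega & connected Omega].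

(* Paths and homotopies are total functions of which only the restriction to
   the unit interval, resp. the unit square, matters. *)
Definition unit_square : set (R * R) := `[0, 1]%classic `*` `[0, 1]%classic.

Definition path_in A (g : R -> R * R) : Prop :=
  {within `[0, 1]%classic, continuous g} /\
  (forall t, 0 <= t <= 1 -> A (g t)).

Definition path_connected A : Prop :=
  forall x y, A x -> A y -> exists g, [/\ path_in A g, g 0 = x & g 1 = y].

(* Loops contract to their base point, which stays fixed. *)
Definition null_homotopic A (g : R -> R * R) : Prop :=
  exists H : R * R -> R * R,
    [/\ {within unit_square, continuous H},
        (forall p, unit_square p -> A (H p)),
        (forall t, 0 <= t <= 1 -> H (0, t) = g t),
        (forall t, 0 <= t <= 1 -> H (1, t) = g 0) &
        (forall s, 0 <= s <= 1 -> H (s, 0) = g 0 /\ H (s, 1) = g 0)].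

Definition simply_connected A : Prop :=
  path_connected A /\
  (forall g, path_in A g -> g 0 = g 1 -> null_homotopic A g).

Definition polygonal Omega : Prop :=
  exists s : seq ((R * R) * (R * R)),
    boundary Omega = [set x | exists2 e, e \in s & segment e.1 e.2 x].

(* Near each boundary point, in the Cartesian coordinates with that point as
   origin and axes d and rot90 d, Omega is the strict epigraph of a Lipschitz
   function. *)
Definition lipschitz_domain Omega : Prop :=
  forall x, boundary Omega x ->
  exists (d : R * R) (l : R) (g : R -> R),
    [/\ dot d d = 1, l.-lipschitz g &
        \forall y \near x, Omega y <-> g (dot d (y - x)) < dot (rot90 d) (y - x)].

Definition simply_connected_polygonal_domain Omega : Prop :=
  [/\ domain Omega, simply_connected Omega, bounded_set Omega,
      polygonal Omega & lipschitz_domain Omega].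

Definition is_triangle K : Prop :=
  exists a b c, noncollinear a b c /\ K = triangle a b c.

Definition is_vertex K x : Prop :=
  exists b c, noncollinear x b c /\ K = triangle x b c.

Definition is_edge K E : Prop :=
  exists a b c, [/\ noncollinear a b c, K = triangle a b c & E = segment a b].

Definition regular_triangulation Omega (T : set (set (R * R))) : Prop :=
  [/\ finite_set T,
      (forall K, T K -> is_triangle K),
      closure Omega = \bigcup_(K in T) K &
      (forall K L, T K -> T L -> K <> L ->
         [\/ K `&` L = set0,
             (exists E, [/\ is_edge K E, is_edge L E & K `&` L = E]) |
             (exists x, [/\ is_vertex K x, is_vertex L x & K `&` L = [set x]])])].

Definition refinement_edges (T : set (set (R * R)))
    (e : set (R * R) -> set (R * R)) : Prop :=
  forall K, T K -> is_edge K (e K).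

(* A pair (K, E) is a triangle K with its refinement edge E.  The midpoint of E
   becomes the newest vertex of both children, and the refinement edge of a
   child is the edge opposite to its newest vertex. *)
Inductive bisection (M : set (set (R * R) * set (R * R))) :
    set (set (R * R) * set (R * R)) -> Prop :=
| Bisection a b c :
    noncollinear a b c ->
    M (triangle a b c, segment a b) ->
    bisection M
      ((M `\ (triangle a b c, segment a b)) `|`
       [set (triangle a c (midpoint a b), segment a c);
            (triangle b c (midpoint a b), segment b c)]).

(* Single triangles are bisected one at a time; hanging nodes may occur in
   between, but not in the final triangulation. *)
Definition admissible_refinement Omega (T : set (set (R * R)))
    (e : set (R * R) -> set (R * R)) (Tstar : set (set (R * R))) : Prop :=
  exists M,
    [/\ clos_refl_trans _ bisection [set (K, e K) | K in T] M,
        Tstar = [set P.1 | P in M] &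
        regular_triangulation Omega Tstar].

End Geometry.

(* An element of an L^2 space is represented by any of its representatives:
   every set of functions below is closed under equality a.e. in Omega, and the
   values outside Omega are irrelevant.  Hence equality of such sets is equality
   of the corresponding subsets of L^2. *)
Section FunctionSpaces.
Context {R : realType}.

(* measurableTypeR R is R with the Borel sigma-algebra carried by
   lebesgue_measure *)
Definition leb2 :
    {measure set (measurableTypeR R * measurableTypeR R) -> \bar R} :=
  (lebesgue_measure \x lebesgue_measure)%E.

Variable Omega : set (R * R).
Implicit Types (v f beta phi : R * R -> R) (g p q : R * R -> R * R).

Definition measurable_on f : Prop :=
  @measurable_fun _ _ (measurableTypeR R * measurableTypeR R)%type R Omega f.

Definition L2 : set (R * R -> R) :=
  [set f | measurable_on f /\
           leb2.-integrable Omega (fun x => (f x ^+ 2)%:E)].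

Definition L2v : set (R * R -> R * R) :=
  [set g | L2 (fun x => (g x).1) /\ L2 (fun x => (g x).2)].

Definition L2_0 : set (R * R -> R) :=
  [set f | L2 f /\ \int[leb2]_(x in Omega) f x = 0].

Definition L2v_inner p q : R := \int[leb2]_(x in Omega) dot (p x) (q x).

Definition e1 : R * R := (1, 0).
Definition e2 : R * R := (0, 1).

Definition smooth phi : Prop :=
  forall w : seq (R * R), {subset w <= [:: e1; e2]} ->
  forall x, differentiable (foldr (fun d h => 'D_d h) phi w) x.

Definition test_function : set (R * R -> R) :=
  [set phi | smooth phi /\
     exists K, [/\ compact K, K `<=` Omega & forall x, ~ K x -> phi x = 0]].

Definition weak_partial (d : R * R) v f : Prop :=
  L2 f /\
  forall phi, test_function phi ->
    \int[leb2]_(x in Omega) (v x * 'D_d phi x) =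
    - \int[leb2]_(x in Omega) (f x * phi x).

Definition weak_gradient v g : Prop :=
  weak_partial e1 v (fun x => (g x).1) /\ weak_partial e2 v (fun x => (g x).2).

(* g = Curl beta = (d beta / d x2, - d beta / d x1) *)
Definition weak_Curl beta g : Prop :=
  weak_partial e2 beta (fun x => (g x).1) /\
  weak_partial e1 beta (fun x => - (g x).2).

Definition H1 : set (R * R -> R) :=
  [set v | L2 v /\ exists g, weak_gradient v g].

(* closure of the test functions in the H^1 norm *)
Definition H10 : set (R * R -> R) :=
  [set v | L2 v /\ exists g, weak_gradient v g /\
     exists phi : nat -> (R * R -> R),
       [/\ (forall n, test_function (phi n)),
           (fun n => \int[leb2]_(x in Omega) ((phi n x - v x) ^+ 2))
             @ \oo --> (0 : R),
           (fun n => \int[leb2]_(x in Omega) (('D_e1 (phi n) x - (g x).1) ^+ 2))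
             @ \oo --> (0 : R) &
           (fun n => \int[leb2]_(x in Omega) (('D_e2 (phi n) x - (g x).2) ^+ 2))
             @ \oo --> (0 : R)]].

Definition grad_H10 : set (R * R -> R * R) :=
  [set g | exists2 v, H10 v & weak_gradient v g].

Definition Y : set (R * R -> R) := H1 `&` L2_0.

Definition poly2 (k : nat) (c : nat -> nat -> R) (x : R * R) : R :=
  \sum_(i < k.+1) \sum_(j < k.+1 - i) c i j * x.1 ^+ i * x.2 ^+ j.

Definition Pk (k : nat) (T : set (set (R * R))) : set (R * R -> R) :=
  [set f | measurable_on f /\
     forall K, T K -> exists c,
       {ae leb2, forall x, Omega x -> K x -> f x = poly2 k c x}].

Definition Xh (k : nat) (T : set (set (R * R))) : set (R * R -> R * R) :=
  [set q | Pk k T (fun x => (q x).1) /\ Pk k T (fun x => (q x).2)].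

Definition Yh (k : nat) (T : set (set (R * R))) : set (R * R -> R) :=
  Pk k.+1 T `&` Y.

Definition Wh (k : nat) (T : set (set (R * R))) : set (R * R -> R * R) :=
  [set q | Xh k T q /\
     forall beta, Yh k T beta ->
     forall g, weak_Curl beta g -> L2v_inner q g = 0].

(* p represents the L^2-orthogonal projection of g onto X *)
Definition L2_projection (X : set (R * R -> R * R)) g p : Prop :=
  X p /\ forall q, X q -> L2v_inner (fun x => g x - p x) q = 0.

Definition L2_projection_image (X S : set (R * R -> R * R)) :
    set (R * R -> R * R) :=
  [set p | exists2 g, S g & L2_projection X g p].

End FunctionSpaces.

(* Main.v *)
Require Import Defs.
From mathcomp Require Import all_boot all_order all_algebra.
From mathcomp Require Import all_classical all_reals all_analysis measurable_realfun.
From mathcomp Require Import ring lra.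

Set Implicit Arguments.
Unset Strict Implicit.
Unset Printing Implicit Defensive.

Import Order.TTheory GRing.Theory Num.Theory.
Import numFieldNormedType.Exports.

Local Open Scope classical_set_scope.
Local Open Scope ring_scope.

(* The inclusion from right to left is the orthogonality of gradients and Curls:
   Curl beta of a discrete beta is piecewise polynomial, so it does not see the
   projection, and grad phi is orthogonal to it for test functions phi by the
   symmetry of second derivatives.
   Conversely, let p be the orthogonal projection of q in W_h onto the space of all
   projections of grad phi, phi a test function.  Then w = q - p in X_h is
   orthogonal to all grad phi, that is, weakly divergence free.  As Omega is simply
   connected, w = Curl beta for some beta, and beta is a polynomial of degree k + 1
   on each triangle; subtracting its mean puts beta into Y_h.  So w is orthogonal
   to q and to p, hence vanishes.
   The potential beta is found on small squares by integrating w along the axes,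
   with all identities in the weak sense, and the local potentials are made to agree
   a.e. by correcting them with constants, which exist by simple connectedness.
   That beta is weakly differentiable across edges is thus automatic: only the
   cover of Omega by closed triangles with negligible boundaries is needed, not the
   regularity of the triangulation.
   The second identity follows from the first one, because X_h(T) is contained in
   X_h(T_star) and therefore the projections satisfy Pi_T Pi_T_star = Pi_T. *)

(** * Integrals of bounded functions with bounded support *)

(** Projecting onto the projected gradients of test functions takes the place of solving a Poisson
    problem. These projections form a subspace of the finite-dimensional space [Xh], so the
    orthogonal projection onto it exists without completeness of L^2 and without closedness of the
    gradients; every element of [Wh] thereby turns out to be the projection of the gradient of a
    test function. The scalar product is only semidefinite on functions, so finite dimension,
    orthonormality and projection are all understood up to vectors of seminorm zero. The field w
    jumps across edges and is known only almost everywhere, so it cannot be integrated along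
    arbitrary paths. Paths enter only through the constants by which local potentials differ: these
    are genuine numbers, to which a combinatorial monodromy argument applies. Squares are the
    natural neighbourhoods, being the balls of the maximum norm: they are convex, they intersect in
    boxes, and on a box tensor products of one-dimensional test functions separate integrable
    functions, so that Fubini reduces the analysis to one variable. *)

Section BoundedMeasurable.
Context {R : realType}.
Local Notation mR := (measurableTypeR R).
Local Notation mu := (@lebesgue_measure R).
Local Notation mR2 := (measurableTypeR R * measurableTypeR R)%type.

Definition meas1 (f : R -> R) : Prop := @measurable_fun _ _ mR R setT f.
Definition meas2 (f : R * R -> R) : Prop := @measurable_fun _ _ mR2 R setT f.

(* bcs: bounded, with bounded support *)
Definition bcs1 (f : R -> R) : Prop :=
  meas1 f /\ exists M : R, (forall x, `|f x| <= M) /\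
    forall x, M < `|x| -> f x = 0.

Definition bcs2 (f : R * R -> R) : Prop :=
  meas2 f /\ exists M : R, (forall x, `|f x| <= M) /\
    forall x, M < `|x| -> f x = 0.

Definition I1 (f : R -> R) : R := \int[mu]_x f x.
Definition I2 (f : R * R -> R) : R := \int[leb2]_x f x.

Lemma norm2E (x : R * R) : `|x| = Num.max `|x.1| `|x.2|.
Proof. by []. Qed.

Lemma lebesgue_measure_itvcc_lty (a b : R) : (mu `[a, b]%classic < +oo)%E.
Proof. by rewrite lebesgue_measure_itv/=; case: ifP => _; rewrite ?ltry// -EFinB ltry. Qed.

Lemma leb2_itv (a b : R) : (leb2 (`[a, b]%classic `*` `[a, b]%classic) < +oo)%E.
Proof.
have mI : measurable (`[a, b]%classic : set mR) by exact: measurable_itv.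
have -> : leb2 (`[a, b]%classic `*` `[a, b]%classic) =
    (mu `[a, b]%classic * mu `[a, b]%classic)%E by exact: product_measure1E.
by rewrite lte_mul_pinfty// ?ge0_fin_numE// lebesgue_measure_itvcc_lty.
Qed.

Lemma bcs2_integrable f : bcs2 f -> leb2.-integrable setT (EFin \o f).
Proof.
move=> [mf [M [fM f0]]].
pose B : set mR2 := `[-M, M]%classic `*` `[-M, M]%classic.
have mB : measurable B by apply: measurableX; exact: measurable_itv.
have -> : EFin \o f = (EFin \o f) \_ B.
  apply/funext => x; rewrite patchE; case: ifPn => // /negP xB.
  rewrite /= f0//; rewrite ltNge; apply/negP => xM; apply: xB.
  rewrite inE /B /=; move: xM; rewrite norm2E ge_max !ler_norml => /andP[? ?].
  by rewrite !in_itv.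
apply: (proj1 (integrable_mkcond _ mB)).
apply: (@measurable_bounded_integrable _ mR2 R leb2 f B) => //.
- exact: leb2_itv.
- exact: measurable_funTS.
- exists M; split; first by rewrite num_real.
  by move=> N MN x _ /=; rewrite (le_trans (fM x))// ltW.
Qed.

Lemma bcs1_integrable f : bcs1 f -> mu.-integrable setT (EFin \o f).
Proof.
move=> [mf [M [fM f0]]].
pose B : set mR := `[-M, M]%classic.
have mB : measurable B by exact: measurable_itv.
have -> : EFin \o f = (EFin \o f) \_ B.
  apply/funext => x; rewrite patchE; case: ifPn => // /negP xB.
  rewrite /= f0//; rewrite ltNge; apply/negP => xM; apply: xB.
  by rewrite inE /B /= in_itv /= -ler_norml.
apply: (proj1 (integrable_mkcond _ mB)).
apply: measurable_bounded_integrable => //.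
- exact: lebesgue_measure_itvcc_lty.
- exact: measurable_funTS.
- exists M; split; first by rewrite num_real.
  by move=> N MN x _ /=; rewrite (le_trans (fM x))// ltW.
Qed.

Lemma bcs2D f g : bcs2 f -> bcs2 g -> bcs2 (fun x => f x + g x).
Proof.
move=> [mf [M [fM f0]]] [mg [N [gN g0]]]; split; first exact: measurable_funD.
have M0 : 0 <= M by apply: le_trans (fM 0).
have N0 : 0 <= N by apply: le_trans (gN 0).
exists (M + N); split=> x.
  by rewrite (le_trans (ler_normD _ _))// lerD.
by move=> MNx; rewrite f0 ?g0 ?addr0//; apply: le_lt_trans MNx; rewrite (lerDl, lerDr).
Qed.

(** The support of [f] confines the product to a bounded set, so bounds for [g] on bounded sets are
    enough; this admits polynomials as factors. *)
Lemma bcs2M f g : meas2 g ->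
  (forall r, exists M, forall x, `|x| <= r -> `|g x| <= M) ->
  bcs2 f -> bcs2 (fun x => g x * f x).
Proof.
move=> mg lbg [mf [M [fM f0]]]; split; first exact: measurable_funM.
have [N gN] := lbg M.
exists (Num.max M (N * M)); split=> x.
  have [xM|xM] := leP `|x| M.
    by rewrite normrM le_max ler_pM ?orbT//; exact: gN.
  by rewrite f0// mulr0 normr0 le_max (le_trans _ (fM 0)).
by rewrite gt_max => /andP[? _]; rewrite f0// mulr0.
Qed.

Lemma bcs2Z c f : bcs2 f -> bcs2 (fun x => c * f x).
Proof.
move=> bf; apply: bcs2M => //; first exact: measurable_cst.
by move=> r; exists `|c|.
Qed.

Lemma bcs1D f g : bcs1 f -> bcs1 g -> bcs1 (fun x => f x + g x).
Proof.
move=> [mf [M [fM f0]]] [mg [N [gN g0]]]; split; first exact: measurable_funD.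
have M0 : 0 <= M by apply: le_trans (fM 0).
have N0 : 0 <= N by apply: le_trans (gN 0).
exists (M + N); split=> x.
  by rewrite (le_trans (ler_normD _ _))// lerD.
by move=> MNx; rewrite f0 ?g0 ?addr0//; apply: le_lt_trans MNx; rewrite (lerDl, lerDr).
Qed.

Lemma bcs1M f g : meas1 g ->
  (forall r, exists M, forall x, `|x| <= r -> `|g x| <= M) ->
  bcs1 f -> bcs1 (fun x => g x * f x).
Proof.
move=> mg lbg [mf [M [fM f0]]]; split; first exact: measurable_funM.
have [N gN] := lbg M.
exists (Num.max M (N * M)); split=> x.
  have [xM|xM] := leP `|x| M.
    by rewrite normrM le_max ler_pM ?orbT//; exact: gN.
  by rewrite f0// mulr0 normr0 le_max (le_trans _ (fM 0)).
by rewrite gt_max => /andP[? _]; rewrite f0// mulr0.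
Qed.

Lemma bcs1Z c f : bcs1 f -> bcs1 (fun x => c * f x).
Proof.
move=> bf; apply: bcs1M => //; first exact: measurable_cst.
by move=> r; exists `|c|.
Qed.

Lemma I2D f g : bcs2 f -> bcs2 g -> I2 (fun x => f x + g x) = I2 f + I2 g.
Proof. by move=> *; apply: RintegralD => //; exact: bcs2_integrable. Qed.

Lemma I2Z c f : bcs2 f -> I2 (fun x => c * f x) = c * I2 f.
Proof. by move=> *; apply: RintegralZl => //; exact: bcs2_integrable. Qed.

Lemma I1D f g : bcs1 f -> bcs1 g -> I1 (fun x => f x + g x) = I1 f + I1 g.
Proof. by move=> *; apply: RintegralD => //; exact: bcs1_integrable. Qed.

Lemma I1Z c f : bcs1 f -> I1 (fun x => c * f x) = c * I1 f.
Proof. by move=> *; apply: RintegralZl => //; exact: bcs1_integrable. Qed.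

(* Adding M times an indicator makes the integrand nonnegative, so that
   Tonelli applies. *)
Lemma measurable_I1_param d (T : measurableType d) (k : T -> R -> R) (M : R) :
  @measurable_fun _ _ (T * mR)%type R setT (fun p => k p.1 p.2) ->
  (forall x t, `|k x t| <= M) -> (forall x t, M < `|t| -> k x t = 0) ->
  measurable_fun setT (fun x => I1 (k x)).
Proof.
move=> mk kM k0.
pose ind (t : R) : R := \1_(`[-M, M]%classic) t.
have indE t : ind t = (`|t| <= M)%R%:R.
  by rewrite /ind indicE mem_setE in_itv/= ler_norml.
have mind : meas1 ind by exact: measurable_indic.
have bind : bcs1 (fun t => M * ind t).
  split; first exact: measurable_funM.
  exists `|M|; split=> x.
    by rewrite indE normrM normr_nat; case: (`|x| <= M)%R; rewrite ?mulr1 ?mulr0 /=.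
  by move=> Mx; rewrite indE leNgt (le_lt_trans (ler_norm _) Mx) mulr0.
have bk x : bcs1 (k x).
  split.
    rewrite /meas1 (_ : k x = (fun p => k p.1 p.2) \o (fun t => (x, t)))//.
    by apply: measurableT_comp => //; exact: measurable_fun_pair.
  by exists M; split => // t; exact: k0.
have -> : (fun x => I1 (k x)) =
    (fun x => fine (\int[mu]_t ((k x t + M * ind t)%:E))%E - I1 (fun t => M * ind t)).
  apply/funext => x.
  by rewrite [X in _ = X - _](_ : _ = I1 (fun t => k x t + M * ind t))// I1D// addrK.
apply: measurable_funB; last exact: measurable_cst.
apply/measurable_EFinP.
rewrite (_ : _ \o _ = fun x => (\int[mu]_t ((k x t + M * ind t)%:E))%E); last first.
  apply/funext => x /=; rewrite fineK//; apply: integrable_fin_num => //.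
  by apply: bcs1_integrable; exact: bcs1D.
apply: (@measurable_fun_fubini_tonelli_F _ _ T mR R mu
          (fun p => (k p.1 p.2 + M * ind p.2)%:E)).
  apply/measurable_EFinP; apply: measurable_funD => //.
  apply: measurable_funM; first exact: measurable_cst.
  by apply: measurableT_comp => //.
move=> [x t]; rewrite lee_fin /= indE.
have [tM|tM] := leP `|t| M.
  by rewrite mulr1 -lerBlDr sub0r; have := kM x t; rewrite ler_norml => /andP[].
by rewrite mulr0 addr0 k0.
Qed.

Lemma bcs1_xsection f x : bcs2 f -> bcs1 (fun y => f (x, y)).
Proof.
move=> [mf [M [fM f0]]]; split.
  rewrite /meas1 (_ : (fun _ => _) = f \o (fun t => (x, t)))//.
  by apply: measurableT_comp => //; exact: measurable_fun_pair.
by exists M; split=> // y My; apply: f0; rewrite norm2E lt_max My orbT.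
Qed.

Lemma bcs1_ysection f y : bcs2 f -> bcs1 (fun x => f (x, y)).
Proof.
move=> [mf [M [fM f0]]]; split.
  rewrite /meas1 (_ : (fun _ => _) = f \o (fun t => (t, y)))//.
  by apply: measurableT_comp => //; exact: measurable_fun_pair.
by exists M; split=> // x My; apply: f0; rewrite norm2E lt_max My.
Qed.

Lemma bcs2_swap f : bcs2 f -> bcs2 (fun p => f (p.2, p.1)).
Proof.
move=> [mf [M [fM f0]]]; split.
  rewrite /meas2 (_ : (fun _ => _) = f \o (fun t => (t.2, t.1)))//.
  by apply: measurableT_comp => //; exact: measurable_fun_pair.
by exists M; split=> // x Mx; apply: f0; rewrite norm2E maxC -norm2E.
Qed.

Lemma I1_bound f M : 0 <= M -> bcs1 f -> (forall x, `|f x| <= M) ->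
  (forall x, M < `|x| -> f x = 0) -> `|I1 f| <= M * (2 * M).
Proof.
move=> M0 bf fM f0.
have ib : mu.-integrable setT (EFin \o (fun t => M * \1_(`[-M, M]%classic) t)).
  apply: bcs1_integrable; apply: bcs1Z; split; first exact: measurable_indic.
  exists (Num.max 1 M); split=> x; rewrite indicE mem_setE in_itv/= -ler_norml.
    by rewrite normr_nat; case: (`|x| <= M)%R; rewrite le_max ?lexx// ler01.
  by rewrite gt_max => /andP[_]; rewrite ltNge => /negbTE ->.
apply: (le_trans (le_normr_Rintegral _ (bcs1_integrable bf))) => //.
apply: (@le_trans _ _ (I1 (fun t => M * \1_(`[-M, M]%classic) t))).
  apply: le_Rintegral => //.
    have [mf _] := bf.
    apply: bcs1_integrable; split; first exact: measurableT_comp.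
    exists M; split => x; first by rewrite normr_id.
    by move=> Mx; rewrite f0// normr0.
  move=> x _; rewrite indicE mem_setE in_itv/= -ler_norml.
  by have [xM|xM] := leP `|x| M; rewrite ?mulr1// mulr0 f0// normr0.
rewrite /I1 RintegralZl//; last first.
  apply: bcs1_integrable; split; first exact: measurable_indic.
  exists (Num.max 1 M); split=> x; rewrite indicE mem_setE in_itv/= -ler_norml.
    by rewrite normr_nat; case: (`|x| <= M)%R; rewrite le_max ?lexx// ler01.
  by rewrite gt_max => /andP[_]; rewrite ltNge => /negbTE ->.
rewrite ler_wpM2l// /Rintegral integral_indic//= setIT lebesgue_measure_itv/=.
by rewrite lte_fin; case: ifP => _ /=; lra.
Qed.

Lemma bcs1_I1 f : bcs2 f -> bcs1 (fun x => I1 (fun y => f (x, y))).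
Proof.
move=> bf; have [mf [M [fM f0]]] := bf.
have M0 : 0 <= M by apply: le_trans (fM 0).
split.
  apply: (@measurable_I1_param _ mR (fun x y => f (x, y)) M) => //.
    by rewrite (_ : (fun _ => _) = f)//; apply/funext => -[].
  by move=> x t Mt; apply: f0; rewrite norm2E lt_max Mt orbT.
exists (Num.max M (M * (2 * M))); split=> x.
  rewrite le_max I1_bound ?orbT//; first exact: bcs1_xsection.
  by move=> y My; apply: f0; rewrite norm2E lt_max My orbT.
rewrite gt_max => /andP[Mx _].
rewrite (_ : (fun _ => _) = cst 0); first by rewrite /I1 Rintegral_cst// mul0r.
by apply/funext => y; apply: f0; rewrite norm2E lt_max Mx.
Qed.

Lemma I2_xy f : bcs2 f -> I2 f = I1 (fun x => I1 (fun y => f (x, y))).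
Proof.
move=> bf; rewrite /I2 /Rintegral -integral12_prod_meas1; last exact: bcs2_integrable.
congr fine; apply: eq_integral => x _; rewrite /fubini_F /I1 /Rintegral fineK//.
by apply: integrable_fin_num => //; apply: bcs1_integrable; exact: bcs1_xsection.
Qed.

Lemma I2_yx f : bcs2 f -> I2 f = I1 (fun y => I1 (fun x => f (x, y))).
Proof.
move=> bf; rewrite /I2 /Rintegral -integral21_prod_meas1; last exact: bcs2_integrable.
congr fine; apply: eq_integral => x _; rewrite /fubini_G /I1 /Rintegral fineK//.
by apply: integrable_fin_num => //; apply: bcs1_integrable; exact: bcs1_ysection.
Qed.

End BoundedMeasurable.

(** * Measurability of open sets and local almost-everywhere statements *)

Section PlaneMeasurability.
Context {R : realType}.
Local Notation mR2 := (measurableTypeR R * measurableTypeR R)%type.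

Definition box (a b c d : R) : set (R * R) :=
  [set x | [/\ a < x.1, x.1 < b, c < x.2 & x.2 < d]].

Lemma boxE a b c d : box a b c d = `]a, b[%classic `*` `]c, d[%classic.
Proof.
apply/seteqP; split=> x; rewrite /box /= !in_itv /=.
  by move=> [-> -> -> ->].
by move=> [/andP[-> ->] /andP[-> ->]].
Qed.

Lemma measurable_box a b c d : measurable (box a b c d : set mR2).
Proof. by rewrite boxE; apply: measurableX; exact: measurable_itv. Qed.

Lemma ballE (p : R * R) r (x : R * R) :
  ball p r x <-> `|p.1 - x.1| < r /\ `|p.2 - x.2| < r.
Proof. by rewrite -ball_normE /ball_/= norm2E gt_max; split => [/andP|[-> ->]]. Qed.

Lemma ball_box (p : R * R) r : ball p r = box (p.1 - r) (p.1 + r) (p.2 - r) (p.2 + r).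
Proof.
apply/seteqP; split => x; rewrite ballE /box /= !ltr_norml.
  by move=> [/andP[? ?] /andP[? ?]]; split; lra.
by move=> [? ? ? ?]; split; apply/andP; split; lra.
Qed.

(** A countable base of the plane. It makes open sets measurable for the product sigma-algebra and
    reduces almost-everywhere statements to neighbourhoods of points. *)
Definition rat_box (q : rat * rat * (rat * rat)) : set (R * R) :=
  box (ratr q.1.1) (ratr q.1.2) (ratr q.2.1) (ratr q.2.2).

Lemma rat_box_ball (p : R * R) r : 0 < r ->
  exists q, rat_box q p /\ rat_box q `<=` ball p r.
Proof.
move=> r0.
have [|a] := @rat_in_itvoo R (p.1 - r) p.1; first by lra.
have [|b] := @rat_in_itvoo R p.1 (p.1 + r); first by lra.
have [|c] := @rat_in_itvoo R (p.2 - r) p.2; first by lra.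
have [|d] := @rat_in_itvoo R p.2 (p.2 + r); first by lra.
rewrite !in_itv /= => /andP[? ?] /andP[? ?] /andP[? ?] /andP[? ?].
exists ((a, b), (c, d)); split; first by split.
by rewrite ball_box => x [/= ? ? ? ?]; split; lra.
Qed.

Lemma open_measurable2 (U : set (R * R)) : open U -> measurable (U : set mR2).
Proof.
move=> oU.
pose F (q : rat * rat * (rat * rat)) : set mR2 :=
  [set x | rat_box q x /\ rat_box q `<=` U].
have -> : U = \bigcup_q F q.
  apply/seteqP; split=> [x Ux|x [q _ [qx]]]; last exact.
  have /nbhs_ballP[r /= r0 rU] : nbhs x U by exact: open_nbhs_nbhs.
  have [q [qx qr]] := rat_box_ball x r0.
  by exists q => //; split => //; exact: subset_trans rU.
apply: countable_bigcupT_measurable; first exact: countableP.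
move=> q; have [qU|qU] := pselect (rat_box q `<=` U).
  rewrite (_ : F q = rat_box q); first exact: measurable_box.
  by apply/seteqP; split => x // [].
rewrite (_ : F q = set0); first exact: measurable0.
by apply/seteqP; split => x // [].
Qed.

(** Lindelof's argument: the exceptional set is covered by those rational boxes in which it is
    negligible, and there are only countably many of them. *)
Lemma ae_local (O P : set (R * R)) :
  (forall p, O p -> exists2 r, 0 < r &
     {ae leb2, forall x, ball p r x -> O x -> P x}) ->
  {ae leb2, forall x, O x -> P x}.
Proof.
move=> OP.
pose N : set mR2 := [set x | O x /\ ~ P x].
pose good q := leb2.-negligible (N `&` rat_box q).
(* The good boxes are enumerated by their codes; every other number contributes the empty set. *)
pose G (n : nat) : set mR2 :=
  if unpickle n is Some q then
    if `[< good q >] then N `&` rat_box q else set0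
  else set0.
have NG : N `<=` \bigcup_n G n.
  move=> x [Ox nPx]; have [r r0 aer] := OP x Ox.
  have [q [qx qr]] := rat_box_ball x r0.
  have [n qn] : exists n, unpickle n = Some q by exists (pickle q); exact: pickleK.
  exists n => //; rewrite /G qn; case: asboolP => [|[]].
    by move=> _; split.
  apply: negligibleS aer => y [[Oy nPy] qy] /= H.
  by apply: nPy; apply: H => //; exact: qr.
have nG : leb2.-negligible (\bigcup_n G n).
  apply: negligible_bigcup => n; rewrite /G.
  case: unpickle => [q|]; last exact: negligible_set0.
  by case: asboolP => // _; exact: negligible_set0.
apply: negligibleS nG; apply: subset_trans NG => x /= /not_implyP[? ?].
by split.
Qed.

Lemma continuous_meas2 (f : R * R -> R) : continuous f -> meas2 f.
Proof.
move=> cf; apply: (measurability _ (RGenOpens.measurableE R)) => //.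
move=> _ [_ [a [b ->] <-]]; rewrite setTI; apply: open_measurable2.
by apply: open_comp; [move=> x _; exact: cf|exact: interval_open].
Qed.

Lemma continuous_meas1 (f : R -> R) : continuous f -> meas1 f.
Proof. exact: continuous_measurable_fun. Qed.

Lemma continuous_lbounded2 (f : R * R -> R) : continuous f ->
  forall r, exists M, forall x, `|x| <= r -> `|f x| <= M.
Proof.
move=> cf r.
have : compact (f @` (`[-r, r] `*` `[-r, r])).
  apply: continuous_compact; first exact: continuous_subspaceT.
  by apply: compact_setX; exact: segment_compact.
move=> /compact_bounded[M [_ MM]]; exists (M + 1) => x xr; apply: (MM (M + 1)).
  by rewrite ltrDl.
exists x => //; move: xr; rewrite norm2E ge_max !ler_norml => /andP[? ?].
by split; rewrite /= in_itv.
Qed.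

Lemma continuous_lbounded1 (f : R -> R) : continuous f ->
  forall r, exists M, forall x, `|x| <= r -> `|f x| <= M.
Proof.
move=> cf r.
have : compact (f @` `[-r, r]).
  apply: continuous_compact; first exact: continuous_subspaceT.
  exact: segment_compact.
move=> /compact_bounded[M [_ MM]]; exists (M + 1) => x xr; apply: (MM (M + 1)).
  by rewrite ltrDl.
by exists x => //; rewrite /= in_itv /= -ler_norml.
Qed.

Lemma continuous_bcs2 (f : R * R -> R) r : continuous f ->
  (forall x, r < `|x| -> f x = 0) -> bcs2 f.
Proof.
move=> cf f0; split; first exact: continuous_meas2.
have [M fM] := continuous_lbounded2 cf r.
exists (Num.max (Num.max M r) 0); split=> x.
  rewrite !le_max; have [xr|xr] := leP `|x| r; first by rewrite fM.
  by rewrite f0// normr0 lexx orbT.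
by rewrite !gt_max => /andP[/andP[_ ?] _]; exact: f0.
Qed.

Lemma continuous_bcs1 (f : R -> R) r : continuous f ->
  (forall x, r < `|x| -> f x = 0) -> bcs1 f.
Proof.
move=> cf f0; split; first exact: continuous_meas1.
have [M fM] := continuous_lbounded1 cf r.
exists (Num.max (Num.max M r) 0); split=> x.
  rewrite !le_max; have [xr|xr] := leP `|x| r; first by rewrite fM.
  by rewrite f0// normr0 lexx orbT.
by rewrite !gt_max => /andP[/andP[_ ?] _]; exact: f0.
Qed.

End PlaneMeasurability.

(** * Test functions *)

Section Smooth1.
Context {R : realType}.
Implicit Types f g : R -> R.

(* Coinductive reading of smoothness: f lies in a class closed under derivatives. *)
Definition smooth1 f : Prop := exists S : set (R -> R), S f /\
  forall g, S g -> exists2 g' : R -> R, (forall x : R, is_derive x (1 : R) g (g' x)) & S g'.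

Lemma smooth1_derive f : smooth1 f ->
  (forall x : R, is_derive x (1 : R) f (derive1 f x)) /\ smooth1 (derive1 f).
Proof.
move=> [S [Sf HS]]; have [f' df Sf'] := HS _ Sf.
have ff' : derive1 f = f' by apply/funext => x; rewrite derive1E; exact: derive_val.
by rewrite ff'; split => //; exists S.
Qed.

Lemma smooth1_continuous f : smooth1 f -> continuous f.
Proof.
move=> /smooth1_derive[df _] x; apply: differentiable_continuous.
by apply/derivable1_diffP; apply: ex_derive.
Qed.

Lemma smooth1_prim f g : (forall x : R, is_derive x (1 : R) f (g x)) -> smooth1 g ->
  smooth1 f.
Proof.
move=> df sg; exists (f |` smooth1); split; first by left.
move=> h [->|/smooth1_derive[dh sh]]; first by exists g => //; right.
by exists (derive1 h) => //; right.
Qed.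

Lemma smooth1_cst c : smooth1 (cst c).
Proof.
exists [set f | exists c, f = cst c]; split; first by exists c.
move=> _ [a ->]; exists (cst 0); last by exists 0.
by move=> x; exact: is_derive_cst.
Qed.

Lemma smooth1D f g : smooth1 f -> smooth1 g -> smooth1 (fun x => f x + g x).
Proof.
move=> sf sg.
exists [set h | exists f g, [/\ smooth1 f, smooth1 g & h = fun x => f x + g x]].
split; first by exists f, g.
move=> _ [u [v [/smooth1_derive[du su] /smooth1_derive[dv sv] ->]]].
exists (fun x => derive1 u x + derive1 v x); last by exists (derive1 u), (derive1 v).
by move=> x; exact: is_deriveD.
Qed.

(** Products of smooth functions alone are not closed under derivatives; by the Leibniz rule their
    finite sums are. *)
Inductive smooth1_alg : (R -> R) -> Prop :=
| Smooth1Mul f g : smooth1 f -> smooth1 g -> smooth1_alg (fun x => f x * g x)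
| Smooth1Add f g : smooth1_alg f -> smooth1_alg g ->
    smooth1_alg (fun x => f x + g x).

Lemma smooth1M f g : smooth1 f -> smooth1 g -> smooth1 (fun x => f x * g x).
Proof.
move=> sf sg; exists smooth1_alg; split; first exact: Smooth1Mul.
move=> h; elim=> {f g sf sg h} [f g sf sg|f g _ [f' df sf] _ [g' dg sg]].
  have [df sf'] := smooth1_derive sf; have [dg sg'] := smooth1_derive sg.
  exists (fun x => f x * derive1 g x + derive1 f x * g x).
    move=> x; have := @is_deriveM _ _ f g x 1 _ _ (df x) (dg x).
    by rewrite /GRing.scale/= (mulrC (g x)).
  by apply: Smooth1Add; exact: Smooth1Mul.
exists (fun x => f' x + g' x); last exact: Smooth1Add.
by move=> x; exact: is_deriveD.
Qed.

Lemma smooth1Z c f : smooth1 f -> smooth1 (fun x => c * f x).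
Proof. by apply: smooth1M; exact: smooth1_cst. Qed.

Lemma smooth1_affine f c d : smooth1 f -> smooth1 (fun x => f (c * x + d)).
Proof.
move=> sf.
exists [set h | exists a g, smooth1 g /\ h = fun x => a * g (c * x + d)].
split; first by exists 1, f; split=> //; apply/funext => x; rewrite mul1r.
move=> _ [a [g [/smooth1_derive[dg sg] ->]]].
exists (fun x => (a * c) * derive1 g (c * x + d)); last by exists (a * c), (derive1 g).
move=> x.
have dl : is_derive x 1 (fun x : R => c * x + d) c.
  have -> : (fun x : R => c * x + d) = (fun x => c *: x) \+ cst d by [].
  by apply: is_derive_eq; rewrite addr0 scaler1.
have := @is_derive1_comp _ g (fun x : R => c * x + d) x _ _ (dg (c * x + d)) dl.
move=> /(is_deriveZ a) H.
by apply: (is_derive_eq H); rewrite /GRing.scale/=; ring.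
Qed.

End Smooth1.

(** * A smooth function that is flat at the origin *)

Section Bump.
Context {R : realType}.
Implicit Types p : {poly R}.

(* The functions p(1/x) exp(-1/x), extended by 0, form a class closed under
   derivatives; hence each of them is smooth, also at 0. *)
Definition pexp p (x : R) : R := if 0 < x then p.[x^-1] * expR (- x^-1) else 0.

(** From [t <= i * expR (t / i)] follows [t ^+ i <= i ^+ i * expR t], which explains the weights
    [i ^+ i] in the constant; the monomial of degree 0 is treated apart because of the division. *)
Lemma poly_expR_bound p : exists2 C, 0 <= C & forall t : R, 0 <= t ->
  `|p.[t]| <= C * expR t.
Proof.
exists (\sum_(i < size p) `|p`_i| * i%:R ^+ i).
  by apply: sumr_ge0 => i _; rewrite mulr_ge0// exprn_ge0.
move=> t t0; rewrite horner_coef (le_trans (ler_norm_sum _ _ _))// mulr_suml.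
apply: ler_sum => i _; rewrite normrM -mulrA ler_wpM2l// ger0_norm ?exprn_ge0//.
have [->|i0] := posnP i; first by rewrite !expr0 mul1r -expR0 ler_expR.
have i0' : 0 < (i%:R : R) by rewrite ltr0n.
have -> : expR t = expR (t / i%:R) ^+ i.
  by rewrite -expRM_natl mulrC divfK// gt_eqF.
rewrite -exprMn lerXn2r ?nnegrE ?mulr_ge0 ?expR_ge0 ?(ltW i0')//.
have /(ler_wpM2l (ltW i0')) := expR_ge1Dx (t / i%:R).
by apply: le_trans; rewrite mulrDr mulr1 [X in _ + X]mulrC divfK ?gt_eqF// lerDr ltW.
Qed.

(** The exponential bound is applied to ['X^2 * p] at the point 1/x, which gains the factor x^2.
    Decay faster than linear is what the difference quotient at 0 needs. *)
Lemma pexp_bound p : exists2 C, 0 <= C & forall x, `|pexp p x| <= C * x ^+ 2.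
Proof.
have [C C0 HC] := poly_expR_bound ('X^2 * p); exists C => // x.
rewrite /pexp; case: ifPn => [x0|_]; last by rewrite normr0 mulr_ge0// sqr_ge0.
have xi0 : 0 < x^-1 by rewrite invr_gt0.
have := HC _ (ltW xi0).
rewrite hornerM hornerXn [in X in X -> _]normrM [`|_ ^+ 2|]ger0_norm ?exprn_ge0 ?(ltW xi0)// => H.
rewrite normrM (ger0_norm (expR_ge0 _)) expRN ler_pdivrMr ?expR_gt0//.
rewrite -(ler_pM2l (_ : 0 < x^-1 ^+ 2)) ?exprn_gt0//.
apply: le_trans H _; rewrite [leRHS](_ : _ = C * expR x^-1)//.
by field; rewrite gt_eqF.
Qed.

(** For x > 0 the derivative of 1/x contributes -x^-2, whence the factor ['X^2] and the sign of the
    derivative of [p]. At 0 the difference quotient is at most C |h| by [pexp_bound]. *)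
Lemma pexp_derive p x : is_derive x (1 : R) (pexp p) (pexp ('X^2 * (p - p^`())) x).
Proof.
have [x0|x0|<-] := ltgtP 0 x; last first.
- have [C C0 HC] := pexp_bound p.
  rewrite {2}/pexp ltxx.
  suff H : h^-1 *: ((pexp p \o shift (0:R)) (h *: (1:R)) - pexp p 0) @[h --> (0:R)^'] --> (0 : R).
    by apply: DeriveDef; [apply/cvg_ex; exists 0|exact: cvg_lim].
  apply/cvgr0Pnorm_le => e e0; near=> h.
  have h0 : h != 0 by near: h; exact: nbhs_dnbhs_neq.
  rewrite /= /shift/= {2}/pexp ltxx subr0 addr0 [_ *: (1:R)]mulr1.
  rewrite [_ *: _]mulrC normrM normfV ler_pdivrMr ?normr_gt0//.
  apply: (le_trans (HC h)); rewrite -(real_normK (num_real h)) expr2 mulrA.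
  rewrite ler_pM2r ?normr_gt0//.
  have : `|h| <= e / (C + 1).
    by near: h; apply: dnbhs0_le; rewrite divr_gt0// ltr_wpDl.
  rewrite ler_pdivlMr ?ltr_wpDl// => /(le_trans _); apply.
  by rewrite mulrC ler_wpM2l// lerDl.
- rewrite (_ : pexp _ x = 0); last by rewrite /pexp ltNge (ltW x0).
  apply: (@near_eq_is_derive _ _ _ (cst 0)).
  near=> y; by rewrite /pexp/= ltNge (ltW _)//; near: y; exact: lt_nbhsl.
- have dinv : is_derive x (1 : R) (fun y => y^-1 : R) (- x ^- 2).
    have xn0 : (id : R -> R) x != 0 by rewrite gt_eqF.
    have := @is_deriveV _ id x 1 1 xn0 (is_derive_id x 1).
    by move=> H; apply: (is_derive_eq H); rewrite /GRing.scale/= mulr1.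
  have dp : is_derive x (1 : R) (fun y => p.[y^-1]) (p^`().[x^-1] * - x ^- 2).
    exact: (@is_derive1_comp _ (horner p) (fun y => y^-1)).
  have dmi : is_derive x (1 : R) (fun y => - y^-1 : R) (x ^- 2).
    by apply: (is_derive_eq (is_deriveN dinv)); rewrite opprK.
  have de : is_derive x (1 : R) (fun y => expR (- y^-1)) (expR (- x^-1) * x ^- 2).
    exact: (@is_derive1_comp _ expR (fun y => - y^-1)).
  have dm := is_deriveM dp de.
  have dm' := is_derive_eq dm (_ : _ = pexp ('X^2 * (p - p^`())) x).
  apply: near_eq_is_derive (dm' _).
    near=> y; rewrite /pexp ifT//; near: y; exact: lt_nbhsr.
  rewrite /pexp x0 hornerM hornerXn hornerD hornerN /GRing.scale/=.
  by field; rewrite gt_eqF.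
Unshelve. all: by end_near. Qed.
End Bump.

(** * Test functions on an interval and their primitives *)

Section Tests1.
Context {R : realType}.
Local Notation mu := (@lebesgue_measure R).
Implicit Types f g : R -> R.

Lemma smooth1_pexp (p : {poly R}) : smooth1 (pexp p).
Proof.
exists [set f | exists p, f = pexp p]; split; first by exists p.
move=> _ [q ->]; exists (pexp ('X^2 * (q - q^`()))); last by eexists.
by move=> x; exact: pexp_derive.
Qed.

Definition psi : R -> R := pexp 1.

Lemma psi_ge0 x : 0 <= psi x.
Proof. by rewrite /psi /pexp hornerC mul1r; case: ifP => // _; exact: expR_ge0. Qed.

Lemma psi_le1 x : psi x <= 1.
Proof.
rewrite /psi /pexp hornerC mul1r; case: ifPn => // x0.
by rewrite -expR0 ler_expR lerNl oppr0 invr_ge0 ltW.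
Qed.

Lemma psi_gt0 x : 0 < x -> 0 < psi x.
Proof. by rewrite /psi /pexp hornerC mul1r => ->; exact: expR_gt0. Qed.

Lemma psi_eq0 x : x <= 0 -> psi x = 0.
Proof. by move=> x0; rewrite /psi /pexp ltNge x0. Qed.

Lemma psi_cvg x : psi (n.+1%:R * x) @[n --> \oo] --> ((0 < x)%R%:R : R).
Proof.
have [x0|x0] := ltP 0 x; last first.
  rewrite (_ : (fun _ => _) = cst 0); first exact: cvg_cst.
  by apply/funext => n; rewrite psi_eq0// mulr_ge0_le0.
have -> : (fun n => psi (n.+1%:R * x)) = (fun n => expR (- (x^-1 * harmonic n))).
  apply/funext => n; rewrite /psi /pexp hornerC mul1r ifT ?mulr_gt0 ?ltr0n//.
  by rewrite invfM mulrC.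
rewrite /= -[X in _ --> X](@expR0 R).
apply: continuous_cvg; first exact: continuous_expR.
rewrite -oppr0; apply: cvgN; rewrite -(mulr0 x^-1).
by apply: cvgMl_tmp; exact: cvg_harmonic.
Qed.

(** The values lie in [0, 1] and tend pointwise to the indicator of the open interval, by
    [bump_cvg]. Dominated convergence thus carries identities for test functions over to integrals
    on boxes. *)
Definition bump (a b : R) (n : nat) (x : R) : R :=
  psi (n.+1%:R * (x - a)) * psi (n.+1%:R * (b - x)).

Lemma smooth1_bump a b n : smooth1 (bump a b n).
Proof.
have H (c : R) (d : R) : smooth1 (fun x => psi (c * x + d)).
  by apply: smooth1_affine; exact: smooth1_pexp.
apply: smooth1M.
  have := H n.+1%:R (- (n.+1%:R * a)).
  by congr smooth1; apply/funext => x; rewrite mulrBr.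
have := H (- n.+1%:R) (n.+1%:R * b).
by congr smooth1; apply/funext => x; rewrite mulrBr mulNr addrC.
Qed.

Lemma bump_ge0 a b n x : 0 <= bump a b n x.
Proof. by rewrite mulr_ge0 ?psi_ge0. Qed.

Lemma bump_le1 a b n x : bump a b n x <= 1.
Proof. by rewrite mulr_ile1 ?psi_ge0 ?psi_le1. Qed.

Lemma bump_eq0 a b n x : ~~ (a < x < b) -> bump a b n x = 0.
Proof.
rewrite negb_and -!leNgt => /orP[H|H]; rewrite /bump.
  by rewrite psi_eq0 ?mul0r// mulr_ge0_le0// subr_le0.
by rewrite [X in _ * X]psi_eq0 ?mulr0// mulr_ge0_le0// subr_le0.
Qed.

Lemma bump_gt0 a b n x : a < x < b -> 0 < bump a b n x.
Proof.
by move=> /andP[ax xb]; rewrite mulr_gt0// psi_gt0// mulr_gt0// ?subr_gt0.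
Qed.

Lemma bump_cvg a b x : bump a b n x @[n --> \oo] --> ((a < x < b)%R%:R : R).
Proof.
rewrite -mulnb natrM -(subr_gt0 a) -(subr_gt0 x); apply: cvgM; exact: psi_cvg.
Qed.

Definition test1 (a b : R) f : Prop := smooth1 f /\
  exists a' b', [/\ a < a', b' < b & forall x, ~~ (a' <= x <= b') -> f x = 0].

Lemma test1_bump a a' b' b n : a < a' -> b' < b -> test1 a b (bump a' b' n).
Proof.
move=> aa bb; split; first exact: smooth1_bump.
exists a', b'; split=> // x /negP xab; apply: bump_eq0; apply/negP.
by move=> /andP[ax xb]; apply: xab; rewrite !ltW.
Qed.

Lemma test1_bcs a b f : test1 a b f -> bcs1 f.
Proof.
move=> [sf [a' [b' [aa bb f0]]]].
apply: (@continuous_bcs1 _ _ (Num.max `|a'| `|b'|)); first exact: smooth1_continuous.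
move=> x; rewrite gt_max => /andP[xa xb]; apply: f0; apply/negP => /andP[ax xb'].
have [x0|x0] := leP 0 x.
  by move: xb; rewrite ltNge (ger0_norm x0) (le_trans xb' (ler_norm _)).
move: xa; rewrite ltNge (ltr0_norm x0) -[X in _ <= X]normrN.
by rewrite (le_trans _ (ler_norm _))// lerN2.
Qed.

Lemma test1_derive a b f : test1 a b f ->
  (forall x, is_derive x (1 : R) f (derive1 f x)) /\ test1 a b (derive1 f).
Proof.
move=> [/smooth1_derive[df sf'] [a' [b' [aa bb f0]]]]; split=> //; split=> //.
exists a', b'; split=> // x xab; rewrite derive1E.
rewrite (@near_eq_derive _ _ _ _ (cst 0)) ?derive_cst//.
move: xab; rewrite negb_and -!ltNge => /orP[/lt_nbhsl|/lt_nbhsr];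
  by apply: filterS => y yab; apply: f0; rewrite negb_and -!ltNge yab ?orbT.
Qed.

Lemma test1D a b f g : test1 a b f -> test1 a b g ->
  test1 a b (fun x => f x + g x).
Proof.
move=> [sf [a1 [b1 [? ? f0]]]] [sg [a2 [b2 [? ? g0]]]]; split; first exact: smooth1D.
exists (Num.min a1 a2), (Num.max b1 b2); split; rewrite ?lt_min ?gt_max; [lra..|].
move=> x; rewrite ge_min le_max negb_and !negb_or => xab.
rewrite f0 ?g0 ?addr0// negb_and; case/orP: xab => /andP[n1 n2].
- by rewrite n2.
- by rewrite n2 orbT.
- by rewrite n1.
- by rewrite n1 orbT.
Qed.

Lemma test1Z a b c f : test1 a b f -> test1 a b (fun x => c * f x).
Proof.
move=> [sf [a1 [b1 [? ? f0]]]]; split; first exact: smooth1Z.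
by exists a1, b1; split=> // x /f0 ->; rewrite mulr0.
Qed.

Definition prim f (x : R) : R := \int[mu]_(t in `]-oo, x]) f t.

Lemma primP f : continuous f -> bcs1 f ->
  forall x, is_derive x (1 : R) (prim f) (f x).
Proof.
move=> cf bf x.
have [] := @continuous_FTC1 R f -oo%O x (x + 1) _ _ _ (cf x).
- by rewrite ltrDl.
- exact: integrableS (bcs1_integrable bf).
- exact: ltNyr.
by move=> dF <-; rewrite derive1E; exact: derivableP.
Qed.

Lemma prim_left f x : (forall t, t <= x -> f t = 0) -> prim f x = 0.
Proof.
move=> f0; rewrite /prim (@eq_Rintegral _ _ _ mu _ (cst 0)).
  by rewrite Rintegral_cst// mul0r.
by move=> t; rewrite inE /= in_itv /= => /f0.
Qed.

Lemma prim_right f x : (forall t, x < t -> f t = 0) -> prim f x = I1 f.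
Proof.
move=> f0; rewrite /prim Rintegral_mkcond; congr (I1 _); apply/funext => t.
rewrite patchE; case: ifPn => // /negP H; rewrite f0// ltNge; apply/negP => tx.
by apply: H; rewrite inE /= in_itv.
Qed.

(** To the right of the support of [f] the primitive equals the total integral, so mean zero is
    exactly what keeps its support compact. *)
Lemma test1_prim a b f : test1 a b f -> I1 f = 0 -> test1 a b (prim f).
Proof.
move=> tf f0; have [sf [a' [b' [aa bb fab]]]] := tf.
have cf := smooth1_continuous sf.
split; first by apply: (smooth1_prim _ sf); apply: primP => //; exact: test1_bcs tf.
exists a', b'; split=> // x; rewrite negb_and -!ltNge => /orP[xa|bx].
  apply: prim_left => t tx; apply: fab; rewrite negb_and -!ltNge.
  by rewrite (le_lt_trans tx xa).
rewrite prim_right// => t xt; apply: fab; rewrite negb_and -!ltNge.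
by rewrite (lt_trans bx xt) orbT.
Qed.

Lemma I1_ge0 f : (forall x, 0 <= f x) -> 0 <= I1 f.
Proof. by move=> f0; exact: Rintegral_ge0. Qed.

(** If the integral were 0, the primitive, which lies between 0 and the integral, would vanish
    identically, and so would its derivative at the midpoint, where the bump is positive. *)
Lemma I1_bump_gt0 a b n : a < b -> 0 < I1 (bump a b n).
Proof.
move=> ab; pose f := bump a b n.
have cf : continuous f by apply: smooth1_continuous; exact: smooth1_bump.
have bf : bcs1 f by apply: (@test1_bcs (a - 1) (b + 1)); apply: test1_bump; lra.
pose c := (a + b) / 2.
rewrite lt_neqAle I1_ge0 ?andbT; last by move=> x; exact: bump_ge0.
apply/eqP => I0.
have dF := primP cf bf.
have F0 x : prim f x = 0.
  apply/eqP; rewrite eq_le Rintegral_ge0 ?andbT; last by move=> ? _; exact: bump_ge0.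
  rewrite I0 /prim Rintegral_mkcond.
  apply: le_Rintegral => //; last 2 first.
  - exact: bcs1_integrable.
  - move=> t _; rewrite patchE; case: ifP => // _; exact: bump_ge0.
  rewrite -restrict_EFin; apply: (proj1 (integrable_mkcond _ _)) => //.
  by apply: integrableS (bcs1_integrable bf).
have : 0 < f c by apply: bump_gt0; rewrite /c; lra.
have <- : 'D_1 (prim f) c = f c by exact: derive_val.
by rewrite (_ : prim f = cst 0) ?derive_cst ?ltxx//; exact/funext.
Qed.

End Tests1.

(** * Smooth functions of two variables *)

Section Tests2.
Context {R : realType}.
Implicit Types (phi f g : R * R -> R) (Omega : set (R * R)).

(** Along any word of coordinate directions the iterated derivatives stay in [S]. This replaces
    inductions over words whenever a class closed under both partial derivatives is at hand. *)
Lemma smooth_coind (S : set (R * R -> R)) :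
  (forall phi, S phi -> [/\ forall x, differentiable phi x,
     S ('D_e1 phi) & S ('D_e2 phi)]) ->
  forall phi, S phi -> smooth phi.
Proof.
move=> HS phi Sphi w we; suff Sw : S (foldr (fun d h => 'D_d h) phi w) by have [] := HS _ Sw.
elim: w we => [//|d w IH] we /=.
have ww : {subset w <= [:: e1; e2]} by move=> v vw; apply: we; rewrite inE vw orbT.
have [_ S1 S2] := HS _ (IH ww).
have : d \in [:: e1; e2] by apply: we; rewrite inE eqxx.
by rewrite !inE => /orP[]/eqP ->.
Qed.

Lemma smooth_diff phi x : smooth phi -> differentiable phi x.
Proof. by move=> sp; apply: (sp [::]). Qed.

Lemma smooth_D phi d : d \in [:: e1; e2] -> smooth phi -> smooth ('D_d phi).
Proof.
move=> de sp w we x; have := sp (rcons w d) _ x; rewrite foldr_rcons; apply.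
by move=> v; rewrite mem_rcons inE => /orP[/eqP ->//|]; exact: we.
Qed.

Lemma e1_in : @e1 R \in [:: e1; e2]. Proof. by rewrite inE eqxx. Qed.
Lemma e2_in : @e2 R \in [:: e1; e2]. Proof. by rewrite !inE eqxx orbT. Qed.

Lemma smooth_continuous phi : smooth phi -> continuous phi.
Proof. by move=> sp x; apply: differentiable_continuous; exact: smooth_diff. Qed.

Lemma smooth_derivable phi x v : smooth phi -> derivable phi x v.
Proof. by move=> sp; apply: diff_derivable; exact: smooth_diff. Qed.

Lemma derive_smoothD f g v : smooth f -> smooth g ->
  'D_v (fun x => f x + g x) = fun x => 'D_v f x + 'D_v g x.
Proof.
by move=> sf sg; apply/funext => x; apply: deriveD; exact: smooth_derivable.
Qed.

Lemma derive_smoothM f g v : smooth f -> smooth g ->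
  'D_v (fun x => f x * g x) = fun x => f x * 'D_v g x + 'D_v f x * g x.
Proof.
move=> sf sg; apply/funext => x.
have := @deriveM _ _ f g x v (@smooth_derivable f x v sf) (@smooth_derivable g x v sg).
by rewrite /GRing.scale/= (mulrC (g x)).
Qed.

Lemma smooth_cst c : smooth (cst c : R * R -> R).
Proof.
apply: (@smooth_coind [set f | exists c, f = cst c]); last by exists c.
move=> _ [a ->]; split.
- by move=> x; exact: differentiable_cst.
- by exists 0; apply/funext => x; rewrite derive_cst.
- by exists 0; apply/funext => x; rewrite derive_cst.
Qed.

Inductive smooth_alg : (R * R -> R) -> Prop :=
| SmoothMul (f g : R * R -> R) : @smooth R f -> @smooth R g -> smooth_alg (fun x : R * R => f x * g x)
| SmoothAdd (f g : R * R -> R) : smooth_alg f -> smooth_alg g -> smooth_alg (fun x : R * R => f x + g x).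

Lemma smooth_alg_smooth phi : smooth_alg phi -> smooth phi.
Proof.
apply: smooth_coind => {}phi; elim=> {phi} [f g sf sg|f g _ [df f1 f2] _ [dg g1 g2]].
  split.
  - by move=> x; apply: differentiableM; exact: smooth_diff.
  - by rewrite derive_smoothM//; apply: SmoothAdd; apply: SmoothMul => //;
      apply: smooth_D => //; exact: e1_in.
  - by rewrite derive_smoothM//; apply: SmoothAdd; apply: SmoothMul => //;
      apply: smooth_D => //; exact: e2_in.
have DD v : 'D_v (fun x => f x + g x) = fun x => 'D_v f x + 'D_v g x.
  by apply/funext => x; apply: deriveD; exact: diff_derivable.
split.
- by move=> x; exact: differentiableD.
- by rewrite DD; exact: SmoothAdd.
- by rewrite DD; exact: SmoothAdd.
Qed.

Lemma smoothM f g : smooth f -> smooth g -> smooth (fun x : R * R => f x * g x).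
Proof. by move=> sf sg; apply: smooth_alg_smooth; exact: SmoothMul. Qed.

Lemma smoothD f g : smooth f -> smooth g -> smooth (fun x : R * R => f x + g x).
Proof.
move=> sf sg.
have sa h : smooth h -> smooth_alg h.
  move=> /SmoothMul /(_ (smooth_cst 1)); congr smooth_alg.
  by apply/funext => x; rewrite mulr1.
by apply: smooth_alg_smooth; apply: SmoothAdd; exact: sa.
Qed.

Lemma smoothZ c f : smooth f -> smooth (fun x : R * R => c * f x).
Proof. by apply: smoothM; exact: smooth_cst. Qed.

Lemma derive_smoothZ c f v : smooth f ->
  'D_v (fun x => c * f x) = fun x => c * 'D_v f x.
Proof.
move=> sf; rewrite derive_smoothM//; last exact: smooth_cst.
by apply/funext => x; rewrite derive_cst mul0r addr0.
Qed.

(** The two difference quotients are the same function of [h], so derivability and the derivative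
    pass to sections as plain equalities, whatever the regularity of [phi]. *)
Lemma quotient_xsection phi (x y : R) :
  (fun h : R => h^-1 *: ((phi \o shift (x, y)) (h *: e1) - phi (x, y))) =
  (fun h : R => h^-1 *: (((fun t => phi (t, y)) \o shift x) (h *: (1 : R)) - phi (x, y))).
Proof.
apply/funext => h; rewrite /shift/=; congr (_ *: (phi _ - _)).
by rewrite [LHS]surjective_pairing /= [h *: (0 : R)]mulr0 add0r.
Qed.

Lemma quotient_ysection phi (x y : R) :
  (fun h : R => h^-1 *: ((phi \o shift (x, y)) (h *: e2) - phi (x, y))) =
  (fun h : R => h^-1 *: (((fun t => phi (x, t)) \o shift y) (h *: (1 : R)) - phi (x, y))).
Proof.
apply/funext => h; rewrite /shift/=; congr (_ *: (phi _ - _)).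
by rewrite [LHS]surjective_pairing /= [h *: (0 : R)]mulr0 add0r.
Qed.

Lemma derivable_xsection phi (x y : R) :
  derivable phi (x, y) e1 = derivable (fun t => phi (t, y)) x (1 : R).
Proof. by rewrite /derivable quotient_xsection. Qed.

Lemma derivable_ysection phi (x y : R) :
  derivable phi (x, y) e2 = derivable (fun t => phi (x, t)) y (1 : R).
Proof. by rewrite /derivable quotient_ysection. Qed.

Lemma derive_xsection phi (x y : R) :
  'D_e1 phi (x, y) = derive1 (fun t => phi (t, y)) x.
Proof. by rewrite derive1E /derive quotient_xsection. Qed.

Lemma derive_ysection phi (x y : R) :
  'D_e2 phi (x, y) = derive1 (fun t => phi (x, t)) y.
Proof. by rewrite derive1E /derive quotient_ysection. Qed.

Lemma smooth_xsection phi x y : smooth phi ->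
  is_derive x (1 : R) (fun t => phi (t, y)) ('D_e1 phi (x, y)).
Proof.
move=> sp; rewrite derive_xsection derive1E; apply: derivableP.
by rewrite -derivable_xsection; exact: smooth_derivable.
Qed.

Lemma smooth_ysection phi x y : smooth phi ->
  is_derive y (1 : R) (fun t => phi (x, t)) ('D_e2 phi (x, y)).
Proof.
move=> sp; rewrite derive_ysection derive1E; apply: derivableP.
by rewrite -derivable_ysection; exact: smooth_derivable.
Qed.

Definition tens (f g : R -> R) (x : R * R) : R := f x.1 * g x.2.

Lemma derive_tens1 (f g : R -> R) : (forall x, derivable f x (1 : R)) ->
  'D_e1 (tens f g) = tens (derive1 f) g.
Proof.
move=> df; apply/funext => -[x y]; rewrite derive_xsection /tens/=.
rewrite (_ : (fun t => _) = g y \*: f); last first.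
  by apply/funext => t; rewrite [LHS]mulrC.
by rewrite !derive1E deriveZ// [LHS]mulrC.
Qed.

Lemma derive_tens2 (f g : R -> R) : (forall x, derivable g x (1 : R)) ->
  'D_e2 (tens f g) = tens f (derive1 g).
Proof.
move=> df; apply/funext => -[x y]; rewrite derive_ysection /tens/=.
by rewrite !derive1E deriveZ.
Qed.

Lemma smooth_tens (f g : R -> R) : smooth1 f -> smooth1 g -> smooth (tens f g).
Proof.
move=> sf sg; apply: (@smooth_coind [set h | exists f g : R -> R,
  [/\ smooth1 f, smooth1 g & h = tens f g]]); last by exists f, g.
move=> _ [u [v [/smooth1_derive[du su] /smooth1_derive[dv sv] ->]]].
have su' := smooth1_prim du su; have sv' := smooth1_prim dv sv.
split.
- move=> x; apply: (@differentiableM _ _ (u \o fst) (v \o snd)).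
    apply: differentiable_comp; last by apply/derivable1_diffP; apply: ex_derive.
    by apply: linear_differentiable => z; exact: cvg_fst.
  apply: differentiable_comp; last by apply/derivable1_diffP; apply: ex_derive.
  by apply: linear_differentiable => z; exact: cvg_snd.
- rewrite derive_tens1; last by move=> x; apply: ex_derive.
  by exists (derive1 u), v; split.
- rewrite derive_tens2; last by move=> x; apply: ex_derive.
  by exists u, (derive1 v); split.
Qed.

End Tests2.

(** * Test functions in the plane and integration by parts *)

Section TestFunctions.
Context {R : realType}.
Local Notation mu := (@lebesgue_measure R).
Implicit Types (phi : R * R -> R) (Omega : set (R * R)).

Lemma test_smooth Omega phi : test_function Omega phi -> smooth phi.
Proof. by case. Qed.

Lemma test_bounded_support Omega phi : test_function Omega phi ->
  exists r, forall x, r < `|x| -> phi x = 0.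
Proof.
move=> [_ [K [/compact_bounded[M [_ MM]] _ phi0]]]; exists (M + 1) => x Mx.
apply: phi0 => Kx; have MM1 : M < M + 1 by rewrite ltrDl.
by have := MM _ MM1 x Kx; rewrite /= leNgt Mx.
Qed.

Lemma test_out Omega phi x : test_function Omega phi -> ~ Omega x -> phi x = 0.
Proof. by move=> [_ [K [_ KO phi0]]] xO; apply: phi0 => /KO. Qed.

Lemma test_sub Omega Omega' phi : Omega `<=` Omega' ->
  test_function Omega phi -> test_function Omega' phi.
Proof.
move=> OO [sp [K [cK KO phi0]]]; split=> //; exists K; split => //.
exact: subset_trans OO.
Qed.

Lemma hausdorff_plane : hausdorff_space (R * R)%type.
Proof. exact: norm_hausdorff. Qed.

Lemma test_D Omega phi d : d \in [:: e1; e2] -> test_function Omega phi ->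
  test_function Omega ('D_d phi).
Proof.
move=> de [sp [K [cK KO phi0]]]; split; first exact: smooth_D.
exists K; split=> // x Kx.
rewrite (@near_eq_derive _ _ _ _ (cst 0)) ?derive_cst//.
have : nbhs x (~` K).
  apply: open_nbhs_nbhs; split=> //; apply: closed_openC.
  by apply: compact_closed => //; exact: hausdorff_plane.
by apply: filterS => y /phi0.
Qed.

Lemma test_M Omega phi g : smooth g -> test_function Omega phi ->
  test_function Omega (fun x => g x * phi x).
Proof.
move=> sg [sp [K [cK KO phi0]]]; split; first exact: smoothM.
by exists K; split=> // x /phi0 ->; rewrite mulr0.
Qed.

Lemma test_Z Omega phi c : test_function Omega phi ->
  test_function Omega (fun x => c * phi x).
Proof. by apply: test_M; exact: smooth_cst. Qed.

Lemma test_add Omega phi1 phi2 : test_function Omega phi1 ->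
  test_function Omega phi2 -> test_function Omega (fun x => phi1 x + phi2 x).
Proof.
move=> [s1 [K1 [c1 K1O phi10]]] [s2 [K2 [c2 K2O phi20]]].
split; first exact: smoothD.
exists (K1 `|` K2); split; first exact: compactU.
  by move=> x [/K1O|/K2O].
by move=> x /not_orP[/phi10 -> /phi20 ->]; rewrite addr0.
Qed.

Lemma test_bcs Omega phi : test_function Omega phi -> bcs2 phi.
Proof.
move=> tp; have [r phi0] := test_bounded_support tp.
by apply: (@continuous_bcs2 _ _ r) => //; apply: smooth_continuous; case: tp.
Qed.

Lemma test_D1_bcs Omega phi : test_function Omega phi -> bcs2 ('D_e1 phi).
Proof. by move=> tp; apply: test_bcs; apply: test_D tp; exact: e1_in. Qed.

Lemma test_D2_bcs Omega phi : test_function Omega phi -> bcs2 ('D_e2 phi).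
Proof. by move=> tp; apply: test_bcs; apply: test_D tp; exact: e2_in. Qed.

Lemma test_tens a b c d (f g : R -> R) : test1 a b f -> test1 c d g ->
  test_function (box a b c d) (tens f g).
Proof.
move=> [sf [a' [b' [aa bb f0]]]] [sg [c' [d' [cc dd g0]]]].
split; first exact: smooth_tens.
exists (`[a', b'] `*` `[c', d']); split.
- by apply: compact_setX; exact: segment_compact.
- move=> x [/=]; rewrite !in_itv/= => /andP[? ?] /andP[? ?].
  by split; lra.
- move=> x /= xK; rewrite /tens.
  have [xa|xa] := boolP (a' <= x.1 <= b'); last by rewrite f0// mul0r.
  rewrite g0 ?mulr0//; apply/negP => xc; apply: xK.
  by rewrite !in_itv.
Qed.

Lemma I2_setE Omega (f : R * R -> R) : (forall x, ~ Omega x -> f x = 0) ->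
  \int[leb2]_(x in Omega) f x = I2 f.
Proof.
move=> f0; rewrite Rintegral_mkcond; congr (Rintegral _ _ _); apply/funext => x.
by rewrite patchE; case: ifPn => // /negP; rewrite inE => /f0 ->.
Qed.

Lemma derive_out (f f' : R -> R) r :
  (forall x : R, is_derive x (1 : R) f (f' x)) ->
  (forall x, r < `|x| -> f x = 0) -> forall x, r < `|x| -> f' x = 0.
Proof.
move=> df f0 x rx; rewrite -[LHS](@derive_val _ _ _ _ _ _ _ (df x)).
rewrite (@near_eq_derive _ _ _ _ (cst 0)) ?derive_cst//.
near=> y; apply: f0; near: y.
by apply: cvgr_norm_gt rx; exact: cvg_id.
Unshelve. all: by end_near. Qed.

(** The fundamental theorem on the half-line to the right of [t], where [f] vanishes at infinity.
    The half-line appears as a factor of the integrand so that the order of integration can later be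
    exchanged. *)
Lemma I1_FTC_right (f f' : R -> R) r t :
  (forall x : R, is_derive x (1 : R) f (f' x)) -> continuous f' ->
  (forall x, r < `|x| -> f x = 0) ->
  I1 (fun y => (t < y)%R%:R * f' y) = - f t.
Proof.
move=> df cf' f0; have f'0 := derive_out df f0.
(* A point to the right both of [t] and of the support, so that [f b = 0]. *)
pose b := Num.max t `|r| + 1.
have tb : t < b by rewrite /b ltr_pwDr// le_max lexx.
have rb x : b <= x -> r < `|x|.
  move=> bx; apply: lt_le_trans (ler_norm x).
  by apply: lt_le_trans bx; rewrite /b ltr_pwDr// le_max (ler_norm r) orbT.
have cf : continuous f.
  by move=> x; apply: differentiable_continuous; apply/derivable1_diffP; apply: ex_derive.
have F : (\int[mu]_(x in `[t, b]) (f' x)%:E = (f b)%:E - (f t)%:E)%E.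
  apply: continuous_FTC2 => //.
  - exact: continuous_subspaceT.
  - split; first by move=> x _; apply: ex_derive.
      by apply: cvg_at_right_filter; exact: cf.
    by apply: cvg_at_left_filter; exact: cf.
  - by move=> x _; rewrite derive1E; exact: derive_val.
transitivity (\int[mu]_(x in `[t, b]) f' x); last first.
  by rewrite /Rintegral F /= f0 ?rb ?lexx// sub0r.
rewrite -Rintegral_itv_obnd_cbnd; last first.
  have bf' : bcs1 f' by apply: continuous_bcs1 cf' f'0.
  exact: integrableS (bcs1_integrable bf').
rewrite Rintegral_mkcond; congr (I1 _); apply/funext => x.
rewrite patchE mem_setE in_itv/=.
have [tx|tx] := ltP t x => /=; last by rewrite mul0r.
by rewrite mul1r; have [//|bx] := leP x b; rewrite f'0// rb// ltW.
Qed.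

Lemma I1_derive_eq0 (f f' : R -> R) r :
  (forall x : R, is_derive x (1 : R) f (f' x)) -> continuous f' ->
  (forall x, r < `|x| -> f x = 0) -> I1 f' = 0.
Proof.
move=> df cf' f0; have f'0 := derive_out df f0.
(* To the left of the support, so that the half-line beyond [t] carries the whole integral and
   [f t = 0]. *)
pose t := - (`|r| + 1).
have rt x : x <= t -> r < `|x|.
  rewrite /t lerNr => xt; rewrite -normrN (lt_le_trans _ (ler_norm _))//.
  by apply: lt_le_trans xt; rewrite ltr_pwDr// ler_norm.
have := I1_FTC_right t df cf' f0; rewrite f0 ?rt// oppr0 => <-.
congr (I1 _); apply/funext => x; have [_|xt] := ltP t x; first by rewrite mul1r.
by rewrite mul0r f'0// rt.
Qed.

Lemma continuous_pairl (y : R) : continuous (fun x : R => (x, y)).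
Proof.
move=> x; apply/cvgrPdist_lt => e e0; near=> t.
rewrite norm2E /= subrr normr0 gt_max e0 andbT; near: t.
exact: cvgr_dist_lt.
Unshelve. all: by end_near. Qed.

Lemma continuous_pairr (x : R) : continuous (fun y : R => (x, y)).
Proof.
move=> y; apply/cvgrPdist_lt => e e0; near=> t.
rewrite norm2E /= subrr normr0 gt_max e0 /=; near: t.
exact: cvgr_dist_lt.
Unshelve. all: by end_near. Qed.

Lemma I2_D1_eq0 Omega phi : test_function Omega phi -> I2 ('D_e1 phi) = 0.
Proof.
move=> tp; rewrite I2_yx; last exact: test_D1_bcs tp.
have [r phi0] := test_bounded_support tp.
rewrite (_ : (fun _ => _) = cst 0); first by rewrite /I1 Rintegral_cst// mul0r.
apply/funext => y; apply: (@I1_derive_eq0 (fun x => phi (x, y)) _ r).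
- by move=> x; apply: smooth_xsection; case: tp.
- move=> x; apply: (@continuous_comp _ _ _ (fun x => (x, y)) ('D_e1 phi)).
    exact: continuous_pairl.
  by apply: smooth_continuous; apply: smooth_D; [exact: e1_in|case: tp].
- by move=> x rx; apply: phi0; rewrite norm2E lt_max rx.
Qed.

Lemma I2_D2_eq0 Omega phi : test_function Omega phi -> I2 ('D_e2 phi) = 0.
Proof.
move=> tp; rewrite I2_xy; last exact: test_D2_bcs tp.
have [r phi0] := test_bounded_support tp.
rewrite (_ : (fun _ => _) = cst 0); first by rewrite /I1 Rintegral_cst// mul0r.
apply/funext => x; apply: (@I1_derive_eq0 (fun y => phi (x, y)) _ r).
- by move=> y; apply: smooth_ysection; case: tp.
- move=> y; apply: (@continuous_comp _ _ _ (fun y => (x, y)) ('D_e2 phi)).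
    exact: continuous_pairr.
  by apply: smooth_continuous; apply: smooth_D; [exact: e2_in|case: tp].
- by move=> y ry; apply: phi0; rewrite norm2E lt_max ry orbT.
Qed.

Lemma smooth_bcsM Omega phi g : smooth g -> test_function Omega phi ->
  bcs2 (fun x => g x * phi x).
Proof. by move=> sg /(test_M sg)/test_bcs. Qed.

(** The product [g * phi] is again a test function, so the integral of its derivative vanishes, and
    the Leibniz rule splits it. *)
Lemma ibp1 Omega phi g : smooth g -> test_function Omega phi ->
  I2 (fun x => g x * 'D_e1 phi x) = - I2 (fun x => 'D_e1 g x * phi x).
Proof.
move=> sg tp; have sp := test_smooth tp.
have := I2_D1_eq0 (test_M sg tp); rewrite derive_smoothM// I2D//.
- by move/eqP; rewrite addr_eq0 => /eqP.
- by apply: smooth_bcsM => //; apply: test_D tp; exact: e1_in.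
- by apply: smooth_bcsM tp; apply: smooth_D => //; exact: e1_in.
Qed.

Lemma ibp2 Omega phi g : smooth g -> test_function Omega phi ->
  I2 (fun x => g x * 'D_e2 phi x) = - I2 (fun x => 'D_e2 g x * phi x).
Proof.
move=> sg tp; have sp := test_smooth tp.
have := I2_D2_eq0 (test_M sg tp); rewrite derive_smoothM// I2D//.
- by move/eqP; rewrite addr_eq0 => /eqP.
- by apply: smooth_bcsM => //; apply: test_D tp; exact: e2_in.
- by apply: smooth_bcsM tp; apply: smooth_D => //; exact: e2_in.
Qed.

End TestFunctions.

(** * Potentials on a rectangle *)

Section FundamentalLemma.
Context {R : realType}.
Local Notation mR := (measurableTypeR R).
Local Notation mR2 := (measurableTypeR R * measurableTypeR R)%type.
Implicit Types (u : R * R -> R).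

Definition boxes : set (set (R * R)) :=
  [set A | exists a b c d, A = box a b c d].

Lemma boxI a b c d a' b' c' d' : box a b c d `&` box a' b' c' d' =
  box (Num.max a a') (Num.min b b') (Num.max c c') (Num.min d d') :> set (R * R).
Proof.
apply/seteqP; split => x; rewrite /box /= !gt_max !lt_min.
  by move=> [[-> -> -> ->] [-> -> -> ->]].
by move=> [/andP[-> ->] /andP[-> ->] /andP[-> ->] /andP[-> ->]].
Qed.

(** Open strips are countable unions of boxes, so both projections are measurable for the
    sigma-algebra generated by boxes. The boxes are moreover closed under intersection, which
    prepares a Dynkin argument. *)
Lemma measurable_boxesE : (@measurable _ mR2) = <<s boxes >>.
Proof.
apply/seteqP; split; last first.
  apply: smallest_sub; first exact: sigma_algebra_measurable.
  by move=> _ [a [b [c [d ->]]]]; exact: measurable_box.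
pose T := @g_sigma_algebraType (R * R)%type boxes.
have bigb (a b c d : R) : (@measurable _ T) (box a b c d).
  by apply: sub_sigma_algebra; exists a, b, c, d.
have m1 : @measurable_fun _ _ T mR setT fst.
  apply: (measurability _ (RGenOpens.measurableE R)) => //.
  move=> _ [_ [a [b ->] <-]]; rewrite setTI.
  have -> : (fst : T -> R) @^-1` `]a, b[%classic = \bigcup_n box a b (- n%:R) n%:R.
    apply/seteqP; split=> [x /=|x [n _ [/= ? ? _ _]]]; rewrite in_itv/=; last exact/andP.
    move=> /andP[? ?]; have xn := archi_boundP (normr_ge0 x.2).
    by exists (Num.bound `|x.2|) => //; move: xn; rewrite ltr_norml => /andP[? ?]; split.
  by apply: bigcupT_measurable => n; exact: bigb.
have m2 : @measurable_fun _ _ T mR setT snd.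
  apply: (measurability _ (RGenOpens.measurableE R)) => //.
  move=> _ [_ [a [b ->] <-]]; rewrite setTI.
  have -> : (snd : T -> R) @^-1` `]a, b[%classic = \bigcup_n box (- n%:R) n%:R a b.
    apply/seteqP; split=> [x /=|x [n _ [/= _ _ ? ?]]]; rewrite in_itv/=; last exact/andP.
    move=> /andP[? ?]; have xn := archi_boundP (normr_ge0 x.1).
    by exists (Num.bound `|x.1|) => //; move: xn; rewrite ltr_norml => /andP[? ?]; split.
  by apply: bigcupT_measurable => n; exact: bigb.
have mid : @measurable_fun _ _ T mR2 setT id by apply/measurable_fun_pairP.
by move=> A mA; have := mid measurableT A mA; rewrite setTI.
Qed.

(** The sets on which the charge with density [u] vanishes form a Dynkin system containing the
    boxes, hence contain all measurable sets. The support of [u] lies in a box, so the whole plane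
    has charge zero too. *)
Lemma ae_eq0_box u a0 b0 c0 d0 : leb2.-integrable setT (EFin \o u) ->
  (forall x, ~ box a0 b0 c0 d0 x -> u x = 0) ->
  (forall a b c d, \int[leb2]_(x in box a b c d) u x = 0) ->
  {ae leb2, forall x, u x = 0}.
Proof.
move=> iu us u0.
pose nu := induced_charge iu.
have fin A : measurable A -> nu A = (\int[leb2]_(x in A) u x)%:E.
  move=> mA; rewrite /nu /induced_charge /Rintegral fineK//.
  by apply: integrable_fin_num => //; apply: (integrableS _ _ _ iu).
pose H (A : set mR2) := measurable A /\ nu A = 0%E.
have HT : H setT.
  by split => //; rewrite fin// -[Rintegral _ _ _]/(I2 u) -(I2_setE us) u0.
have DH : dynkin H.
  split=> //.
  - move=> A [mA A0]; split; first exact: measurableC.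
    have -> : nu (~` A) = (nu setT - nu A)%E.
      have := @chargeD _ _ _ (induced_charge iu) setT A measurableT mA.
      by rewrite setTD setTI.
    by rewrite A0 HT.2 sube0.
  - move=> F tF HF; have mF n : measurable (F n) by case: (HF n).
    split; first exact: bigcupT_measurable.
    have : (fun n => \sum_(0 <= i < n) nu (F i))%E @ \oo --> nu (\bigcup_n F n).
      have X := (@charge_semi_sigma_additive _ _ _ (induced_charge iu) F mF tF).
      by apply: X; exact: bigcupT_measurable.
    rewrite (_ : (fun _ => _) = cst 0%E); last first.
      by apply/funext => n; rewrite big1// => i _; case: (HF i).
    by move=> h; apply: (cvg_unique (@ereal_hausdorff R) h); exact: cvg_cst.
have sub : (@measurable _ mR2) `<=` H.
  rewrite measurable_boxesE; apply: lambda_system_subset => //.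
  - move=> _ _ [a [b [c [d ->]]]] [a' [b' [c' [d' ->]]]]; rewrite boxI.
    by do 4 eexists.
  - exact/dynkin_lambda_system.
  - move=> _ [a [b [c [d ->]]]]; split; first exact: measurable_box.
    rewrite fin ?u0//; exact: measurable_box.
have : ae_eq leb2 setT (EFin \o u) (cst 0%E).
  apply: integral_ae_eq => // E _ mE.
  by rewrite integral_cst// mul0e; exact: (sub _ mE).2.
by apply: filterS => x /= /(_ I) [].
Qed.

(** Tensor products of bumps tend to the indicator of a smaller box while [u] dominates, so [u] has
    integral zero over every box well inside. Near each point [ae_eq0_box] then applies to [u] cut
    off to a small ball. *)
Lemma fundamental u a b c d : leb2.-integrable (box a b c d) (EFin \o u) ->
  (forall f g, test1 a b f -> test1 c d g ->
     \int[leb2]_(x in box a b c d) (u x * tens f g x) = 0) ->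
  {ae leb2, forall x, box a b c d x -> u x = 0}.
Proof.
set B := box a b c d => iu Hu.
have mB : measurable (B : set mR2) by exact: measurable_box.
have step1 a' b' c' d' : a < a' -> b' < b -> c < c' -> d' < d ->
    \int[leb2]_(x in box a' b' c' d') u x = 0.
  move=> aa bb cc dd; set B' := box a' b' c' d'.
  have mB' : measurable (B' : set mR2) by exact: measurable_box.
  have BB : B' `<=` B by move=> x [? ? ? ?]; split; lra.
  pose F n (x : mR2) := u x * tens (bump a' b' n) (bump c' d' n) x.
  have F0 n : \int[leb2]_(x in B) F n x = 0 by apply: Hu; exact: test1_bump.
  have mu_ : measurable_fun B u by apply/measurable_EFinP; case/integrableP: iu.
  have mt n : meas2 (tens (bump a' b' n) (bump c' d' n)).
    by apply: continuous_meas2; apply: smooth_continuous; apply: smooth_tens; exact: smooth1_bump.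
  have mF n : measurable_fun B (F n).
    by apply: measurable_funM => //; apply: measurable_funTS; exact: mt.
  have Fle n x : `|F n x| <= `|u x|.
    rewrite normrM; apply: ler_piMr => //.
    rewrite /tens ger0_norm; last by apply: mulr_ge0; exact: bump_ge0.
    by apply: mulr_ile1; rewrite ?bump_ge0 ?bump_le1.
  have H1 m : measurable_fun B (EFin \o F m) by exact/measurable_EFinP.
  have H2 : measurable_fun B (EFin \o (u \_ B')).
    apply/measurable_EFinP; apply/measurable_restrict => //.
    by apply: measurable_funS mu_ => // x [].
  have H3 : {ae leb2, forall x, B x -> (EFin \o F n) x @[n --> \oo] --> (EFin \o (u \_ B')) x}.
    apply: aeW => z _; apply: cvg_EFin; first exact: nearW.
    rewrite (_ : _ \o _ = F ^~ z)// patchE.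
    have -> : (if z \in B' then u z else 0) = u z * ((a' < z.1 < b')%R%:R * (c' < z.2 < d')%R%:R).
      case: ifPn; first by rewrite inE => -[-> -> -> ->]; rewrite !mulr1.
      move=> /negP; rewrite inE => nB; case: andP => [[? ?]|]; last by rewrite mul0r mulr0.
      case: andP => [[? ?]|]; last by rewrite !mulr0.
      by exfalso; apply: nB.
    apply: cvgMl_tmp; apply: cvgM; exact: bump_cvg.
  have H4 : leb2.-integrable B (abse \o (EFin \o u)) by exact: integrable_abse.
  have H5 : {ae leb2, forall x n, B x -> (`|(EFin \o F n) x| <= (abse \o (EFin \o u)) x)%E}.
    by apply: aeW => z m _ /=; rewrite lee_fin; exact: Fle.
  have [iuB _] := dominated_convergence mB H1 H2 H3 H4 H5.
  have iF n : leb2.-integrable B (EFin \o F n).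
    apply: (le_integrable mB (H1 n) _ H4) => z _ /=; rewrite lee_fin normr_id; exact: Fle.
  rewrite (_ : (fun _ => _) = cst 0%E); last first.
    apply/funext => n; have := F0 n; rewrite /Rintegral => F0'.
    by rewrite -[LHS]fineK ?F0'//; exact: integrable_fin_num.
  move=> h; have {}h := cvg_unique (@ereal_hausdorff R) h (cvg_cst _).
  have -> : B' = B `&` B' by apply/esym; exact: setIidr.
  by rewrite Rintegral_mkcondr /Rintegral h.
apply: ae_local => p [ap pb cp pd].
(* Half the distance to the sides: the ball then keeps a positive distance from them, as [step1]
   requires. *)
pose r := Num.min (Num.min (p.1 - a) (b - p.1)) (Num.min (p.2 - c) (d - p.2)) / 2.
have r0 : 0 < r by rewrite /r divr_gt0// !lt_min !subr_gt0 ap pb cp pd.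
have [ra [rb [rc rd]]] : a < p.1 - r /\ p.1 + r < b /\ c < p.2 - r /\ p.2 + r < d.
  have : r * 2 <= Num.min (Num.min (p.1 - a) (b - p.1)) (Num.min (p.2 - c) (d - p.2)).
    by rewrite /r divfK.
  by rewrite !le_min => /andP[/andP[? ?] /andP[? ?]]; do ![split]; lra.
exists r => //; rewrite ball_box; set B' := box _ _ _ _.
have mB' : measurable (B' : set mR2) by exact: measurable_box.
have BB : B' `<=` B by move=> x [? ? ? ?]; split; lra.
have H : {ae leb2, forall x, (u \_ B') x = 0}.
  apply: (@ae_eq0_box _ (p.1 - r) (p.1 + r) (p.2 - r) (p.2 + r)).
  - rewrite -restrict_EFin; apply: (proj1 (integrable_mkcond _ mB')).
    exact: integrableS iu.
  - by move=> x xB; rewrite patchE; case: ifPn => //; rewrite inE => /xB.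
  - move=> a' b' c' d'; rewrite -Rintegral_mkcondr boxI; apply: step1.
    + by rewrite lt_max ra orbT.
    + by rewrite gt_min rb orbT.
    + by rewrite lt_max rc orbT.
    + by rewrite gt_min rd orbT.
apply: negligibleS H => z /= nP h; apply: nP => B'z _.
by move: h; rewrite patchE mem_set.
Qed.
End FundamentalLemma.

(** * Functions with vanishing weak gradient *)

Section ZeroGradient.
Context {R : realType}.
Local Notation mR2 := (measurableTypeR R * measurableTypeR R)%type.

Implicit Types f g : R -> R.

Lemma exists_unit_test1 (a b : R) : a < b -> exists2 f, test1 a b f & I1 f = 1.
Proof.
move=> ab; pose a' := a + (b - a) / 3; pose b' := b - (b - a) / 3.
have I0 : 0 < I1 (bump a' b' 0) by apply: I1_bump_gt0; rewrite /a' /b'; lra.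
have tb : test1 a b (bump a' b' 0) by apply: test1_bump; rewrite /a' /b'; lra.
exists (fun x => (I1 (bump a' b' 0))^-1 * bump a' b' 0 x); first exact: test1Z.
by rewrite I1Z ?mulVf ?gt_eqF//; exact: test1_bcs tb.
Qed.

Lemma integrable_mul_bounded (B : set mR2) (u h : R * R -> R) : measurable B ->
  leb2.-integrable B (EFin \o u) -> bcs2 h ->
  leb2.-integrable B (EFin \o (fun x => u x * h x)).
Proof.
move=> mB iu [mh [M [hM _]]].
have mu_ : measurable_fun B u by apply/measurable_EFinP; case/integrableP: iu.
have iMu : leb2.-integrable B (fun x => M%:E * (EFin \o u) x)%E by exact: integrableZl.
apply: (le_integrable mB _ _ iMu).
  by apply/measurable_EFinP/measurable_funM => //; exact: measurable_funTS.
by move=> x _ /=; rewrite lee_fin !normrM mulrC ler_wpM2r// (le_trans (hM x))// ler_norm.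
Qed.

Lemma integrable_mull (B : set mR2) (u : R * R -> R) r : measurable B ->
  leb2.-integrable B (EFin \o u) -> leb2.-integrable B (EFin \o (fun x => r * u x)).
Proof.
by move=> mB iu; exact: (integrableZl mB r iu).
Qed.

Lemma bcs2_tens f g : bcs1 f -> bcs1 g -> bcs2 (tens f g).
Proof.
move=> [mf [M [fM f0]]] [mg [N [gN g0]]]; split.
  by apply: measurable_funM; apply: measurableT_comp.
exists (Num.max (M * N) (Num.max M N)); split=> x.
  by rewrite le_max normrM ler_pM.
rewrite norm2E gt_max => /andP[_]; rewrite lt_max gt_max gt_max.
by move=> /orP[/andP[? _]|/andP[_ ?]]; rewrite /tens; [rewrite f0 ?mul0r|rewrite g0 ?mulr0].
Qed.

Lemma I2_tens f g : bcs1 f -> bcs1 g -> I2 (tens f g) = I1 f * I1 g.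
Proof.
move=> bf bg; rewrite I2_xy; last exact: bcs2_tens.
transitivity (I1 (fun x => I1 g * f x)); last by rewrite I1Z// mulrC.
by congr (I1 _); apply/funext => x; rewrite /tens/= I1Z// mulrC.
Qed.

(** Removing the mean by means of the unit mass [eta] makes the primitive compactly supported.
    Modulo multiples of [eta], every test function is therefore the derivative of a test
    function. *)
Lemma test1_center a b f eta : test1 a b f -> test1 a b eta -> I1 eta = 1 ->
  exists2 F, test1 a b F & forall x : R, is_derive x (1 : R) F (f x - I1 f * eta x).
Proof.
move=> tf te Ie.
have th : test1 a b (fun x => f x + (- I1 f) * eta x).
  by apply: test1D => //; exact: test1Z.
exists (prim (fun x => f x + (- I1 f) * eta x)).
  apply: test1_prim => //; rewrite I1D ?I1Z ?Ie ?mulr1 ?subrr//.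
  - exact: test1_bcs te.
  - exact: test1_bcs tf.
  - by apply: bcs1Z; exact: test1_bcs te.
move=> x; rewrite -mulNr; apply: primP; last exact: test1_bcs th.
by apply: smooth1_continuous; case: th.
Qed.

Lemma derive1_val (f f' : R -> R) :
  (forall x : R, is_derive x (1 : R) f (f' x)) -> derive1 f = f'.
Proof. by move=> df; apply/funext => x; rewrite derive1E; exact: derive_val. Qed.

(** By [test1_center] the pairing of [v] with a tensor product depends on each factor only through
    its integral. So it is that of the constant [m], the average of [v] against the unit mass built
    from [eta1] and [eta2], and the fundamental lemma applies to [v - m]. *)
Lemma zero_gradient_const (a b c d : R) (v : R * R -> R) : a < b -> c < d ->
  leb2.-integrable (box a b c d) (EFin \o v) ->
  (forall phi, test_function (box a b c d) phi ->
    \int[leb2]_(x in box a b c d) (v x * 'D_e1 phi x) = 0) ->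
  (forall phi, test_function (box a b c d) phi ->
    \int[leb2]_(x in box a b c d) (v x * 'D_e2 phi x) = 0) ->
  exists m, {ae leb2, forall x, box a b c d x -> v x = m}.
Proof.
set B := box a b c d => ab cd iv v1 v2.
have mB : measurable (B : set mR2) by exact: measurable_box.
have [eta1 t1 I1e] := exists_unit_test1 ab.
have [eta2 t2 I2e] := exists_unit_test1 cd.
have v1' phi (psi : R * R -> R) : test_function B phi -> 'D_e1 phi = psi ->
    \int[leb2]_(x in B) (v x * psi x) = 0 by move=> tp <-; exact: v1.
have v2' phi (psi : R * R -> R) : test_function B phi -> 'D_e2 phi = psi ->
    \int[leb2]_(x in B) (v x * psi x) = 0 by move=> tp <-; exact: v2.
pose J f g := \int[leb2]_(x in B) (v x * tens f g x).
have it f g : test1 a b f -> test1 c d g ->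
    leb2.-integrable B (EFin \o (fun x => v x * tens f g x)).
  move=> tf tg; apply: integrable_mul_bounded => //.
  by apply: bcs2_tens; [exact: test1_bcs tf|exact: test1_bcs tg].
have J1 f g : test1 a b f -> test1 c d g -> J f g = I1 f * J eta1 g.
  move=> tf tg; have [F tF dF] := test1_center tf t1 I1e.
  have H := v1' _ _ (test_tens tF tg) (derive_tens1 g (fun x => @ex_derive _ _ _ _ _ _ _ (dF x))).
  rewrite (derive1_val dF) in H; apply/eqP; rewrite -subr_eq0 -H /J -RintegralZl//; last exact: it.
  rewrite -RintegralB//; [|exact: it|].
    by apply/eqP; apply: eq_Rintegral => x _; rewrite /tens; ring.
  by apply: integrable_mull => //; exact: it.
have J2 f g : test1 a b f -> test1 c d g -> J f g = I1 g * J f eta2.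
  move=> tf tg; have [F tF dF] := test1_center tg t2 I2e.
  have H := v2' _ _ (test_tens tf tF) (derive_tens2 f (fun x => @ex_derive _ _ _ _ _ _ _ (dF x))).
  rewrite (derive1_val dF) in H; apply/eqP; rewrite -subr_eq0 -H /J -RintegralZl//; last exact: it.
  rewrite -RintegralB//; [|exact: it|].
    by apply/eqP; apply: eq_Rintegral => x _; rewrite /tens; ring.
  by apply: integrable_mull => //; exact: it.
pose m := J eta1 eta2; exists m.
have ivm : leb2.-integrable B (EFin \o (fun x => v x - m)).
  have -> : EFin \o (fun x => v x - m) = ((EFin \o v) \- cst m%:E)%E by [].
  apply: integrableB => //; apply: (@measurable_bounded_integrable _ mR2 R leb2 (cst m) B) => //.
    apply: le_lt_trans (leb2_itv (Num.min a c) (Num.max b d)); apply: le_measure; rewrite ?inE//.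
      by apply: measurableX; exact: measurable_itv.
    move=> x [? ? ? ?]; split; rewrite /= in_itv/= ge_min le_max; apply/andP; split; apply/orP.
    - by left; exact: ltW.
    - by left; exact: ltW.
    - by right; exact: ltW.
    - by right; exact: ltW.
  by exists `|m|; split; [exact: num_real|move=> N mN x _; exact: ltW].
have H : {ae leb2, forall x, B x -> v x - m = 0}.
  apply: fundamental => // f g tf tg.
  have -> : \int[leb2]_(x in B) ((v x - m) * tens f g x) = J f g - m * I2 (tens f g).
    have bt : bcs2 (tens f g) by apply: bcs2_tens; [exact: test1_bcs tf|exact: test1_bcs tg].
    rewrite -I2Z// -(@I2_setE _ B); last first.
      by move=> x nB; rewrite (test_out (test_tens tf tg))// mulr0.
    rewrite -RintegralB//; [|exact: it|].
      by apply: eq_Rintegral => x _; rewrite mulrBl.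
    by apply: integrableS (bcs2_integrable (bcs2Z m bt)).
  rewrite J1// J2// -/m I2_tens; [|exact: test1_bcs tf|exact: test1_bcs tg].
  by rewrite /m; ring.
by apply: negligibleS H => x /= nP h; apply: nP => /h/eqP; rewrite subr_eq0 => /eqP.
Qed.

End ZeroGradient.

(** * Weak primitives along the axes *)

Section Primitives.
Context {R : realType}.
Local Notation mR := (measurableTypeR R).
Local Notation mR2 := (measurableTypeR R * measurableTypeR R)%type.
Implicit Types f g h : R -> R.

Lemma measurable_ltr d (T : measurableType d) (f g : T -> R) :
  measurable_fun setT f -> measurable_fun setT g ->
  measurable_fun setT (fun x => (f x < g x)%R%:R : R).
Proof.
move=> mf mg.
have -> : (fun x => (f x < g x)%R%:R) = (fun x => if f x < g x then 1 else 0 : R).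
  by apply/funext => x; case: ifP.
by apply: measurable_fun_ifT => //; exact: measurable_fun_ltr.
Qed.

Lemma itv_norm_le (c d x : R) : c < x < d -> `|x| <= Num.max `|c| `|d|.
Proof.
move=> /andP[cx xd]; rewrite ler_norml; apply/andP; split.
  rewrite lerNl le_max (@le_trans _ _ (- c)) ?lerN2 ?(ltW cx)//.
  by rewrite -[leRHS]normrN ler_norm.
by rewrite le_max (le_trans (ltW xd) (ler_norm d)) orbT.
Qed.

(** As a kernel, it turns the primitive from [c] of a function cut off at [d] into an integral over
    the whole line, measurable in [t] and [y] jointly, as Fubini requires. *)
Definition cut (c d t y : R) : R := (c < t)%R%:R * (t < d)%R%:R * (t < y)%R%:R.

Lemma cut_bound c d t y : `|cut c d t y| <= 1.
Proof.
by rewrite /cut; do 3![case: (_ < _)]; rewrite ?(mulr0, mulr1, mul0r, normr0, normr1).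
Qed.

Lemma cut_eq0 c d t y : Num.max `|c| `|d| < `|t| -> cut c d t y = 0.
Proof.
move=> cdt; rewrite /cut.
have [tc|] := ltP c t; last by rewrite !mul0r.
have [td|] := ltP t d; last by rewrite mulr0 mul0r.
by move: cdt; rewrite ltNge itv_norm_le// tc.
Qed.

Lemma measurable_cut d (T : measurableType d) (c e : R) (t y : T -> R) :
  measurable_fun setT t -> measurable_fun setT y ->
  measurable_fun setT (fun x => cut c e (t x) (y x)).
Proof.
move=> mt my; apply: measurable_funM; last exact: measurable_ltr.
by apply: measurable_funM; apply: measurable_ltr.
Qed.

(** Integration by parts for a merely bounded measurable [h]: after exchanging the integrals, the
    inner one is that of [f'] over the half-line beyond [t], which is [- f t]. The cut-off to the
    interval does no harm because [f] vanishes outside it. *)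
Lemma I1_prim_parts c d h f f' M : meas1 h -> (forall t, `|h t| <= M) ->
  (forall x : R, is_derive x (1 : R) f (f' x)) -> continuous f' ->
  (forall x, ~~ (c < x < d) -> f x = 0) ->
  I1 (fun y => I1 (fun t => cut c d t y * h t) * f' y) = - I1 (fun t => h t * f t).
Proof.
move=> mh hM df cf' f0.
have N0 x : Num.max `|c| `|d| < `|x| -> f x = 0.
  by move=> cdx; apply: f0; apply/negP => /itv_norm_le; rewrite leNgt cdx.
have f'0 := derive_out df N0.
have bf' : bcs1 f' by apply: continuous_bcs1 cf' f'0.
have [_ [N [f'N f'N0]]] := bf'.
have NN : 0 <= N by apply: le_trans (f'N 0).
have M0 : 0 <= M by apply: le_trans (hM 0).
pose k (p : R * R) := cut c d p.1 p.2 * h p.1 * f' p.2.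
have bk : bcs2 k.
  split.
    apply: measurable_funM; last by apply: measurableT_comp => //; exact: bf'.1.
    by apply: measurable_funM; [exact: measurable_cut|exact: measurableT_comp].
  exists (Num.max (Num.max (Num.max `|c| `|d|) N) (M * N)); split=> x.
    rewrite le_max /k normrM normrM; apply/orP; right; apply: ler_pM => //.
    by rewrite -[M]mul1r; apply: ler_pM => //; exact: cut_bound.
  rewrite gt_max => /andP[+ _]; rewrite gt_max => /andP[cdx Nx]; rewrite /k.
  (* Far out, either the first coordinate is large and [cut] vanishes, or the norm is that of the
     second coordinate and [f'] vanishes. *)
  have [cx|cx] := ltP (Num.max `|c| `|d|) `|x.1|.
    by rewrite cut_eq0// !mul0r.
  move: cdx; rewrite norm2E lt_max ltNge cx /= => cx2.
  rewrite f'N0 ?mulr0//; move: Nx; rewrite norm2E max_r//.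
  exact: ltW (le_lt_trans cx cx2).
have -> : (fun y => I1 (fun t => cut c d t y * h t) * f' y) =
    (fun y => I1 (fun t => k (t, y))).
  apply/funext => y; rewrite mulrC -I1Z; last first.
    split.
      by apply: measurable_funM => //; apply: (@measurable_cut _ mR); [exact: measurable_id|exact: measurable_cst].
    exists (Num.max M (Num.max `|c| `|d|)); split=> t.
      by rewrite le_max normrM -[M]mul1r; apply/orP; left; apply: ler_pM => //; exact: cut_bound.
    by rewrite gt_max => /andP[_ ?]; rewrite cut_eq0// mul0r.
  by congr (I1 _); apply/funext => t; rewrite /k/= mulrC.
rewrite -I2_yx// I2_xy// -mulN1r.
have -> : (fun x => I1 (fun y => k (x, y))) = (fun t => -1 * (h t * f t)).
  apply/funext => t.
  transitivity (I1 (fun y => ((c < t)%R%:R * (t < d)%R%:R * h t) * ((t < y)%R%:R * f' y))).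
    by congr (I1 _); apply/funext => y; rewrite /k /cut/=; ring.
  rewrite I1Z; last first.
    split.
      apply: measurable_funM; last exact: bf'.1.
      by apply: measurable_ltr => //; exact: measurable_cst.
    exists N; split=> y.
      by rewrite normrM; case: (t < y); rewrite ?normr1 ?normr0 ?mul1r ?mul0r.
    by move=> Ny; rewrite f'N0// mulr0.
  rewrite (I1_FTC_right t df cf' N0).
  have [tc|tc] := boolP (c < t < d); last by rewrite f0//; ring.
  by move: tc => /andP[-> ->]; rewrite !mul1r mulN1r mulrN.
rewrite I1Z//; apply: bcs1M => //; first by move=> r; exists M.
apply: (continuous_bcs1 _ N0) => x.
by apply: differentiable_continuous; apply/derivable1_diffP; apply: ex_derive.
Qed.

Definition bmeas (u : R * R -> R) : Prop :=
  meas2 u /\ exists M, forall x, `|u x| <= M.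

Lemma bmeasM u v : bmeas u -> bcs2 v -> bcs2 (fun x => u x * v x).
Proof.
by move=> [mu_ [M uM]] bv; apply: bcs2M => // r; exists M.
Qed.

Definition vprim c d q (p : R * R) : R := I1 (fun t => cut c d t p.2 * q (p.1, t)).
Definition hprim a b q (p : R * R) : R := I1 (fun s => cut a b s p.1 * q (s, p.2)).

Lemma bmeas_param (k : R * R -> R -> R) (M : R) :
  @measurable_fun _ _ (mR2 * mR)%type R setT (fun p => k p.1 p.2) ->
  (forall x t, `|k x t| <= M) -> (forall x t, M < `|t| -> k x t = 0) ->
  bmeas (fun x => I1 (k x)).
Proof.
move=> mk kM k0; split; first exact: (@measurable_I1_param _ _ mR2 k M).
exists (M * (2 * M)) => x; apply: I1_bound => //.
- by apply: le_trans (kM 0 0).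
- split; last by exists M; split=> // t; exact: k0.
  rewrite /meas1 (_ : k x = (fun p => k p.1 p.2) \o (fun t => (x, t)))//.
  by apply: measurableT_comp => //; exact: measurable_fun_pair.
- by move=> t; exact: k0.
Qed.

Lemma bmeas_vprim c d q : bmeas q -> bmeas (vprim c d q).
Proof.
move=> [mq [M qM]]; have M0 : 0 <= M by apply: le_trans (qM 0).
apply: (@bmeas_param (fun p t => cut c d t p.2 * q (p.1, t)) (Num.max M (Num.max `|c| `|d|))).
- apply: measurable_funM.
    apply: (@measurable_cut _ (mR2 * mR)%type) => //.
    by apply: measurableT_comp => //; exact: measurableT_comp.
  rewrite (_ : (fun x => _) = q \o (fun x : mR2 * mR => (x.1.1, x.2)))//.
  apply: measurableT_comp => //; apply: measurable_fun_pair => //.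
  exact: measurableT_comp.
- move=> p t; rewrite le_max normrM -[X in _ <= X]mul1r; apply/orP; left.
  by apply: ler_pM => //; exact: cut_bound.
- by move=> p t; rewrite gt_max => /andP[_ ?]; rewrite cut_eq0// mul0r.
Qed.

Lemma bmeas_hprim c d q : bmeas q -> bmeas (hprim c d q).
Proof.
move=> [mq [M qM]]; have M0 : 0 <= M by apply: le_trans (qM 0).
apply: (@bmeas_param (fun p t => cut c d t p.1 * q (t, p.2)) (Num.max M (Num.max `|c| `|d|))).
- apply: measurable_funM.
    apply: (@measurable_cut _ (mR2 * mR)%type) => //.
    by apply: measurableT_comp => //; exact: measurableT_comp.
  rewrite (_ : (fun x => _) = q \o (fun x : mR2 * mR => (x.2, x.1.2)))//.
  apply: measurableT_comp => //; apply: measurable_fun_pair => //.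
  exact: measurableT_comp.
- move=> p t; rewrite le_max normrM -[X in _ <= X]mul1r; apply/orP; left.
  by apply: ler_pM => //; exact: cut_bound.
- by move=> p t; rewrite gt_max => /andP[_ ?]; rewrite cut_eq0// mul0r.
Qed.

Lemma I1N f : bcs1 f -> I1 (fun x => - f x) = - I1 f.
Proof. by move=> bf; under eq_fun do rewrite -mulN1r; rewrite I1Z// mulN1r. Qed.

Lemma vprim_parts a b c d q phi : bmeas q -> test_function (box a b c d) phi ->
  I2 (fun p => vprim c d q p * 'D_e2 phi p) = - I2 (fun p => q p * phi p).
Proof.
move=> bq tp; have [mq [M qM]] := bq.
have bD := test_D2_bcs tp; have bqp : bcs2 (fun p => q p * phi p).
  by apply: bmeasM => //; exact: test_bcs tp.
rewrite I2_xy; last by apply: bmeasM => //; exact: bmeas_vprim.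
rewrite I2_xy// -I1N; last exact: (bcs1_I1 bqp).
congr (I1 _); apply/funext => x.
apply: (@I1_prim_parts c d (fun t => q (x, t)) (fun t => phi (x, t)) _ M) => //.
- rewrite /meas1 (_ : (fun _ => _) = q \o (fun t => (x, t)))//.
  by apply: measurableT_comp => //; exact: measurable_fun_pair.
- by move=> y; apply: smooth_ysection; case: tp.
- move=> y; apply: (@continuous_comp _ _ _ (fun y => (x, y)) ('D_e2 phi)).
    exact: continuous_pairr.
  by apply: smooth_continuous; apply: smooth_D; [exact: e2_in|case: tp].
- move=> y /negP cyd; apply: (test_out tp) => -[/= _ _ ? ?].
  by apply: cyd; apply/andP.
Qed.

Lemma hprim_parts a b c d q phi : bmeas q -> test_function (box a b c d) phi ->
  I2 (fun p => hprim a b q p * 'D_e1 phi p) = - I2 (fun p => q p * phi p).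
Proof.
move=> bq tp; have [mq [M qM]] := bq.
have bD := test_D1_bcs tp; have bqp : bcs2 (fun p => q p * phi p).
  by apply: bmeasM => //; exact: test_bcs tp.
rewrite I2_yx; last by apply: bmeasM => //; exact: bmeas_hprim.
rewrite I2_yx// -I1N; last first.
  exact: (@bcs1_I1 _ (fun p => q (p.2, p.1) * phi (p.2, p.1)) (bcs2_swap bqp)).
congr (I1 _); apply/funext => y.
apply: (@I1_prim_parts a b (fun t => q (t, y)) (fun t => phi (t, y)) _ M) => //.
- rewrite /meas1 (_ : (fun _ => _) = q \o (fun t => (t, y)))//.
  by apply: measurableT_comp => //; exact: measurable_fun_pair.
- by move=> x; apply: smooth_xsection; case: tp.
- move=> x; apply: (@continuous_comp _ _ _ (fun x => (x, y)) ('D_e1 phi)).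
    exact: continuous_pairl.
  by apply: smooth_continuous; apply: smooth_D; [exact: e1_in|case: tp].
- move=> x /negP axb; apply: (test_out tp) => -[/= ? ? _ _].
  by apply: axb; apply/andP.
Qed.

End Primitives.

(** * Vanishing mixed derivatives and the potential on a box *)

Section LocalPotential.
Context {R : realType}.
Local Notation mR := (measurableTypeR R).
Local Notation mR2 := (measurableTypeR R * measurableTypeR R)%type.
Implicit Types (f g h : R -> R) (u v phi : R * R -> R).

Lemma bmeasD u v : bmeas u -> bmeas v -> bmeas (fun x : R * R => u x + v x).
Proof.
move=> [mu_ [M uM]] [mv [N vN]]; split; first exact: measurable_funD.
by exists (M + N) => x; rewrite (le_trans (ler_normD _ _))// lerD.
Qed.

Lemma bmeasZ r u : bmeas u -> bmeas (fun x : R * R => r * u x).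
Proof.
move=> [mu_ [M uM]]; split; first by apply: measurable_funM => //; exact: measurable_cst.
by exists (`|r| * M) => x; rewrite normrM ler_wpM2l.
Qed.

Lemma bmeas_cst r : bmeas (cst r : R * R -> R).
Proof. by split; [exact: measurable_cst|exists `|r|]. Qed.

Lemma bmeas_fst h : meas1 h -> (exists M, forall t, `|h t| <= M) ->
  bmeas (fun p : R * R => h p.1).
Proof.
by move=> mh [M hM]; split; [exact: measurableT_comp|exists M].
Qed.

Lemma bmeas_snd h : meas1 h -> (exists M, forall t, `|h t| <= M) ->
  bmeas (fun p : R * R => h p.2).
Proof.
by move=> mh [M hM]; split; [exact: measurableT_comp|exists M].
Qed.

Lemma bmeas_section_integral u f : bmeas u -> bcs1 f ->
  bmeas (fun p : R * R => I1 (fun t => u (p.1, t) * f t)) /\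
  bmeas (fun p : R * R => I1 (fun s => u (s, p.2) * f s)).
Proof.
move=> [mu_ [M uM]] [mf [N [fN f0]]]; have M0 : 0 <= M by apply: le_trans (uM 0).
have N0 : 0 <= N by apply: le_trans (fN 0).
split.
- apply: (@bmeas_param _ (fun p t => u (p.1, t) * f t) (Num.max (M * N) N)).
  + apply: measurable_funM; last exact: measurableT_comp.
    rewrite (_ : (fun x => _) = u \o (fun x : mR2 * mR => (x.1.1, x.2)))//.
    apply: measurableT_comp => //; apply: measurable_fun_pair => //.
    exact: measurableT_comp.
  + by move=> p t; rewrite le_max normrM ler_pM.
  + by move=> p t; rewrite gt_max => /andP[_ ?]; rewrite f0// mulr0.
- apply: (@bmeas_param _ (fun p t => u (t, p.2) * f t) (Num.max (M * N) N)).
  + apply: measurable_funM; last exact: measurableT_comp.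
    rewrite (_ : (fun x => _) = u \o (fun x : mR2 * mR => (x.2, x.1.2)))//.
    apply: measurableT_comp => //; apply: measurable_fun_pair => //.
    exact: measurableT_comp.
  + by move=> p t; rewrite le_max normrM ler_pM.
  + by move=> p t; rewrite gt_max => /andP[_ ?]; rewrite f0// mulr0.
Qed.

Lemma bcs1_section_integral u f : bmeas u -> bcs1 f ->
  meas1 (fun x => I1 (fun t => u (x, t) * f t)) /\
  meas1 (fun y => I1 (fun s => u (s, y) * f s)).
Proof.
move=> bu bf; have [[m1 _] [m2 _]] := bmeas_section_integral bu bf; split.
- rewrite /meas1 (_ : (fun x => _) = (fun p : R * R => I1 (fun t => u (p.1, t) * f t)) \o (fun x => (x, 0)))//.
  by apply: measurableT_comp => //; exact: measurable_fun_pair.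
- rewrite /meas1 (_ : (fun x => _) = (fun p : R * R => I1 (fun t => u (t, p.2) * f t)) \o (fun x => (0, x)))//.
  by apply: measurableT_comp => //; exact: measurable_fun_pair.
Qed.

(** Once averaged in the second variable, [u] no longer depends on it, so [g] contributes only its
    integral while [eta] takes its place in the pairing. *)
Lemma I2_tensr u f g eta : bmeas u -> bcs1 f -> bcs1 g -> bcs1 eta ->
  I2 (fun p => I1 (fun t => u (p.1, t) * eta t) * tens f g p) =
  I1 g * I2 (fun p => u p * tens f eta p).
Proof.
move=> bu bf bg be; have bD := (bmeas_section_integral bu be).1.
have bx x : bcs1 (fun t => u (x, t) * eta t).
  have [mu_ [M uM]] := bu; apply: bcs1M => //; last by move=> r; exists M.
  rewrite /meas1 (_ : (fun _ => _) = u \o (fun t => (x, t)))//.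
  by apply: measurableT_comp => //; exact: measurable_fun_pair.
rewrite I2_xy; last by apply: bmeasM => //; exact: bcs2_tens.
rewrite [in RHS]I2_xy; last by apply: bmeasM => //; exact: bcs2_tens.
rewrite -I1Z; last first.
  exact: (bcs1_I1 (bmeasM bu (bcs2_tens bf be))).
congr (I1 _); apply/funext => x; rewrite /tens/=.
transitivity (I1 (fun t => u (x, t) * eta t) * (f x * I1 g)).
  by rewrite -I1Z// -I1Z//; exact: bcs1Z.
rewrite mulrC -mulrA mulrCA; congr (_ * _).
by rewrite -I1Z//; congr (I1 _); apply/funext => t; ring.
Qed.

Lemma I2_tensl u f g eta : bmeas u -> bcs1 f -> bcs1 g -> bcs1 eta ->
  I2 (fun p => I1 (fun s => u (s, p.2) * eta s) * tens f g p) =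
  I1 f * I2 (fun p => u p * tens eta g p).
Proof.
move=> bu bf bg be; have bD := (bmeas_section_integral bu be).2.
have by_ y : bcs1 (fun t => u (t, y) * eta t).
  have [mu_ [M uM]] := bu; apply: bcs1M => //; last by move=> r; exists M.
  rewrite /meas1 (_ : (fun _ => _) = u \o (fun t => (t, y)))//.
  by apply: measurableT_comp => //; exact: measurable_fun_pair.
rewrite I2_yx; last by apply: bmeasM => //; exact: bcs2_tens.
rewrite [in RHS]I2_yx; last by apply: bmeasM => //; exact: bcs2_tens.
rewrite -I1Z; last first.
  exact: (bcs1_I1 (bcs2_swap (bmeasM bu (bcs2_tens be bg)))).
congr (I1 _); apply/funext => y; rewrite /tens/=.
transitivity (I1 (fun t => u (t, y) * eta t) * (g y * I1 f)).
  by rewrite -I1Z// -I1Z; [congr (I1 _); apply/funext => s; rewrite (mulrC (f s))|exact: bcs1Z].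
rewrite mulrC -mulrA mulrCA; congr (_ * _).
by rewrite -I1Z//; congr (I1 _); apply/funext => t; ring.
Qed.

Lemma leb2_box_lty (a b c d : R) : (leb2 (box a b c d) < +oo)%E.
Proof.
apply: le_lt_trans (leb2_itv (Num.min a c) (Num.max b d)).
apply: le_measure; rewrite ?inE; first exact: measurable_box.
  by apply: measurableX; exact: measurable_itv.
move=> x [? ? ? ?]; split; rewrite /= in_itv/= ge_min le_max; apply/andP; split; apply/orP.
- by left; exact: ltW.
- by left; exact: ltW.
- by right; exact: ltW.
- by right; exact: ltW.
Qed.

Lemma bmeas_integrable (B : set mR2) u : measurable B -> (leb2 B < +oo)%E ->
  bmeas u -> leb2.-integrable B (EFin \o u).
Proof.
move=> mB B_fin [mu_ [M uM]].
apply: (@measurable_bounded_integrable _ mR2 R leb2 u B) => //.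
  exact: measurable_funTS.
by exists M; split; [exact: num_real|move=> N MN x _; rewrite /= (le_trans (uM x))// ltW].
Qed.

Lemma ae_I2 u v : bcs2 u -> bcs2 v -> {ae leb2, forall p, u p = v p} -> I2 u = I2 v.
Proof.
move=> bu bv uv; congr fine; apply: ae_eq_integral => //.
- by apply/measurable_EFinP; case: bu.
- by apply/measurable_EFinP; case: bv.
- by apply: negligibleS uv => p /= nP h; apply: nP => _ /=; rewrite h.
Qed.

(* Averaging u against a unit mass in either variable produces the two summands. *)
Lemma zero_mixed a b c d u : a < b -> c < d -> bmeas u ->
  (forall f g, test1 a b f -> test1 c d g ->
     I2 (fun p => u p * tens (derive1 f) (derive1 g) p) = 0) ->
  exists D C, [/\ meas1 D, meas1 C,
    exists M, (forall t, `|D t| <= M) /\ (forall t, `|C t| <= M) &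
    {ae leb2, forall p, box a b c d p -> u p = D p.1 + C p.2}].
Proof.
set B := box a b c d => ab cd bu u0.
have mB : measurable (B : set mR2) by exact: measurable_box.
have [eta1 t1 I1e] := exists_unit_test1 ab.
have [eta2 t2 I2e] := exists_unit_test1 cd.
have be1 := test1_bcs t1; have be2 := test1_bcs t2.
pose m := I2 (fun p => u p * tens eta1 eta2 p).
pose D x := I1 (fun t => u (x, t) * eta2 t).
(* The double average [m] is contained in both partial averages; it is subtracted from one of
   them. *)
pose C y := I1 (fun s => u (s, y) * eta1 s) - m.
have [[_ [M1 D1]] [_ [M2 C2]]] : bmeas (fun p : R * R => D p.1) /\
    bmeas (fun p : R * R => I1 (fun s => u (s, p.2) * eta1 s)).
  by split; [exact: (bmeas_section_integral bu be2).1|exact: (bmeas_section_integral bu be1).2].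
have mD : meas1 D by exact: (bcs1_section_integral bu be2).1.
have mC : meas1 C by apply: measurable_funB => //; exact: (bcs1_section_integral bu be1).2.
have bD t : `|D t| <= Num.max M1 (M2 + `|m|) by rewrite le_max (D1 (t, 0)).
have bC t : `|C t| <= Num.max M1 (M2 + `|m|).
  rewrite le_max; apply/orP; right; rewrite (le_trans (ler_normB _ _))// lerD2r.
  exact: (C2 (0, t)).
exists D, C; split => //; first by exists (Num.max M1 (M2 + `|m|)).
have bDp : bmeas (fun p => D p.1) by apply: bmeas_fst => //; eexists; exact: bD.
have bCp : bmeas (fun p => C p.2) by apply: bmeas_snd => //; eexists; exact: bC.
have bv : bmeas (fun p => u p + -1 * (D p.1 + C p.2)).
  by apply: bmeasD => //; apply: bmeasZ; exact: bmeasD.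
suff H : {ae leb2, forall p, B p -> u p + -1 * (D p.1 + C p.2) = 0}.
  apply: negligibleS H => p /= nP h; apply: nP => /h.
  by rewrite mulN1r => /eqP; rewrite subr_eq0 => /eqP.
apply: fundamental.
  by apply: bmeas_integrable => //; exact: leb2_box_lty.
move=> f g tf tg; rewrite (@I2_setE _ B); last first.
  by move=> x nB; rewrite (test_out (test_tens tf tg))// mulr0.
have bf := test1_bcs tf; have bg := test1_bcs tg.
(* The hypothesis is applied to the primitives of the centred [f] and [g]. Expanding the product of
   the centred functions gives four terms, which are exactly the pairing of [u - D - C] with the
   tensor product of [f] and [g]. *)
have [F tF dF] := test1_center tf t1 I1e.
have [G tG dG] := test1_center tg t2 I2e.
have := u0 _ _ tF tG; rewrite (derive1_val dF) (derive1_val dG) => <-.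
pose J f g := I2 (fun p => u p * tens f g p).
have bJ f1 g1 : bcs1 f1 -> bcs1 g1 -> bcs2 (fun p => u p * tens f1 g1 p).
  by move=> *; apply: bmeasM => //; exact: bcs2_tens.
have bI1 : bcs2 (fun p => D p.1 * tens f g p) by apply: bmeasM => //; exact: bcs2_tens.
have bI2 : bcs2 (fun p => (C p.2 + m) * tens f g p).
  by apply: bmeasM; [apply: bmeasD => //; exact: bmeas_cst|exact: bcs2_tens].
have bt := bcs2_tens bf bg.
transitivity (J f g + -1 * (I1 g * J f eta2) + -1 * (I1 f * J eta1 g) + m * I2 (tens f g)).
  rewrite /J -(I2_tensr bu bf bg be2) -(I2_tensl bu bf bg be1).
  have -> : (fun p : R * R => I1 (fun t => u (p.1, t) * eta2 t) * tens f g p) =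
    (fun p => D p.1 * tens f g p) by [].
  have -> : (fun p : R * R => I1 (fun s => u (s, p.2) * eta1 s) * tens f g p) =
      (fun p => (C p.2 + m) * tens f g p).
    by apply/funext => p; rewrite /C subrK.
  rewrite -(I2Z (-1) bI1) -(I2Z (-1) bI2) -(I2Z m bt).
  rewrite -I2D; [|exact: bJ|exact: bcs2Z].
  rewrite -I2D; [|by apply: bcs2D; [exact: bJ|exact: bcs2Z]|exact: bcs2Z].
  rewrite -I2D; [|by apply: bcs2D; [apply: bcs2D; [exact: bJ|exact: bcs2Z]|exact: bcs2Z]|exact: bcs2Z].
  by congr (I2 _); apply/funext => p; ring.
rewrite I2_tens//.
have -> : (fun p => u p * tens (fun x => f x - I1 f * eta1 x) (fun x => g x - I1 g * eta2 x) p) =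
  (fun p => u p * tens f g p + (- I1 g) * (u p * tens f eta2 p) +
            (- I1 f) * (u p * tens eta1 g p) + (I1 f * I1 g) * (u p * tens eta1 eta2 p)).
  by apply/funext => p; rewrite /tens; ring.
have b1 := bJ _ _ bf bg; have b2 := bJ _ _ bf be2.
have b3 := bJ _ _ be1 bg; have b4 := bJ _ _ be1 be2.
rewrite I2D; [|by apply: bcs2D; [apply: bcs2D; [|exact: bcs2Z]|exact: bcs2Z]|exact: bcs2Z].
rewrite I2D; [|by apply: bcs2D; [|exact: bcs2Z]|exact: bcs2Z].
rewrite I2D//; last exact: bcs2Z.
by rewrite !I2Z// /J -/m; ring.
Qed.

(* With V(x, y) the integral of q1(x, .) from c to y and H(x, y) the integral of
   q2(., y) from a to x, the field being divergence free means that V + H has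
   zero mixed derivative, so V + H = D(x) + C(y), and V - D = C - H is a potential. *)
Lemma local_potential a b c d (q1 q2 : R * R -> R) : a < b -> c < d -> bmeas q1 -> bmeas q2 ->
  (forall phi, test_function (box a b c d) phi ->
     I2 (fun p => q1 p * 'D_e1 phi p + q2 p * 'D_e2 phi p) = 0) ->
  exists beta, [/\ bmeas beta,
    forall phi, test_function (box a b c d) phi ->
      I2 (fun p => beta p * 'D_e2 phi p) = - I2 (fun p => q1 p * phi p) &
    forall phi, test_function (box a b c d) phi ->
      I2 (fun p => beta p * 'D_e1 phi p) = I2 (fun p => q2 p * phi p)].
Proof.
set B := box a b c d => ab cd b1 b2 divq.
have bU := bmeas_vprim c d b1; have bV := bmeas_hprim a b b2.
have bu := bmeasD bU bV.
have [|D [C [mD mC [M [DM CM]] uDC]]] := zero_mixed ab cd bu.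
  move=> f g tf tg.
  have [df tf'] := test1_derive tf; have [dg tg'] := test1_derive tg.
  (* The mixed product is at once the second derivative of [tens (derive1 f) g] and the first
     derivative of [tens f (derive1 g)]. These two functions form the gradient of [tens f g],
     against which the field is tested. *)
  have E1 : 'D_e2 (tens (derive1 f) g) = tens (derive1 f) (derive1 g).
    by apply: derive_tens2 => x; apply: ex_derive.
  have E2 : 'D_e1 (tens f (derive1 g)) = tens (derive1 f) (derive1 g).
    by apply: derive_tens1 => x; apply: ex_derive.
  have E3 : 'D_e1 (tens f g) = tens (derive1 f) g.
    by apply: derive_tens1 => x; apply: ex_derive.
  have E4 : 'D_e2 (tens f g) = tens f (derive1 g).
    by apply: derive_tens2 => x; apply: ex_derive.
  have V1 : I2 (fun p => vprim c d q1 p * tens (derive1 f) (derive1 g) p) =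
      - I2 (fun p => q1 p * tens (derive1 f) g p).
    by rewrite -E1; exact: vprim_parts (test_tens tf' tg).
  have V2 : I2 (fun p => hprim a b q2 p * tens (derive1 f) (derive1 g) p) =
      - I2 (fun p => q2 p * tens f (derive1 g) p).
    by rewrite -E2; exact: hprim_parts (test_tens tf tg').
  have V3 : I2 (fun p => q1 p * tens (derive1 f) g p + q2 p * tens f (derive1 g) p) = 0.
    by rewrite -E3 -E4; exact: divq (test_tens tf tg).
  have tt := bcs2_tens (test1_bcs tf') (test1_bcs tg').
  rewrite I2D in V3; [|by apply: bmeasM => //; exact: bcs2_tens (test1_bcs tf') (test1_bcs tg)|
    by apply: bmeasM => //; exact: bcs2_tens (test1_bcs tf) (test1_bcs tg')].
  under eq_fun do rewrite mulrDl.
  by rewrite I2D ?V1 ?V2 -?opprD ?V3 ?oppr0//; exact: bmeasM.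
have bD : bmeas (fun p => D p.1) by apply: bmeas_fst => //; exists M.
have bC : bmeas (fun p => C p.2) by apply: bmeas_snd => //; exists M.
exists (fun p => vprim c d q1 p + -1 * D p.1); split.
- by apply: bmeasD => //; exact: bmeasZ.
- move=> phi tp; have bp := test_D2_bcs tp.
  have -> : I2 (fun p => (vprim c d q1 p + -1 * D p.1) * 'D_e2 phi p) =
      I2 (fun p => vprim c d q1 p * 'D_e2 phi p) + -1 * I2 (fun p => D p.1 * 'D_e2 phi p).
    rewrite -I2Z; last exact: bmeasM.
    rewrite -I2D; [|exact: bmeasM|by apply: bcs2Z; exact: bmeasM].
    by congr (I2 _); apply/funext => p; ring.
  (* [D] is constant on vertical lines, along which the derivative of [phi] integrates to zero. *)
  rewrite (vprim_parts b1 tp) [X in -1 * X](_ : _ = 0) ?mulr0 ?addr0//.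
  rewrite I2_xy; last exact: bmeasM.
  rewrite (_ : (fun x => _) = cst 0); first by rewrite /I1 Rintegral_cst// mul0r.
  apply/funext => x /=; rewrite I1Z; last exact: (bcs1_xsection x bp).
  rewrite (_ : I1 _ = 0) ?mulr0//.
  have [r phi0] := test_bounded_support tp.
  apply: (@I1_derive_eq0 _ (fun y => phi (x, y)) _ r).
  + by move=> y; apply: smooth_ysection; case: tp.
  + move=> y; apply: (@continuous_comp _ _ _ (fun y => (x, y)) ('D_e2 phi)).
      exact: continuous_pairr.
    by apply: smooth_continuous; apply: smooth_D; [exact: e2_in|case: tp].
  + by move=> y ry; apply: phi0; rewrite norm2E lt_max ry orbT.
- move=> phi tp; have bp := test_D1_bcs tp.
  have -> : I2 (fun p => (vprim c d q1 p + -1 * D p.1) * 'D_e1 phi p) =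
      I2 (fun p => C p.2 * 'D_e1 phi p) + -1 * I2 (fun p => hprim a b q2 p * 'D_e1 phi p).
    rewrite -I2Z; last exact: bmeasM.
    rewrite -I2D; [|exact: bmeasM|by apply: bcs2Z; exact: bmeasM].
    apply: ae_I2.
    + by apply: bmeasM => //; apply: bmeasD => //; exact: bmeasZ.
    + by apply: bcs2D; [exact: bmeasM|apply: bcs2Z; exact: bmeasM].
    + apply: negligibleS uDC => p /= nP h; apply: nP.
      have [Bp|nBp] := pselect (B p).
        have -> : vprim c d q1 p = D p.1 + C p.2 - hprim a b q2 p.
          by rewrite -(h Bp) addrK.
        by ring.
      have -> : 'D_e1 phi p = 0 by exact: (test_out (test_D e1_in tp)).
      by rewrite !mulr0 addr0.
  rewrite (hprim_parts b2 tp) mulN1r opprK [X in X + _](_ : _ = 0) ?add0r//.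
  rewrite I2_yx; last exact: bmeasM.
  rewrite (_ : (fun x => _) = cst 0); first by rewrite /I1 Rintegral_cst// mul0r.
  apply/funext => y /=; rewrite I1Z; last exact: (bcs1_ysection y bp).
  rewrite (_ : I1 _ = 0) ?mulr0//.
  have [r phi0] := test_bounded_support tp.
  apply: (@I1_derive_eq0 _ (fun x => phi (x, y)) _ r).
  + by move=> x; apply: smooth_xsection; case: tp.
  + move=> x; apply: (@continuous_comp _ _ _ (fun x => (x, y)) ('D_e1 phi)).
      exact: continuous_pairl.
    by apply: smooth_continuous; apply: smooth_D; [exact: e1_in|case: tp].
  + by move=> x rx; apply: phi0; rewrite norm2E lt_max rx.
Qed.

End LocalPotential.

(** * Gluing on simply connected sets *)

Section Monodromy.
Context {R : realType}.

Lemma within_continuous_nbhs (T S : topologicalType) (A : set T) (f : T -> S) x B :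
  {within A, continuous f} -> A x -> nbhs (f x) B ->
  nbhs x [set y | A y -> B (f y)].
Proof.
move=> cf Ax Bfx; have := cf x B Bfx.
by rewrite /nbhs /= -nbhs_subspace_in.
Qed.

Lemma big_nat_muln (F : nat -> R) n k :
  \sum_(0 <= j < n * k) F j = \sum_(0 <= i < n) \sum_(0 <= l < k) F (i * k + l)%N.
Proof.
elim: n => [|n IH]; first by rewrite mul0n !big_geq.
rewrite big_nat_recr//= -IH mulSn addnC (@big_cat_nat _ _ _ (n * k))//= ?leq_addr//.
congr (_ + _); rewrite -{1}[(n * k)%N]add0n big_addn addKn.
by apply: eq_bigr => i _; rewrite addnC.
Qed.

(** The Lebesgue number of the cover pulled back along [H]. It holds for all large [n] at once
    because subdivisions must be refined to common ones; [V] is the line for paths and the plane for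
    homotopies. *)
Lemma lebesgue_number (V : normedModType R) (K : set V) (H : V -> R * R)
    (A : set (R * R)) (U : R * R -> set (R * R)) :
  compact K -> {within K, continuous H} ->
  (forall p, K p -> A (H p)) -> (forall x, A x -> U x x) ->
  (forall x, A x -> open (U x)) ->
  exists N, forall n, (N <= n)%N -> forall p, K p -> exists2 x, A x &
    forall p', K p' -> `|p - p'| <= n.+1%:R^-1 -> U x (H p').
Proof.
move=> /compact_near_coveringP cK cH KA Uxx oU.
pose P n p := K p -> exists2 x, A x &
    forall p', K p' -> `|p - p'| <= n.+1%:R^-1 -> U x (H p').
have [|N _ HN] := cK nat \oo P _ _; last first.
  by exists N => n Nn p Kp; apply: (HN n).
move=> p Kp.
have /(within_continuous_nbhs cH Kp) : nbhs (H p) (U (H p)).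
  by apply: open_nbhs_nbhs; split; [exact/oU/KA|exact/Uxx/KA].
move=> /nbhs_ballP[e /= e0 He].
have e20 : 0 < e / 2 by rewrite divr_gt0.
near=> q n => Kq; exists (H p); first exact: KA.
have pq : ball p (e / 2) q by near: q; exact: nbhsx_ballx.
have n2 : n.+1%:R^-1 < e / 2.
  near: n; have := near_infty_natSinv_lt (PosNum e20).
  by apply: filterS.
move=> p' Kp' qp'; apply: He => //; rewrite -ball_normE /ball_/=.
rewrite (splitr e) -(subrKA q) (le_lt_trans (ler_normD _ _))//; apply: ltrD.
  by move: pq; rewrite -ball_normE.
exact: le_lt_trans n2.
Unshelve. all: by end_near. Qed.

Variables (A : set (R * R)) (U : R * R -> set (R * R)) (h : R * R -> R * R -> R).
Hypothesis scA : simply_connected A.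
Hypothesis Uxx : forall x, A x -> U x x.
Hypothesis oU : forall x, A x -> open (U x).
Hypothesis UA : forall x, A x -> U x `<=` A.
Hypothesis cU : forall x y z, A x -> U x y -> U x z -> segment y z `<=` U x.
Hypothesis hcompat : forall x x' y z, A x -> A x' -> U x y -> U x z ->
  U x' y -> U x' z -> h x z - h x y = h x' z - h x' y.

(** [h x] plays the role of a potential on [U x], of which only increments matter; by [hcompat] the
    choice of [x] is immaterial. Pairs of points in no common [U x] get the default 0, and sums are
    evaluated only where this does not occur. *)
Definition transport (y z : R * R) : R :=
  if pselect (exists x, [/\ A x, U x y & U x z]) is left e
  then h (projT1 (cid e)) z - h (projT1 (cid e)) y else 0.

Local Notation "'d_'" := transport.

Lemma transportE x y z : A x -> U x y -> U x z -> d_ y z = h x z - h x y.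
Proof.
move=> Ax xy xz; rewrite /transport; case: pselect => [e|[]]; last by exists x.
by case: (cid e) => x' [Ax' x'y x'z] /=; exact: hcompat.
Qed.

Definition psum n (g : R -> R * R) : R :=
  \sum_(0 <= i < n) d_ (g (i%:R / n%:R)) (g (i.+1%:R / n%:R)).

(** Whole pieces of the path, and not just the nodes sampled by [psum], must lie in one [U x]; this
    is what makes the property survive refinement. *)
Definition chained n (g : R -> R * R) : Prop := (0 < n)%N /\
  forall i, (i < n)%N -> exists2 x, A x &
    forall t, i%:R / n%:R <= t <= i.+1%:R / n%:R -> U x (g t).

Lemma frac01 i n : (i <= n)%N -> (0 < n)%N -> 0 <= (i%:R / n%:R : R) <= 1.
Proof.
move=> In n0; rewrite divr_ge0//= ler_pdivrMr ?ltr0n// mul1r ler_nat//.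
Qed.

Lemma chained_exists g : path_in A g -> exists2 N, (0 < N)%N &
  forall n, (N <= n)%N -> chained n g.
Proof.
move=> [cg gA].
have gA' p : `[0, 1]%classic p -> A (g p) by rewrite /= in_itv => ?; exact: gA.
have [N HN] := lebesgue_number (@segment_compact R 0 1) cg gA' Uxx oU.
exists N.+1 => // -[//|n] Nn; split=> // i In.
have p01 : `[0, 1]%classic (i%:R / n.+1%:R : R) by rewrite /= in_itv/= frac01// ltnW.
have [x Ax Hx] := HN n Nn _ p01; exists x => // t /andP[it ti]; apply: Hx.
  rewrite /= in_itv/= (le_trans _ it) ?divr_ge0//= (le_trans ti)//.
  by have /andP[] := @frac01 i.+1 n.+1 In isT.
rewrite distrC ger0_norm ?subr_ge0// lerBlDl (le_trans ti)//.
by rewrite -natr1 mulrDl mul1r.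
Qed.

(** The [k] increments within one old piece are all measured in the same [U x], so they telescope to
    the old increment. *)
Lemma chained_mul n k g : chained n g -> (0 < k)%N ->
  chained (n * k) g /\ psum (n * k) g = psum n g.
Proof.
move=> [n0 fg] k0.
have nk0 : ((n * k)%N%:R : R) != 0 by rewrite pnatr_eq0 -lt0n muln_gt0 n0.
have nn0 : (n%:R : R) != 0 by rewrite pnatr_eq0 -lt0n.
have kk0 : (k%:R : R) != 0 by rewrite pnatr_eq0 -lt0n.
have npos : 0 < (n%:R : R) by rewrite ltr0n.
have kpos : 0 < (k%:R : R) by rewrite ltr0n.
have sub i l : (l <= k)%N ->
    i%:R / n%:R <= ((i * k + l)%N%:R / (n * k)%N%:R : R) <= i.+1%:R / n%:R.
  move=> lk; rewrite natrD !natrM.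
  rewrite (_ : (_ + _) / _ = i%:R / n%:R + l%:R / k%:R / n%:R); last by field; apply/andP.
  rewrite -natr1 mulrDl mul1r lerDl lerD2l !divr_ge0//=.
  by rewrite ler_pdivrMr// mulVf// ler_pdivrMr// mul1r ler_nat.
have div_lt j : (j < n * k)%N -> (j %/ k < n)%N by rewrite ltn_divLR.
split.
  split; first by rewrite muln_gt0 n0.
  move=> j jnk; have [x Ax Hx] := fg _ (div_lt _ jnk); exists x => // t /andP[jt tj].
  have jk : (j %% k < k)%N by rewrite ltn_mod.
  have /andP[s1 _] := sub (j %/ k)%N (j %% k)%N (ltnW jk).
  have /andP[_ s2] := sub (j %/ k)%N (j %% k).+1 jk.
  rewrite -divn_eq in s1; rewrite addnS -divn_eq in s2.
  by apply: Hx; rewrite (le_trans s1 jt) (le_trans tj s2).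
rewrite /psum big_nat_muln; apply: eq_big_nat => i /andP[_ In].
have [x Ax Hx] := fg _ In.
transitivity (\sum_(0 <= l < k) (h x (g ((i * k + l.+1)%N%:R / (n * k)%N%:R)) -
                               h x (g ((i * k + l)%N%:R / (n * k)%N%:R)))).
  apply: eq_big_nat => l /andP[_ lk]; rewrite -addnS; apply: transportE => //.
    by apply: Hx; apply: sub; exact: ltnW.
  by apply: Hx; exact: sub.
rewrite (@telescope_sumr _ 0 k (fun l => h x (g ((i * k + l)%N%:R / (n * k)%N%:R))))//.
have e0 : (i * k + 0)%N%:R / (n * k)%N%:R = i%:R / n%:R :> R.
  by rewrite addn0 !natrM; field; apply/andP.
have e1 : (i * k + k)%N%:R / (n * k)%N%:R = i.+1%:R / n%:R :> R.
  by rewrite -mulSnr !natrM; field; apply/andP.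
rewrite e0 e1; apply/esym/transportE => //; apply: Hx.
  by rewrite lexx ler_pM2r ?invr_gt0// ler_nat /=.
by rewrite lexx ler_pM2r ?invr_gt0// ler_nat leqnSn.
Qed.

Lemma loop_sum g : path_in A g -> g 0 = g 1 ->
  exists2 N, (0 < N)%N & forall n, (N <= n)%N -> psum n g = 0.
Proof.
move=> pg g01; have [H [cH HA Hg H1 Hs]] := scA.2 g pg g01.
have cK : compact (unit_square : set (R * R)).
  by apply: compact_setX; exact: segment_compact.
have [N HN] := lebesgue_number cK cH HA Uxx oU.
exists N.+1 => // -[//|n] Nn; set m := n.+1.
pose p i j : R * R := H (i%:R / m%:R, j%:R / m%:R).
have cell i j : (i < m)%N -> (j < m)%N -> exists2 x, A x &
    [/\ U x (p i j), U x (p i.+1 j), U x (p i j.+1) & U x (p i.+1 j.+1)].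
  move=> im jm.
  have sq i' j' : (i' <= m)%N -> (j' <= m)%N ->
      unit_square (i'%:R / m%:R : R, j'%:R / m%:R : R).
    by move=> *; split; rewrite /= in_itv/= frac01.
  have [x Ax Hx] := HN n Nn _ (sq _ _ (ltnW im) (ltnW jm)).
  exists x => //.
  have d0 (a b : R) : `|a / b - a / b| <= m%:R^-1 by rewrite subrr normr0 invr_ge0.
  have d1 a : `|a%:R / m%:R - a.+1%:R / m%:R| <= (m%:R^-1 : R).
    rewrite -mulrBl -natr1 opprD addNKr mulN1r normrN.
    by rewrite ger0_norm// invr_ge0.
  split; apply: Hx; rewrite ?norm2E/= ?ge_max ?d0 ?d1//; apply: sq; rewrite //; exact: ltnW.
pose row i := \sum_(0 <= j < m) d_ (p i j) (p i j.+1).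
have transp0 y : A y -> d_ y y = 0.
  by move=> Ay; rewrite (@transportE y) ?subrr//; exact: Uxx.
have Ag0 : A (g 0) by apply: pg.2; rewrite lexx ler01.
have rowS i : (i < m)%N -> row i = row i.+1.
  move=> im; apply/eqP; rewrite -subr_eq0 -sumrB.
  (* Every cell closes up, so the difference of its horizontal increments is one of vertical
     increments. The sum telescopes to the two vertical sides, where the homotopy stays at the base
     point. *)
  have -> : \sum_(0 <= j < m) (d_ (p i j) (p i j.+1) - d_ (p i.+1 j) (p i.+1 j.+1)) =
    \sum_(0 <= j < m) (- d_ (p i j.+1) (p i.+1 j.+1) - - d_ (p i j) (p i.+1 j)).
    apply: eq_big_nat => j /andP[_ jm]; have [x Ax [x1 x2 x3 x4]] := cell _ _ im jm.
    by rewrite !(@transportE x)//; ring.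
  rewrite (@telescope_sumr _ 0 m (fun j => - d_ (p i j) (p i.+1 j)))//.
  have s01 k : (k <= m)%N -> 0 <= (k%:R / m%:R : R) <= 1 by move=> km; exact: frac01.
  rewrite /p mul0r divff ?pnatr_eq0//.
  rewrite (Hs _ (s01 _ (ltnW im))).1 (Hs _ (s01 _ im)).1.
  rewrite (Hs _ (s01 _ (ltnW im))).2 (Hs _ (s01 _ im)).2.
  by rewrite transp0// subrr.
have -> : psum m g = row 0.
  apply: eq_big_nat => j /andP[_ jm]; rewrite /p mul0r !Hg//; first exact: frac01.
  by apply: frac01 => //; exact: ltnW.
have rowE i : (i <= m)%N -> row 0 = row i.
  elim: i => [_|i IH im]; first by [].
  by rewrite (IH (ltnW im)); exact: rowS.
rewrite (rowE _ (leqnn m)).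
rewrite /row big1_seq// => j; rewrite mem_index_iota => /andP[_ /andP[_ jm]].
rewrite /p divff ?pnatr_eq0// !H1 ?transp0//; first exact: frac01.
by apply: frac01 => //; exact: ltnW.
Qed.

(** Paths are controlled only on the unit interval; composed with [clamp] they are continuous on the
    whole line and can be added. *)
Definition clamp (t : R) : R := Num.max 0 (Num.min 1 t).

Lemma clamp01 t : 0 <= clamp t <= 1.
Proof. by rewrite /clamp le_max lexx/= ge_max ler01 ge_min lexx. Qed.

Lemma clamp_id t : 0 <= t <= 1 -> clamp t = t.
Proof. by move=> /andP[t0 t1]; rewrite /clamp (min_r t1) (max_r t0). Qed.

Lemma clamp_le0 t : t <= 0 -> clamp t = 0.
Proof.
by move=> t0; rewrite /clamp max_l// ge_min t0 orbT.
Qed.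

Lemma clamp_ge1 t : 1 <= t -> clamp t = 1.
Proof. by move=> t1; rewrite /clamp min_l// max_r. Qed.

Lemma continuous_clamp : continuous clamp.
Proof.
move=> t; apply: continuous_max; first exact: cvg_cst.
by apply: continuous_min; [exact: cvg_cst|exact: cvg_id].
Qed.

Lemma path_clamp (g : R -> R * R) : path_in A g -> continuous (g \o clamp).
Proof.
move=> [cg _] t B Bt.
have ct : `[0, 1]%classic (clamp t) by rewrite /= in_itv/= clamp01.
have H : nbhs t [set s | `[0, 1]%classic (clamp s) -> B (g (clamp s))].
  exact: (continuous_clamp (within_continuous_nbhs cg ct Bt)).
suff : nbhs t [set s | B (g (clamp s))] by [].
by apply: filterS H => s Hs; apply: Hs; rewrite /= in_itv/= clamp01.
Qed.

Lemma psum_segment n x y z : (0 < n)%N -> A x -> U x y -> U x z ->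
  psum n (fun t => (1 - t) *: y + t *: z) = h x z - h x y.
Proof.
move=> n0 Ax xy xz; set g := fun t : R => _.
have Ug i : (i <= n)%N -> U x (g (i%:R / n%:R)).
  move=> In; apply: (cU Ax xy xz); exists (i%:R / n%:R).
  by have /andP[? ?] := frac01 In n0; split.
rewrite /psum.
transitivity (\sum_(0 <= i < n) (h x (g (i.+1%:R / n%:R)) - h x (g (i%:R / n%:R)))).
  apply: eq_big_nat => i /andP[_ In]; apply: transportE => //; apply: Ug => //.
  exact: ltnW.
rewrite (@telescope_sumr _ 0 n (fun i => h x (g (i%:R / n%:R))))//.
rewrite divff ?pnatr_eq0 -?lt0n// mul0r /g.
by rewrite subrr scale0r add0r scale1r subr0 scale1r scale0r addr0.
Qed.

Lemma psum_rev n (g : R -> R * R) : chained n g ->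
  psum n (fun t => g (1 - t)) = - psum n g.
Proof.
move=> [n0 fg]; rewrite /psum big_nat_rev/= -sumrN.
apply: eq_big_nat => i /andP[_ In]; rewrite add0n.
have nn0 : (n%:R : R) != 0 by rewrite pnatr_eq0 -lt0n.
have [x Ax Hx] := fg _ In.
have e1 : 1 - ((n - i.+1)%N%:R / n%:R) = i.+1%:R / n%:R :> R.
  by rewrite natrB//; field.
have e2 : 1 - ((n - i.+1).+1%:R / n%:R) = i%:R / n%:R :> R.
  by rewrite -subSn// subSS natrB ?(ltnW In)//; field.
rewrite e1 e2 !(@transportE x) ?opprB//; apply: Hx;
  by rewrite lexx ler_pM2r ?invr_gt0 ?ltr0n// ler_nat leqnSn.
Qed.

(* The increments of the local potentials are summed along paths.  On a grid so
   fine that the homotopy maps every cell into some U x, the increment around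
   each cell vanishes, so the sum around a loop does. *)
Lemma monodromy : exists gamma : R * R -> R, forall x, A x -> forall y z,
  U x y -> U x z -> gamma z - gamma y = h x z - h x y.
Proof.
have [[x0 Ax0]|nA] := pselect (exists x, A x); last first.
  by exists (cst 0) => x Ax; exfalso; apply: nA; exists x.
(* For each endpoint a path from [x0] is chosen together with a subdivision fine enough for it; the
   value of [gamma] is the corresponding sum. *)
have Pz z : exists gn : (R -> R * R) * nat, A z ->
    [/\ path_in A gn.1, gn.1 0 = x0, gn.1 1 = z & chained gn.2 gn.1].
  have [Az|nAz] := pselect (A z); last by exists (cst 0, 0%N).
  have [g [pg g0 g1]] := scA.1 x0 z Ax0 Az.
  have [N _ fN] := chained_exists pg.
  by exists (g, N) => _; split => //; exact: fN.
pose G z := (projT1 (cid (Pz z))).1; pose m z := (projT1 (cid (Pz z))).2.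
have HG z : A z -> [/\ path_in A (G z), G z 0 = x0, G z 1 = z & chained (m z) (G z)].
  by move=> Az; exact: (projT2 (cid (Pz z)) Az).
exists (fun z => psum (m z) (G z)) => x Ax y z xy xz.
have Ay := UA Ax xy; have Az := UA Ax xz.
have [py Gy0 Gy1 fy] := HG y Ay; have [pz Gz0 Gz1 fz] := HG z Az.
pose sg (t : R) : R * R := (1 - t) *: y + t *: z.
(* The loop goes from [x0] to [y], along the segment to [z], and back to [x0]. Written as a sum of
   three clamped legs, each constant outside its third of the interval, it is continuous without any
   gluing of cases. *)
pose l (t : R) : R * R := G y (clamp (3 * t)) + (sg (clamp (3 * t - 1)) - y) +
  (G z (clamp (3 - 3 * t)) - z).
have l1 t : t <= 1 / 3 -> l t = G y (clamp (3 * t)).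
  move=> t1; rewrite /l (@clamp_le0 (3 * t - 1)); last by lra.
  rewrite (@clamp_ge1 (3 - 3 * t)); last by lra.
  by rewrite /sg Gz1 subr0 scale1r scale0r addr0 !subrr !addr0.
have l2 t : 1 / 3 <= t <= 2 / 3 -> l t = sg (clamp (3 * t - 1)).
  move=> /andP[t1 t2]; rewrite /l (@clamp_ge1 (3 * t)); last by lra.
  rewrite (@clamp_ge1 (3 - 3 * t)); last by lra.
  by rewrite Gz1 subrr addr0 Gy1 addrC subrK.
have l3 t : 2 / 3 <= t -> l t = G z (clamp (3 - 3 * t)).
  move=> t1; rewrite /l (@clamp_ge1 (3 * t)); last by lra.
  rewrite (@clamp_ge1 (3 * t - 1)); last by lra.
  by rewrite Gy1 /sg subrr scale0r add0r scale1r [y + _]addrC subrK addrC subrK.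
have sgU t : U x (sg (clamp t)).
  apply: (cU Ax xy xz); exists (clamp t).
  by have /andP[? ?] := clamp01 t; split.
have pl : path_in A l.
  split.
    apply: continuous_subspaceT => t.
    have caff (a b : R) : {for t, continuous (fun t : R => a * t + b)}.
      by apply: cvgD; [apply: cvgMl_tmp; exact: cvg_id|exact: cvg_cst].
    have cG (g : R -> R * R) (a b : R) : path_in A g ->
        {for t, continuous (fun t : R => g (clamp (a * t + b)))}.
      move=> pg; apply: (@continuous_comp _ _ _ (fun t : R => a * t + b) (g \o clamp)).
        exact: caff.
      exact: path_clamp.
    have cs : {for t, continuous (fun t : R => sg (clamp (3 * t + -1)))}.
      have cc : {for t, continuous (fun t : R => clamp (3 * t + -1))}.
        by apply: continuous_comp; [exact: caff|exact: continuous_clamp].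
      apply: cvgD; apply: cvgZr_tmp => //.
      by apply: cvgB => //; exact: cvg_cst.
    apply: cvgD; first apply: cvgD.
    - have -> : (fun t => G y (clamp (3 * t))) = (fun t => G y (clamp (3 * t + 0))).
        by apply/funext => s; rewrite addr0.
      rewrite -[in X in _ --> X](addr0 (3 * t)); exact: (cG _ 3 0 py).
    - by apply: cvgB; [exact: cs|exact: cvg_cst].
    - apply: cvgB; last exact: cvg_cst.
      have -> : (fun t => G z (clamp (3 - 3 * t))) = (fun t => G z (clamp (- 3 * t + 3))).
        by apply/funext => s; rewrite mulNr addrC.
      rewrite (_ : 3 - 3 * t = - 3 * t + 3); first exact: (cG _ (- 3) 3 pz).
      by rewrite mulNr addrC.
  move=> t _; have [t1|t1] := leP t (1 / 3).
    by rewrite l1//; apply: py.2; exact: clamp01.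
  have [t2|t2] := leP t (2 / 3).
    by rewrite l2 ?(ltW t1)//; apply: (UA Ax); exact: sgU.
  by rewrite l3 ?(ltW t2)//; apply: pz.2; exact: clamp01.
have l01 : l 0 = l 1.
  have -> : l 0 = x0 by rewrite l1; [rewrite mulr0 clamp_le0|lra].
  by rewrite l3; [rewrite mulr1 subrr clamp_le0|lra].
have [N N0 HN] := loop_sum pl l01.
(* A common multiple of the two subdivisions, so that refining changes neither sum, and at least
   [N]. The loop is cut into [3 * M] pieces, [M] for each leg. *)
pose M := (m y * m z * N)%N.
have M0 : (0 < M)%N by rewrite /M !muln_gt0 fy.1 fz.1.
have sumy : psum M (G y) = psum (m y) (G y).
  by have [|_ <-] := @chained_mul _ (m z * N)%N _ fy; rewrite ?muln_gt0 ?fz.1// mulnA.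
have [fMz sumz] : chained M (G z) /\ psum M (G z) = psum (m z) (G z).
  rewrite /M (mulnC (m y)) -mulnA; apply: chained_mul => //.
  by rewrite muln_gt0 fy.1.
have NM : (N <= 3 * M)%N.
  by apply: (@leq_trans M); [apply: leq_pmull; rewrite muln_gt0 fy.1 fz.1|exact: leq_pmull].
clearbody M.
have := HN _ NM; rewrite {1}/psum big_nat_muln.
rewrite big_nat_recr//= big_nat_recr//= big_nat1.
have M0' : (M%:R : R) != 0 by rewrite pnatr_eq0 -lt0n.
have fr i j : 3 * ((i * M + j)%N%:R / (3 * M)%N%:R) = i%:R + j%:R / M%:R :> R.
  by rewrite natrD !natrM; field.
have frE i j : (i * M + j)%N%:R / (3 * M)%N%:R = (i%:R + j%:R / M%:R) / 3 :> R.
  by rewrite -fr [RHS]mulrC mulKf ?pnatr_eq0.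
have f01 j : (j <= M)%N -> 0 <= (j%:R / M%:R : R) <= 1 by move=> jM; exact: frac01.
have q1 r : 0 <= r <= 1 -> l ((0%:R + r) / 3) = G y r.
  move=> r01; have /andP[r0 r1] := r01; rewrite l1; last by lra.
  by rewrite (_ : 3 * _ = r) ?clamp_id//; field.
have q2 r : 0 <= r <= 1 -> l ((1%:R + r) / 3) = sg r.
  move=> r01; have /andP[r0 r1] := r01; rewrite l2; last by apply/andP; split; lra.
  by rewrite (_ : 3 * _ - 1 = r) ?clamp_id//; field.
have q3 r : 0 <= r <= 1 -> l ((2%:R + r) / 3) = G z (1 - r).
  move=> /andP[r0 r1]; rewrite l3; last by lra.
  rewrite (_ : 3 - 3 * _ = 1 - r); last by field.
  by rewrite clamp_id//; apply/andP; split; lra.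
have p1 j : (j <= M)%N -> l ((0 * M + j)%N%:R / (3 * M)%N%:R) = G y (j%:R / M%:R).
  by move=> jM; rewrite frE; apply: q1; exact: f01.
have p2 j : (j <= M)%N -> l ((1 * M + j)%N%:R / (3 * M)%N%:R) = sg (j%:R / M%:R).
  by move=> jM; rewrite frE; apply: q2; exact: f01.
have p3 j : (j <= M)%N -> l ((2 * M + j)%N%:R / (3 * M)%N%:R) = G z (1 - j%:R / M%:R).
  by move=> jM; rewrite frE; apply: q3; exact: f01.
have -> : \sum_(0 <= j < M) d_ (l ((0 * M + j)%N%:R / (3 * M)%N%:R))
      (l ((0 * M + j).+1%:R / (3 * M)%N%:R)) = psum M (G y).
  by apply: eq_big_nat => j /andP[_ jM]; rewrite -addnS !p1// ltnW.
have -> : \sum_(0 <= j < M) d_ (l ((1 * M + j)%N%:R / (3 * M)%N%:R))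
      (l ((1 * M + j).+1%:R / (3 * M)%N%:R)) = psum M sg.
  by apply: eq_big_nat => j /andP[_ jM]; rewrite -addnS !p2// ltnW.
have -> : \sum_(0 <= j < M) d_ (l ((2 * M + j)%N%:R / (3 * M)%N%:R))
      (l ((2 * M + j).+1%:R / (3 * M)%N%:R)) = psum M (fun t => G z (1 - t)).
  by apply: eq_big_nat => j /andP[_ jM]; rewrite -addnS !p3// ltnW.
rewrite psum_rev// (psum_segment M0 Ax xy xz) sumy sumz => /eqP.
by rewrite subr_eq0 => /eqP <-; rewrite addrAC subrr add0r.
Qed.

End Monodromy.

(** * Triangulations *)

Section Triangles.
Context {R : realType}.
Local Notation mu := (@lebesgue_measure R).
Local Notation mR2 := (measurableTypeR R * measurableTypeR R)%type.
Implicit Types (x a b c : R * R).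

Definition affine (l : R * R * R) x : R := l.1.1 * x.1 + l.1.2 * x.2 + l.2.

Lemma continuous_affine l : continuous (affine l).
Proof.
move=> x; apply: cvgD; last exact: cvg_cst.
by apply: cvgD; apply: cvgMl_tmp; [exact: cvg_fst|exact: cvg_snd].
Qed.

Lemma affine_convex l x y t :
  affine l ((1 - t) *: x + t *: y) = (1 - t) * affine l x + t * affine l y.
Proof. by rewrite /affine /= /GRing.scale/=; ring. Qed.

(** A vertical line is a product with a null factor; every other line has single points as
    sections. *)
Lemma negligible_line (l : R * R * R) : l.1 != 0 -> leb2.-negligible [set x | affine l x = 0].
Proof.
move=> l0; set L := [set x | _].
have cL : closed L.
  have -> : L = affine l @^-1` [set 0] by [].
  apply: preimage_closed; last exact: closed_eq.
  by move=> x _; exact: continuous_affine.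
have mL : measurable (L : set mR2).
  by rewrite -[L]setCK; apply: measurableC; apply: open_measurable2; exact: closed_openC.
apply/negligibleP => //.
have [l2|l2] := eqVneq l.1.2 0.
- have l1 : l.1.1 != 0.
    by move: l0; apply: contra => /eqP l1; apply/eqP; rewrite [l.1]surjective_pairing l1 l2.
  have -> : L = [set - l.2 / l.1.1] `*` setT.
    apply/seteqP; split => x; rewrite /L /affine /= l2 mul0r addr0.
      by move=> /eqP; rewrite addr_eq0 => /eqP E; split=> //; rewrite -E mulrC mulKf.
    by move=> [-> _]; rewrite mulrC divfK// addNr.
  transitivity (mu [set (- l.2 / l.1.1)%R] * mu setT)%E.
    by apply: product_measure1E => //; exact: measurable_set1.
  by rewrite lebesgue_measure_set1 mul0e.
- rewrite /leb2 /product_measure1 /=.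
  apply: integral0_eq => x _ /=.
  have -> : xsection L x = [set - (l.1.1 * x + l.2) / l.1.2].
    apply/seteqP; split => y; rewrite /xsection /= inE /L /affine /=.
      rewrite addrAC => /eqP; rewrite addrC addr_eq0 => /eqP E.
      by rewrite -E mulrC mulKf.
    by move=> ->; rewrite [l.1.2 * _]mulrC divfK//; ring.
  by rewrite lebesgue_measure_set1.
Qed.

Lemma triangle_affine a b c : noncollinear a b c -> exists l1 l2 l3,
  [/\ l1.1 != 0, l2.1 != 0, l3.1 != 0,
   (forall x, triangle a b c x <->
      [/\ 0 <= affine l1 x, 0 <= affine l2 x & 0 <= affine l3 x]) &
   exists x, [/\ 0 < affine l1 x, 0 < affine l2 x & 0 < affine l3 x]].
Proof.
rewrite /noncollinear; set D := dot _ _ => D0.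
have DE : D = - (b.2 - a.2) * (c.1 - a.1) + (b.1 - a.1) * (c.2 - a.2) by [].
(* barycentric coordinates, by Cramer's rule *)
pose l2 : R * R * R := ((c.2 - a.2) / D, - (c.1 - a.1) / D,
   (- a.1 * (c.2 - a.2) + a.2 * (c.1 - a.1)) / D).
pose l3 : R * R * R := (- (b.2 - a.2) / D, (b.1 - a.1) / D,
   ((b.2 - a.2) * a.1 - (b.1 - a.1) * a.2) / D).
pose l1 : R * R * R := (- l2.1.1 - l3.1.1, - l2.1.2 - l3.1.2, 1 - l2.2 - l3.2).
have E1 x : affine l1 x = 1 - affine l2 x - affine l3 x.
  by rewrite /affine /l1/=; ring.
have E2 r s t : r + s + t = 1 -> affine l2 (r *: a + s *: b + t *: c) = s.
  move=> rst; have -> : r = 1 - s - t by rewrite -rst; ring.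
  rewrite /affine /l2 /= /GRing.scale/=.
  move: D0; rewrite DE => D0; by field.
have E3 r s t : r + s + t = 1 -> affine l3 (r *: a + s *: b + t *: c) = t.
  move=> rst; have -> : r = 1 - s - t by rewrite -rst; ring.
  rewrite /affine /l3 /= /GRing.scale/=.
  move: D0; rewrite DE => D0; by field.
have inv x : x = affine l1 x *: a + affine l2 x *: b + affine l3 x *: c.
  rewrite E1 [LHS]surjective_pairing [RHS]surjective_pairing /affine /l2 /l3 /= /GRing.scale/=.
  by congr (_, _); move: D0; rewrite DE => D0; field.
(* An affine function taking two values has a nonzero linear part, and each barycentric coordinate
   takes the values 0 and 1 at vertices. *)
have nz (l : R * R * R) x y : affine l x != affine l y -> l.1 != 0.
  by apply: contra => /eqP l0; rewrite /affine l0 /= !mul0r.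
have Ea2 : affine l2 a = 0.
  by have := E2 1 0 0; rewrite !addr0 scale1r !scale0r !addr0; apply.
have Ea3 : affine l3 a = 0.
  by have := E3 1 0 0; rewrite !addr0 scale1r !scale0r !addr0; apply.
have Eb2 : affine l2 b = 1.
  by have := E2 0 1 0; rewrite !addr0 add0r scale1r !scale0r addr0 add0r; apply.
have Ec3 : affine l3 c = 1.
  by have := E3 0 0 1; rewrite !add0r scale1r !scale0r !add0r; apply.
have Eb3 : affine l3 b = 0.
  by have := E3 0 1 0; rewrite !addr0 add0r scale1r !scale0r addr0 add0r; apply.
exists l1, l2, l3; split.
- by apply: (nz _ a b); rewrite !E1 Ea2 Ea3 Eb2 Eb3 !subr0 subrr oner_eq0.
- by apply: (nz _ a b); rewrite Ea2 Eb2 eq_sym oner_eq0.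
- by apply: (nz _ a c); rewrite Ea3 Ec3 eq_sym oner_eq0.
- move=> x; split.
    move=> [r [s [t [r0 s0 t0 rst ->]]]]; rewrite E1 E2// E3//; split=> //.
    by rewrite -rst -!addrA; lra.
  move=> [p1 p2 p3]; exists (affine l1 x), (affine l2 x), (affine l3 x).
  by split => //; rewrite E1; ring.
- exists ((1 / 3) *: a + (1 / 3) *: b + (1 / 3) *: c).
  by rewrite E1 E2 ?E3; [split|..]; lra.
Qed.

Lemma closed_affine_ge0 l : closed [set x | 0 <= affine l x].
Proof.
have -> : [set x | 0 <= affine l x] = affine l @^-1` [set r | 0 <= r] by [].
by apply: preimage_closed; [move=> x _; exact: continuous_affine|exact: closed_ge].
Qed.

Lemma open_affine_gt0 l : open [set x | 0 < affine l x].
Proof.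
have -> : [set x | 0 < affine l x] = affine l @^-1` [set r | 0 < r] by [].
by apply: open_comp; [move=> x _; exact: continuous_affine|exact: open_gt].
Qed.

(** [O] is the set where all three barycentric coordinates are positive; the rest of the triangle
    lies on three lines, which are null sets. *)
Lemma triangle_open_part K : is_triangle K -> closed K /\ exists O : set (R * R),
  [/\ open O, O !=set0, O `<=` K, (forall x y, O x -> O y -> segment x y `<=` O) &
    {ae leb2, forall x, K x -> O x}].
Proof.
move=> [a [b [c [nc ->]]]].
have [l1 [l2 [l3 [n1 n2 n3 KE [x0 [p1 p2 p3]]]]]] := triangle_affine nc.
split.
  have -> : triangle a b c = [set x | 0 <= affine l1 x] `&` [set x | 0 <= affine l2 x]
      `&` [set x | 0 <= affine l3 x].
    apply/seteqP; split=> x; first by move=> /KE[].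
    by move=> [[? ?] ?]; apply/KE.
  by apply: closedI; [apply: closedI|]; exact: closed_affine_ge0.
exists ([set x | 0 < affine l1 x] `&` [set x | 0 < affine l2 x]
      `&` [set x | 0 < affine l3 x]); split.
- by apply: openI; [apply: openI|]; exact: open_affine_gt0.
- by exists x0.
- by move=> x [[? ?] ?]; apply/KE; split; exact: ltW.
- move=> x y [[x1 x2] x3] [[y1 y2] y3] _ [t [t0 t1 ->]].
  have pos u v : 0 < u -> 0 < v -> 0 < (1 - t) * u + t * v.
    move=> u0 v0; have [->|t_neq0] := eqVneq t 0; first by rewrite subr0 mul1r mul0r addr0.
    apply: ltr_wpDl; first by rewrite mulr_ge0 ?subr_ge0// ltW.
    by rewrite mulr_gt0// lt_neqAle eq_sym t_neq0.
  by split; [split|]; rewrite /= affine_convex; exact: pos.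
- have /= N := negligibleU (negligibleU (negligible_line n1) (negligible_line n2)) (negligible_line n3).
  apply: negligibleS N => x /= /not_implyP[/KE[x1 x2 x3] nO].
  apply: contrapT => nN; apply: nO.
  by split; [split|]; rewrite /= lt_neqAle eq_sym ?x1 ?x2 ?x3 andbT; apply/eqP => E; apply: nN;
    [left; left|left; right|right].
Qed.

Lemma bisection_subset (M M' : set (set (R * R) * set (R * R))) :
  bisection M M' -> forall P', M' P' -> exists2 P, M P & P'.1 `<=` P.1.
Proof.
case=> a b c nc Mab P' /= [[MP' _]|]; first by exists P'.
have half (r s t : R) : 0 <= t -> 0 <= 2^-1 * t by move=> ?; rewrite mulr_ge0.
move=> [->|->]; exists (triangle a b c, segment a b) => //= x [r [s [t [r0 s0 t0 rst ->]]]].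
(* The weight [t] of the midpoint is shared equally between the ends of the refinement edge. *)
- exists (r + t / 2), (t / 2), s; split; rewrite ?addr_ge0 ?divr_ge0//.
    by lra.
  rewrite [LHS]surjective_pairing [RHS]surjective_pairing /= /midpoint /GRing.scale/=.
  by congr (_, _); field.
- exists (t / 2), (r + t / 2), s; split; rewrite ?addr_ge0 ?divr_ge0//.
    by lra.
  rewrite [LHS]surjective_pairing [RHS]surjective_pairing /= /midpoint /GRing.scale/=.
  by congr (_, _); field.
Qed.

Lemma refinement_subset Omega T e Tstar : @admissible_refinement R Omega T e Tstar ->
  forall K', Tstar K' -> exists2 K, T K & K' `<=` K.
Proof.
move=> [M [rM -> _]] _ [P' MP' <-].
have : forall M1 M2 : set (set (R * R) * set (R * R)),
    Relation_Operators.clos_refl_trans _ bisection M1 M2 ->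
    forall P', M2 P' -> exists2 P, M1 P & P'.1 `<=` P.1.
  move=> M1 M2; elim=> {M1 M2} [M1 M2 /bisection_subset//|M1 P MP|M1 M2 M3 _ IH1 _ IH2 P].
    by exists P.
  move=> /IH2[Q /IH1[Q' ? ?] QP]; exists Q' => //; exact: subset_trans QP _.
move=> /(_ _ _ rM _ MP')[P [K TK <-] KP].
by exists K.
Qed.

(** This excludes slits and punctures, and places the interiors of the triangles inside [Omega]. A
    boundary point interior to the closure would have, strictly below the Lipschitz graph, a
    neighbouring point with a neighbourhood free of [Omega]. *)
Lemma lipschitz_interior (Omega : set (R * R)) : lipschitz_domain Omega ->
  open Omega -> interior (closure Omega) `<=` Omega.
Proof.
move=> lip oO x xi; apply: contrapT => nOx.
have bx : boundary Omega x.
  by split; [exact: interior_subset|move=> /interior_subset].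
have [d [l [g [dd lg nb]]]] := lip x bx.
have [r /= r0 rx] : exists2 r : R, 0 < r & ball x r `<=` [set y | Omega y <->
    g (dot d (y - x)) < dot (rot90 d) (y - x)] `&` closure Omega.
  apply/nbhs_ballP; apply: filterI; first exact: nb.
  exact: xi.
have g0 : 0 <= g 0.
  rewrite leNgt; apply/negP => g0; apply: nOx.
  have [+ _] := rx x (ballxx _ r0); rewrite /= subrr => E; apply/E.
  by rewrite /dot /= !mulr0 !addr0.
have cdot (e : R * R) : continuous (fun y : R * R => dot e (y - x)).
  have -> : (fun y : R * R => dot e (y - x)) = affine (e.1, e.2, - dot e x).
    by apply/funext => y; rewrite /affine /dot /=; ring.
  exact: continuous_affine.
have cg : continuous g.
  move=> y; apply/cvgrPdist_lt => e e0; near=> z.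
  have lyz : `|g y - g z| <= l * `|y - z| by exact: (lg (y, z) (conj I I)).
  have yz : `|y - z| < e / (`|l| + 1).
    by near: z; apply: cvgr_dist_lt; [exact: cvg_id|rewrite divr_gt0// ltr_wpDl].
  apply: (le_lt_trans lyz); move: yz; rewrite ltr_pdivlMr ?ltr_wpDl//.
  apply: le_lt_trans; rewrite mulrC ler_wpM2l// (le_trans (ler_norm _))//.
  by rewrite lerDl.
pose F (y : R * R) := g (dot d (y - x)) - dot (rot90 d) (y - x).
have cF : continuous F.
  move=> y; apply: cvgB; last exact: cdot.
  by apply: (@continuous_comp _ _ _ (fun y : R * R => dot d (y - x)) g); [exact: cdot|exact: cg].
(* Small enough for [y0] to stay in the ball. Moving down by [t] along the axis gives
   [F y0 = g 0 + t], positive because [x] does not belong to [Omega]. *)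
pose t := r / (`|rot90 d| + 1).
have n0 : 0 < `|rot90 d| + 1 by rewrite ltr_wpDl.
have t0 : 0 < t by rewrite divr_gt0.
pose y0 := x - t *: rot90 d.
have y0x : y0 - x = - (t *: rot90 d) by rewrite /y0 addrAC subrr add0r.
have y0r : ball x r y0.
  rewrite -ball_normE /ball_/= /y0 opprB addrCA subrr addr0 normrZ gtr0_norm//.
  by rewrite /t mulrAC ltr_pdivrMr// ltr_pM2l// ltrDl.
have Fy0 : 0 < F y0.
  rewrite /F y0x.
  have -> : dot d (- (t *: rot90 d)) = 0.
    by rewrite /dot /rot90 /= /GRing.scale/=; ring.
  have -> : dot (rot90 d) (- (t *: rot90 d)) = - t.
    rewrite -[RHS]mulr1 -dd /dot /rot90 /= /GRing.scale/=; ring.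
  by rewrite opprK ltr_wpDl.
have [_ cly0] := rx y0 y0r.
have [y [Oy [yr Fy]]] : (Omega `&` (ball x r `&` [set y | 0 < F y])) !=set0.
  apply: cly0; apply: filterI.
    by apply: open_nbhs_nbhs; split=> //; exact: ball_open.
  have := cF y0 _ (lt_nbhsr Fy0). by [].
have [+ _] := rx y yr => /= -[/(_ Oy) + _].
by rewrite ltNge => /negP; apply; move: Fy; rewrite /F /= subr_gt0 => /ltW.
Unshelve. all: by end_near. Qed.

End Triangles.

(** * Polynomial potentials *)

Section Polynomials.
Context {R : realType}.
Implicit Types (c : nat -> nat -> R) (x : R * R).

Definition mono (i j : nat) x : R := x.1 ^+ i * x.2 ^+ j.

(** In contrast to [poly2] the exponents range over a square, and the total degree is bounded
    through the coefficients. Derivatives then shift coefficients and leave the range of summation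
    as it is. *)
Definition pol (N : nat) c x : R :=
  \sum_(0 <= i < N) \sum_(0 <= j < N) c i j * mono i j x.

Definition bounded_deg (k : nat) c : Prop := forall i j, (k < i + j)%N -> c i j = 0.

Definition trunc (k : nat) c i j : R := if (i + j <= k)%N then c i j else 0.

Lemma trunc_bounded k c : bounded_deg k (trunc k c).
Proof. by move=> i j; rewrite /trunc ltnNge => /negbTE ->. Qed.

Lemma pol_widen N M c : (forall i j, (N <= i)%N \/ (N <= j)%N -> c i j = 0) ->
  (N <= M)%N -> pol M c = pol N c.
Proof.
move=> c0 NM; apply/funext => x; rewrite /pol (@big_cat_nat _ _ _ N)//=.
rewrite [X in _ + X]big_nat [X in _ + X]big1 ?addr0; last first.
  by move=> i /andP[Ni _]; rewrite big1// => j _; rewrite c0 ?mul0r//; left.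
apply: eq_big_nat => i _; rewrite (@big_cat_nat _ _ _ N)//=.
rewrite [X in _ + X]big_nat [X in _ + X]big1 ?addr0// => j /andP[Nj _].
by rewrite c0 ?mul0r//; right.
Qed.

Lemma poly2E k c : poly2 k c = pol k.+1 (trunc k c).
Proof.
apply/funext => x; rewrite /poly2 /pol big_mkord; apply: eq_bigr => i _.
rewrite (@big_cat_nat _ _ _ (k.+1 - i)%N) ?leq_subr//=.
rewrite [X in _ = _ + X]big_nat [X in _ = _ + X]big1 ?addr0; last first.
  by move=> j /andP[+ _]; rewrite leq_subLR => kij; rewrite /trunc leqNgt kij mul0r.
rewrite big_mkord; apply: eq_bigr => j _; rewrite /trunc ifT ?mulrA//.
by have := ltn_ord j; rewrite ltn_subRL ltnS.
Qed.

Lemma pol_poly2 k N c : bounded_deg k c -> (k < N)%N -> pol N c = poly2 k c.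
Proof.
move=> ck kN; rewrite poly2E.
have -> : trunc k c = c.
  by apply/funext => i; apply/funext => j; rewrite /trunc; case: leqP => // /ck.
apply: pol_widen => // i j [ki|kj]; apply: ck.
  by rewrite (leq_trans ki)// leq_addr.
by rewrite (leq_trans kj)// leq_addl.
Qed.

Lemma is_derive_exp (n : nat) (x : R) :
  is_derive x (1 : R) (fun t => t ^+ n) (n%:R * x ^+ n.-1).
Proof.
have H := @is_deriveX _ _ id n x 1 1 (is_derive_id x 1).
rewrite (_ : (fun t : R => t ^+ n) = (id : R -> R) ^+ n).
  by apply: (is_derive_eq H); rewrite /GRing.scale/= mulr1.
by rewrite exprfctE.
Qed.

Lemma smooth1_exp (n : nat) : smooth1 (fun t : R => t ^+ n).
Proof.
elim: n => [|n IH]; first exact: (smooth1_cst 1).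
have sZ : smooth1 (fun x : R => n.+1%:R * x ^+ n) by exact: smooth1Z.
exact: (smooth1_prim (fun t => is_derive_exp n.+1 t) sZ).
Qed.

Lemma smooth_mono i j : smooth (mono i j).
Proof. exact: (smooth_tens (smooth1_exp i) (smooth1_exp j)). Qed.

Lemma derive_mono1 i j : 'D_e1 (mono i j) = fun x => i%:R * mono i.-1 j x.
Proof.
rewrite (_ : mono i j = tens (fun t => t ^+ i) (fun t => t ^+ j))//.
rewrite derive_tens1; last by move=> x; apply: (@ex_derive _ _ _ _ _ _ _ (is_derive_exp i x)).
rewrite (derive1_val (is_derive_exp i)); apply/funext => x.
by rewrite /tens /mono mulrA.
Qed.

Lemma derive_mono2 i j : 'D_e2 (mono i j) = fun x => j%:R * mono i j.-1 x.
Proof.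
rewrite (_ : mono i j = tens (fun t => t ^+ i) (fun t => t ^+ j))//.
rewrite derive_tens2; last by move=> x; apply: (@ex_derive _ _ _ _ _ _ _ (is_derive_exp j x)).
rewrite (derive1_val (is_derive_exp j)); apply/funext => x.
by rewrite /tens /mono mulrCA.
Qed.

Lemma smooth_sum (I : Type) (r : seq I) (F : I -> R * R -> R) v :
  (forall i, smooth (F i)) ->
  smooth (fun x => \sum_(i <- r) F i x) /\
  'D_v (fun x => \sum_(i <- r) F i x) = fun x => \sum_(i <- r) 'D_v (F i) x.
Proof.
move=> sF; elim: r => [|i r [IH1 IH2]].
  under eq_fun do rewrite big_nil.
  split; first exact: smooth_cst.
  by apply/funext => x; rewrite big_nil; exact: derive_cst.
under eq_fun do rewrite big_cons.
split; first exact: smoothD.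
rewrite derive_smoothD//; apply/funext => x; rewrite big_cons; congr (_ + _).
exact: (congr1 (fun f => f x) IH2).
Qed.

Lemma smooth_pol N c : smooth (pol N c).
Proof.
apply: (smooth_sum _ e1 _).1 => i; apply: (smooth_sum _ e1 _).1 => j.
by apply: smoothZ; exact: smooth_mono.
Qed.

Lemma derive_pol N c v : 'D_v (pol N c) =
  fun x => \sum_(0 <= i < N) \sum_(0 <= j < N) c i j * 'D_v (mono i j) x.
Proof.
have s1 i : smooth (fun x => \sum_(0 <= j < N) c i j * mono i j x).
  by apply: (smooth_sum _ e1 _).1 => j; apply: smoothZ; exact: smooth_mono.
rewrite /pol (smooth_sum _ v s1).2; apply/funext => x.
apply: eq_bigr => i _.
have s2 j : smooth (fun x => c i j * mono i j x) by apply: smoothZ; exact: smooth_mono.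
etransitivity; first exact: (congr1 (fun f => f x) (smooth_sum (index_iota 0 N) v s2).2).
apply: eq_bigr => j _.
exact: (congr1 (fun f => f x) (derive_smoothZ (c i j) v (smooth_mono i j))).
Qed.

Definition D1c c i j : R := i.+1%:R * c i.+1 j.
Definition D2c c i j : R := j.+1%:R * c i j.+1.

Lemma sum_shift N (a : nat -> R) (b : nat -> R) : a N = 0 ->
  \sum_(0 <= i < N) a i * (i%:R * b i.-1) = \sum_(0 <= i < N) (i.+1%:R * a i.+1) * b i.
Proof.
case: N => [|N] aN; first by rewrite !big_geq.
rewrite big_nat_recl//= mul0r mulr0 add0r [RHS]big_nat_recr//= aN mulr0 mul0r addr0.
by apply: eq_bigr => i _; rewrite mulrA (mulrC (a _)).
Qed.

Lemma pol_D1 N c : (forall j, c N j = 0) -> 'D_e1 (pol N c) = pol N (D1c c).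
Proof.
move=> cN; rewrite derive_pol; apply/funext => x; rewrite /pol.
rewrite exchange_big [RHS]exchange_big /=; apply: eq_bigr => j _.
rewrite -(@sum_shift N (c ^~ j) (fun i => mono i j x))//.
by apply: eq_bigr => i _; congr (_ * _); exact: (congr1 (fun f => f x) (derive_mono1 i j)).
Qed.

Lemma pol_D2 N c : (forall i, c i N = 0) -> 'D_e2 (pol N c) = pol N (D2c c).
Proof.
move=> cN; rewrite derive_pol; apply/funext => x; rewrite /pol.
apply: eq_bigr => i _.
rewrite -(@sum_shift N (c i) (fun j => mono i j x))//.
by apply: eq_bigr => j _; congr (_ * _); exact: (congr1 (fun f => f x) (derive_mono2 i j)).
Qed.

Lemma sum_pow_eq0 N (E : nat -> R) a b : a < b ->
  (forall t, a < t < b -> \sum_(0 <= i < N) E i * t ^+ i = 0) ->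
  forall i, (i < N)%N -> E i = 0.
Proof.
move=> ab H; pose p := \poly_(i < N) E i.
have pt t : a < t < b -> root p t.
  move=> tab; rewrite /root horner_poly; apply/eqP.
  by rewrite -[RHS](H _ tab) big_mkord.
suff p0 : p = 0 by move=> i iN; have := coef_poly N E i; rewrite -/p p0 coef0 iN.
apply/eqP/negPn/negP => pn0.
(* [N.+1] equidistant points strictly between [a] and [b]: more roots than a nonzero polynomial with
   [N] coefficients can have. *)
pose pts := [seq a + (b - a) * (l.+1%:R / N.+2%:R) | l <- iota 0 N.+1].
have u : uniq pts.
  rewrite map_inj_uniq ?iota_uniq// => l m /addrI H0; move: H0 => /mulfI.
  rewrite gt_eqF ?subr_gt0// => /(_ isT)/mulIf.
  by rewrite invr_eq0 pnatr_eq0 => /(_ isT)/eqP; rewrite eqr_nat => /eqP[].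
have rts : all (root p) pts.
  apply/allP => t /mapP[l]; rewrite mem_iota add0n => /andP[_ lN] ->; apply: pt.
  have q0 : 0 < (l.+1%:R / N.+2%:R : R) by rewrite divr_gt0 ?ltr0n.
  have q1 : (l.+1%:R / N.+2%:R : R) < 1 by rewrite ltr_pdivrMr ?ltr0n// mul1r ltr_nat.
  have ba : 0 < b - a by rewrite subr_gt0.
  rewrite ltrDl mulr_gt0//= -ltrBrDl -[ltRHS]mulr1 ltr_pM2l//.
have := max_poly_roots pn0 rts u.
by rewrite size_map size_iota ltnNge (leq_trans (size_poly _ _))// leqnSn.
Qed.

Lemma pol_eq0 N c a1 b1 a2 b2 : a1 < b1 -> a2 < b2 ->
  (forall x, box a1 b1 a2 b2 x -> pol N c x = 0) ->
  forall i j, (i < N)%N -> (j < N)%N -> c i j = 0.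
Proof.
move=> ab1 ab2 H i j iN jN.
apply: (@sum_pow_eq0 N (c i) a2 b2) => // t tab.
apply: (@sum_pow_eq0 N (fun i => \sum_(0 <= j < N) c i j * t ^+ j) a1 b1) => // s sab.
rewrite -[RHS](H (s, t)); last by move: tab sab => /andP[? ?] /andP[? ?]; split.
rewrite /pol; apply: eq_bigr => {iN}i _; rewrite mulr_suml; apply: eq_bigr => {jN}j _.
by rewrite /mono /= -mulrA (mulrC (t ^+ j)).
Qed.

Lemma poly2_D k c : exists c1 c2,
  'D_e1 (poly2 k.+1 c) = poly2 k c1 /\ 'D_e2 (poly2 k.+1 c) = poly2 k c2.
Proof.
pose t := trunc k.+1 c; have tb : bounded_deg k.+1 t := @trunc_bounded k.+1 c.
exists (D1c t), (D2c t).
rewrite poly2E -/t -(@pol_widen _ k.+3); [|..]; last 2 first.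
- by move=> i j [ki|kj]; apply: tb; [rewrite (leq_trans ki)// leq_addr|rewrite (leq_trans kj)// leq_addl].
- by [].
rewrite pol_D1; last by move=> j; apply: tb; rewrite ltn_addr.
rewrite pol_D2; last by move=> j; apply: tb; rewrite ltn_addl.
have k3 : (k < k.+3)%N by rewrite ltnS -addn2 leq_addr.
split; apply: (pol_poly2 _ k3) => i j kij.
  by rewrite /D1c tb ?mulr0// addSn.
by rewrite /D2c tb ?mulr0// addnS.
Qed.

(* P(x, y) = int_0^y Q1(x, t) dt - int_0^x Q2(s, 0) ds *)
Lemma poly2_potential k a b a1 b1 a2 b2 : a1 < b1 -> a2 < b2 ->
  (forall x, box a1 b1 a2 b2 x -> 'D_e1 (poly2 k a) x + 'D_e2 (poly2 k b) x = 0) ->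
  exists p, 'D_e2 (poly2 k.+1 p) = poly2 k a /\
            'D_e1 (poly2 k.+1 p) = fun x => - poly2 k b x.
Proof.
move=> ab1 ab2.
pose ta := trunc k a; have tab : bounded_deg k ta := @trunc_bounded k a.
pose tb := trunc k b; have tbb : bounded_deg k tb := @trunc_bounded k b.
(* The common range [k.+3] exceeds the degree of the field and that of its potential, so
   coefficients at the upper end vanish and differentiation loses no term. *)
have k3 : (k < k.+3)%N by rewrite ltnS -addn2 leq_addr.
have wid c M : bounded_deg k c -> (k < M)%N -> pol M c = pol k.+1 c.
  move=> ck kM; apply: pol_widen => // i j [ki|kj]; apply: ck.
    by rewrite (leq_trans ki)// leq_addr.
  by rewrite (leq_trans kj)// leq_addl.
have Ea : poly2 k a = pol k.+3 ta by rewrite poly2E (wid _ _ _ k3).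
have Eb : poly2 k b = pol k.+3 tb by rewrite poly2E (wid _ _ _ k3).
have Da : 'D_e1 (pol k.+3 ta) = pol k.+3 (D1c ta).
  by apply: pol_D1 => j; apply: tab; rewrite ltn_addr// k3.
have Db : 'D_e2 (pol k.+3 tb) = pol k.+3 (D2c tb).
  by apply: pol_D2 => j; apply: tbb; rewrite ltn_addl// k3.
rewrite Ea Eb => div1.
have div0 x : box a1 b1 a2 b2 x -> pol k.+3 (D1c ta) x + pol k.+3 (D2c tb) x = 0.
  by move=> xb; rewrite -Da -Db; exact: div1.
have d0 i j : D1c ta i j + D2c tb i j = 0.
  have big : (k < i + j)%N -> D1c ta i j + D2c tb i j = 0.
    move=> kij; rewrite /D1c /D2c tab ?tbb ?mulr0 ?addr0//.
      by rewrite addnS ltnS ltnW.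
    by rewrite addSn ltnS ltnW.
  have [ik|ik] := ltnP i k.+3; last first.
    by apply: big; rewrite ltn_addr// (leq_trans _ ik)// ltnS -addn2 leq_addr.
  have [jk|jk] := ltnP j k.+3; last first.
    by apply: big; rewrite ltn_addl// (leq_trans _ jk)// ltnS -addn2 leq_addr.
  apply: (@pol_eq0 k.+3 (fun i j => D1c ta i j + D2c tb i j) a1 b1 a2 b2) => // x xb.
  rewrite -[RHS](div0 x xb) /pol -big_split; apply: eq_bigr => l _.
  by rewrite -big_split; apply: eq_bigr => m _; rewrite mulrDl.
pose p i j : R := if j is j'.+1 then ta i j' / j'.+1%:R
                  else if i is i'.+1 then - tb i' 0 / i'.+1%:R else 0.
have pb : bounded_deg k.+1 p.
  move=> [|i] [|j] //=; rewrite ?add0n ?addn0 ?addnS ?addSn ltnS => H.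
  - by rewrite tab ?mul0r.
  - by rewrite tbb ?oppr0 ?mul0r// addn0.
  - by rewrite tab ?mul0r// addSn.
exists p.
rewrite -(@pol_poly2 k.+1 k.+3)//.
rewrite pol_D1; last by move=> j; apply: pb; rewrite ltn_addr.
rewrite pol_D2; last by move=> j; apply: pb; rewrite ltn_addl.
split.
  congr pol; apply/funext => i; apply/funext => j.
  by rewrite /D2c /p mulrC divfK ?pnatr_eq0.
have -> : (fun x => - pol k.+3 tb x) = pol k.+3 (fun i j => - tb i j).
  apply/funext => x; rewrite /pol -sumrN; apply: eq_bigr => i _.
  by rewrite -sumrN; apply: eq_bigr => j _; rewrite mulNr.
congr pol; apply/funext => i; apply/funext => -[|j]; rewrite /D1c /p.
  by rewrite mulrC divfK ?pnatr_eq0.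
(* For positive powers of y, the identity for the first derivative is the vanishing divergence, read
   coefficientwise. *)
have := d0 i j; rewrite /D1c /D2c => /eqP; rewrite addr_eq0 => /eqP E.
by rewrite mulrA E mulNr mulrC mulKf ?pnatr_eq0.
Qed.

End Polynomials.

(** * Orthogonal projection *)

Section Projection.
Context {R : realType} (V : lmodType R) (D : set V) (B : V -> V -> R).
Hypothesis D0 : D 0.
Hypothesis DL : forall a u v, D u -> D v -> D (a *: u + v).
Hypothesis BC : forall u v, D u -> D v -> B u v = B v u.
Hypothesis BL : forall a u v w, D u -> D v -> D w ->
  B (a *: u + v) w = a * B u w + B v w.
Hypothesis B_ge0 : forall u, D u -> 0 <= B u u.

(** The degenerate case of the Cauchy-Schwarz inequality: along [t *: s + v] the form is affine in
    [t] and nonnegative, hence has slope zero. A nonzero slope would allow the choice of [t] that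
    yields the value -1. *)
Lemma form_null s v : D s -> D v -> B s s = 0 -> B s v = 0.
Proof.
move=> Ds Dv s0.
have H t : 0 <= 2 * t * B s v + B v v.
  have := B_ge0 (DL t Ds Dv).
  rewrite BL//; last exact: DL.
  rewrite (BC Ds) ?(BC Dv); [|exact: DL|exact: DL].
  by rewrite !BL// s0 (BC Dv Ds) => h; apply: le_trans h _; rewrite le_eqVlt; apply/orP; left; apply/eqP; ring.
apply/eqP; apply: contrapT => /negP nz.
have := H (- (B v v + 1) / (2 * B s v)).
rewrite (_ : 2 * _ * _ = - (B v v + 1)); last by field.
by rewrite opprD addrAC addNr add0r oppr_ge0 ler10.
Qed.

Lemma D_scale a u : D u -> D (a *: u).
Proof. by move=> Du; rewrite -[_ *: _]addr0; exact: DL. Qed.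

Lemma D_sub u v : D u -> D v -> D (u - v).
Proof. by move=> Du Dv; rewrite addrC -scaleN1r; exact: DL. Qed.

Lemma form_0l w : D w -> B 0 w = 0.
Proof.
move=> Dw; have := BL 1 D0 D0 Dw; rewrite scaler0 addr0 mul1r => /eqP.
by rewrite -subr_eq0 opprD addNKr oppr_eq0 => /eqP.
Qed.

Lemma form_Zl a u w : D u -> D w -> B (a *: u) w = a * B u w.
Proof. by move=> Du Dw; rewrite -[a *: u]addr0 BL// form_0l// addr0. Qed.

Lemma form_Bl u v w : D u -> D v -> D w -> B (u - v) w = B u w - B v w.
Proof. by move=> Du Dv Dw; rewrite addrC -scaleN1r BL// mulN1r addrC. Qed.

Lemma form_sum n (c : nat -> R) (e : nat -> V) w : (forall i, (i < n)%N -> D (e i)) ->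
  D w -> D (\sum_(0 <= i < n) c i *: e i) /\
  B (\sum_(0 <= i < n) c i *: e i) w = \sum_(0 <= i < n) c i * B (e i) w.
Proof.
move=> De Dw; elim: n De => [|n IH] De; first by rewrite !big_geq// form_0l.
have [|D1 B1] := IH; first by move=> i ni; apply: De; exact: ltnW.
rewrite !big_nat_recr//= addrC; split; first by apply: DL => //; exact: De.
by rewrite BL ?B1 1?addrC//; exact: De.
Qed.

Variable X : set V.
Hypothesis XD : X `<=` D.
Hypothesis X0 : X 0.
Hypothesis XL : forall a u v, X u -> X v -> X (a *: u + v).
Variable N : nat.
Hypothesis X_fin : forall f : nat -> V, (forall i, X (f i)) ->
  exists u : nat -> R, (exists2 i, (i < N.+1)%N & u i != 0) /\
    B (\sum_(0 <= i < N.+1) u i *: f i) (\sum_(0 <= i < N.+1) u i *: f i) = 0.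

Definition orthonormal_family n (e : nat -> V) : Prop :=
  (forall i, X (e i)) /\
  forall i j, (i < n)%N -> (j < n)%N -> B (e i) (e j) = (i == j)%:R.

(** A nontrivial null combination of [N.+1] orthonormal vectors is orthogonal to each of them by
    [form_null], which forces its coefficients to vanish. *)
Lemma orthonormal_bound n e : orthonormal_family n e -> (n <= N)%N.
Proof.
move=> [Xe eij]; rewrite leqNgt; apply/negP => Nn.
have [u [[j jN uj] s0]] := X_fin Xe.
have [Ds _] := form_sum u (fun i _ => XD (Xe i)) (XD (Xe j)) (n := N.+1).
have := form_null Ds (XD (Xe j)) s0.
have [_ ->] := form_sum u (fun i _ => XD (Xe i)) (XD (Xe j)) (n := N.+1).
rewrite big_mkord (bigD1 (Ordinal jN))//= eij ?(leq_trans jN)// eqxx mulr1 big1 ?addr0.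
  by move=> /eqP; rewrite (negbTE uj).
move=> i; rewrite -val_eqE /= => /negbTE ij.
by rewrite eij ?(leq_trans (ltn_ord i))// ?(leq_trans jN)// ij mulr0.
Qed.

(** An orthonormal family of maximal length spans [X] up to null vectors: otherwise the remainder
    [q - s] of some [q], normalised, would extend it. Null vectors are invisible to the form, so the
    Fourier sum of [g] is a projection. *)
Lemma projection_exists g : D g -> exists2 p, X p & forall q, X q -> B (g - p) q = 0.
Proof.
move=> Dg.
have [n [e one] nmax] : exists2 n, exists e, orthonormal_family n e &
    forall e, ~ orthonormal_family n.+1 e.
  pose P n := `[< exists e, orthonormal_family n e >].
  have P0 : exists n, P n by exists 0%N; apply/asboolP; exists (cst 0).
  have Pb n : P n -> (n <= N)%N by move=> /asboolP[e]; exact: orthonormal_bound.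
  case: (ex_maxnP P0 Pb) => n /asboolP[e one] nmax.
  exists n; first by exists e.
  by move=> e' one'; have := nmax n.+1; rewrite ltnn => H; have := H (asboolT (ex_intro _ e' one')).
have [Xe eij] := one; have De i : (i < n)%N -> D (e i) by move=> _; exact/XD/Xe.
have Xsum (c : nat -> R) : X (\sum_(0 <= i < n) c i *: e i).
  elim: (n) => [|m IH]; first by rewrite big_geq.
  by rewrite big_nat_recr//= addrC; apply: XL => //; exact: Xe.
have coef (c : nat -> R) j : (j < n)%N -> B (\sum_(0 <= i < n) c i *: e i) (e j) = c j.
  move=> jn; rewrite (form_sum c De (De _ jn)).2.
  rewrite big_mkord (bigD1 (Ordinal jn))//= eij// eqxx mulr1 big1 ?addr0//.
  by move=> i; rewrite -val_eqE /= => /negbTE ij; rewrite eij// ij mulr0.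
pose p := \sum_(0 <= i < n) B g (e i) *: e i.
exists p; first exact: Xsum.
move=> q Xq; have Dq := XD Xq; have Dp : D p by exact/XD/Xsum.
have Dgp : D (g - p) by exact: D_sub.
pose s := \sum_(0 <= i < n) B q (e i) *: e i.
have Xs : X s by exact: Xsum.
have Ds := XD Xs.
have Xr : X (q - s) by rewrite addrC -scaleN1r; exact: XL.
have Dr := XD Xr.
have rej j : (j < n)%N -> B (q - s) (e j) = 0.
  by move=> jn; rewrite form_Bl ?coef ?subrr//; exact: De.
have r0 : B (q - s) (q - s) = 0.
  apply/eqP; apply: contrapT => /negP rn0.
  have rpos : 0 < B (q - s) (q - s) by rewrite lt_neqAle eq_sym rn0 B_ge0.
  pose k := (Num.sqrt (B (q - s) (q - s)))^-1.
  pose e' i := if i == n then k *: (q - s) else e i.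
  have kk : k * k * B (q - s) (q - s) = 1.
    rewrite /k -invfM -expr2 sqr_sqrtr ?ltW// mulVf//.
  have Dkr : D (k *: (q - s)) by exact: D_scale.
  apply: (nmax e'); split.
    move=> i; rewrite /e'; case: ifP => // _.
    by rewrite -[_ *: _]addr0; exact: XL.
  move=> i j; rewrite !ltnS /e' => iN jN.
  have [ein|i_n] := boolP (i == n); have [ejn|j_n] := boolP (j == n).
  - by rewrite (eqP ein) (eqP ejn) eqxx form_Zl// BC// form_Zl// mulrA kk.
  - have jn : (j < n)%N by rewrite ltn_neqAle j_n.
    rewrite (eqP ein) [n == j]eq_sym (negbTE j_n) form_Zl ?rej ?mulr0//; exact: De.
  - have ilt : (i < n)%N by rewrite ltn_neqAle i_n.
    by rewrite (eqP ejn) (negbTE i_n) BC ?form_Zl ?rej ?mulr0//; exact: De.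
  - by apply: eij; rewrite ltn_neqAle ?i_n ?j_n.
rewrite -(subrK s q) (BC Dgp); last by rewrite subrK.
rewrite addrC -[s in s + _]scale1r BL//.
rewrite (form_null Dr Dgp r0) addr0 mul1r (form_sum _ De Dgp).2 big_nat big1// => i /andP[_ ni].
have Dei := De _ ni.
by rewrite (BC Dei Dgp) form_Bl// coef// subrr mulr0.
Qed.

End Projection.

(** * Combining almost-everywhere statements *)

Section AlmostEverywhere.
Context {R : realType}.
Implicit Types P Q : R * R -> Prop.

Lemma ae_mono P Q : {ae leb2, forall x, P x} -> (forall x, P x -> Q x) ->
  {ae leb2, forall x, Q x}.
Proof. by move=> aeP PQ; apply: negligibleS aeP => x /= nQ /PQ. Qed.

Lemma ae_and P Q : {ae leb2, forall x, P x} -> {ae leb2, forall x, Q x} ->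
  {ae leb2, forall x, P x /\ Q x}.
Proof.
move=> aeP aeQ; apply: negligibleS (negligibleU aeP aeQ) => x /= /not_andP[]; by [left|right].
Qed.

Lemma ae_all (I : eqType) (s : seq I) (P : I -> R * R -> Prop) :
  (forall i, i \in s -> {ae leb2, forall x, P i x}) ->
  {ae leb2, forall x, forall i, i \in s -> P i x}.
Proof.
elim: s => [|i s IH] H; first by apply: aeW.
have h1 := H i (mem_head i s).
have h2 : {ae leb2, forall x, forall j, j \in s -> P j x}.
  by apply: IH => j js; apply: H; rewrite inE js orbT.
apply: (ae_mono (ae_and h1 h2)) => x [Pi Ps] j.
by rewrite inE => /orP[/eqP ->//|]; exact: Ps.
Qed.

End AlmostEverywhere.

(** * Square-integrable functions and fields *)

Section SquareIntegrable.
Context {R : realType}.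
Local Notation mR2 := (measurableTypeR R * measurableTypeR R)%type.
Variable Omega : set (R * R).
Hypothesis mO : measurable (Omega : set mR2).
Implicit Types f g : R * R -> R.

Lemma L2_sqr_bound (a b : R) : `|a * b| <= a ^+ 2 + b ^+ 2.
Proof.
rewrite normrM -(real_normK (num_real a)) -(real_normK (num_real b)).
have := sqr_ge0 (`|a| - `|b|); have := sqr_ge0 (`|a| + `|b|).
have := normr_ge0 a; have := normr_ge0 b; nra.
Qed.

Lemma L2_integrableM f g : L2 Omega f -> L2 Omega g ->
  leb2.-integrable Omega (EFin \o (fun x => f x * g x)).
Proof.
move=> [mf if2] [mg ig2].
have H : leb2.-integrable Omega (fun x => (f x ^+ 2)%:E + (g x ^+ 2)%:E)%E.
  exact: integrableD.
apply: (le_integrable mO _ _ H).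
  by apply/measurable_EFinP; exact: measurable_funM.
move=> x _ /=; rewrite lee_fin (le_trans (L2_sqr_bound _ _))// ger0_norm//.
by rewrite addr_ge0 ?sqr_ge0.
Qed.

Lemma L2_lin a f g : L2 Omega f -> L2 Omega g -> L2 Omega (fun x => a * f x + g x).
Proof.
move=> Lf Lg; have [mf if2] := Lf; have [mg ig2] := Lg.
have mh : measurable_on Omega (fun x => a * f x + g x).
  by apply: measurable_funD => //; apply: measurable_funM => //; exact: measurable_cst.
split=> //.
pose h1 x := a ^+ 2 * (f x * f x); pose h2 x := (2 * a) * (f x * g x).
pose h3 x := g x * g x.
have H1 : leb2.-integrable Omega (EFin \o h1).
  exact: (integrable_mull _ mO (L2_integrableM Lf Lf)).
have H2 : leb2.-integrable Omega (EFin \o h2).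
  exact: (integrable_mull _ mO (L2_integrableM Lf Lg)).
have H3 : leb2.-integrable Omega (EFin \o h3) by exact: L2_integrableM.
have H : leb2.-integrable Omega ((EFin \o h1) \+ (EFin \o h2) \+ (EFin \o h3))%E.
  by apply: integrableD => //; exact: integrableD.
congr (leb2.-integrable _ _): H; apply/funext => x /=.
by rewrite -!EFinD; congr (_%:E); rewrite /h1 /h2 /h3; ring.
Qed.

Lemma L2_cst0 : L2 Omega (cst 0).
Proof.
split; first exact: measurable_cst.
rewrite (_ : (fun _ => _) = cst 0%E); first exact: integrable0.
by apply/funext => x; rewrite expr0n.
Qed.

Lemma L2_Z a f : L2 Omega f -> L2 Omega (fun x => a * f x).
Proof.
move=> Lf; have := L2_lin a Lf L2_cst0.
by under eq_fun do rewrite addr0.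
Qed.

Lemma L2v_lin a (u v : R * R -> R * R) : L2v Omega u -> L2v Omega v ->
  L2v Omega (a *: u + v).
Proof. by move=> [u1 u2] [v1 v2]; split; exact: L2_lin. Qed.

Lemma L2v_0 : L2v Omega 0.
Proof. by split; exact: L2_cst0. Qed.

Lemma integrable_dot (u v : R * R -> R * R) : L2v Omega u -> L2v Omega v ->
  leb2.-integrable Omega (EFin \o (fun x => dot (u x) (v x))).
Proof.
move=> [u1 u2] [v1 v2].
exact: (integrableD mO (L2_integrableM u1 v1) (L2_integrableM u2 v2)).
Qed.

Lemma L2v_innerC (u v : R * R -> R * R) : L2v_inner Omega u v = L2v_inner Omega v u.
Proof. by apply: eq_Rintegral => x _; rewrite /dot; ring. Qed.

Lemma L2v_innerL a (u v w : R * R -> R * R) : L2v Omega u -> L2v Omega v -> L2v Omega w ->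
  L2v_inner Omega (a *: u + v) w = a * L2v_inner Omega u w + L2v_inner Omega v w.
Proof.
move=> Lu Lv Lw; have iu := integrable_dot Lu Lw; have iv := integrable_dot Lv Lw.
rewrite /L2v_inner -RintegralZl// -RintegralD//; last exact: integrable_mull.
by apply: eq_Rintegral => x _; rewrite /dot /= /GRing.scale/=; ring.
Qed.

Lemma L2v_inner_ge0 (u : R * R -> R * R) : 0 <= L2v_inner Omega u u.
Proof. by apply: Rintegral_ge0 => x _; rewrite /dot addr_ge0// -expr2 sqr_ge0. Qed.

Lemma L2v_inner_ae (u v w : R * R -> R * R) : L2v Omega u -> L2v Omega v -> L2v Omega w ->
  {ae leb2, forall x, Omega x -> u x = v x} -> L2v_inner Omega u w = L2v_inner Omega v w.
Proof.
move=> Lu Lv Lw uv; rewrite /L2v_inner; congr fine; apply: ae_eq_integral => //.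
- by case/integrableP: (integrable_dot Lu Lw).
- by case/integrableP: (integrable_dot Lv Lw).
- by apply: (ae_mono uv) => x H Ox; rewrite H.
Qed.

Lemma L2v_inner_eq0 (u : R * R -> R * R) : L2v Omega u -> L2v_inner Omega u u = 0 ->
  {ae leb2, forall x, Omega x -> u x = 0}.
Proof.
move=> Lu u0; have iu := integrable_dot Lu Lu.
have mu_ : measurable_fun Omega (EFin \o (fun x => dot (u x) (u x))) by case/integrableP: iu.
have dge0 x : 0 <= dot (u x) (u x) by rewrite /dot addr_ge0// -expr2 sqr_ge0.
have /(ae_eq_integral_abs _ mO mu_) H :
    (\int[leb2]_(x in Omega) `|(EFin \o (fun x => dot (u x) (u x))) x|)%E = 0%E.
  under eq_integral do rewrite gee0_abs ?lee_fin//.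
  have := u0; rewrite /L2v_inner /Rintegral => u0'.
  by rewrite -[LHS]fineK ?u0'//; exact: integrable_fin_num.
apply: (ae_mono H) => x /[apply] /= -[] /eqP; rewrite /dot paddr_eq0 -?expr2 ?sqr_ge0//.
by rewrite !sqrf_eq0 => /andP[/eqP u1 /eqP u2]; rewrite [u x]surjective_pairing u1 u2.
Qed.

Lemma bcs2_L2 f : bcs2 f -> L2 Omega f.
Proof.
move=> bf; split; first by apply: measurable_funTS; case: bf.
have [mf [M [fM f0]]] := bf.
have b2 : bcs2 (fun x => f x * f x).
  by apply: bcs2M => // r; exists M.
exact: integrableS (bcs2_integrable b2).
Qed.

Lemma L2_ae f g : measurable_on Omega f -> L2 Omega g ->
  {ae leb2, forall x, Omega x -> f x = g x} -> L2 Omega f.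
Proof.
move=> mf [mg /integrableP[mg2 ig2]] fg; split=> //.
have mf2 : measurable_fun Omega (fun x => (f x ^+ 2)%:E : \bar R).
  by apply/measurable_EFinP; exact: measurable_funX.
apply/integrableP; split=> //.
rewrite (_ : integral _ _ _ = \int[leb2]_(x in Omega) `|(g x ^+ 2)%:E|)%E//.
apply: ae_eq_integral => //; [exact: measurableT_comp|exact: measurableT_comp|].
by apply: (ae_mono fg) => x H Ox; rewrite H.
Qed.

End SquareIntegrable.

(** * Piecewise polynomials: representatives, finite dimension, projection *)

Section PiecewisePolynomials.
Context {R : realType}.
Local Notation mR2 := (measurableTypeR R * measurableTypeR R)%type.

Lemma closed_measurable2 (K : set (R * R)) : closed K -> measurable (K : set mR2).
Proof.
by move=> cK; rewrite -[K]setCK; apply: measurableC; apply: open_measurable2; exact: closed_openC.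
Qed.

(** Earlier sets of the list override later ones. On overlaps the value is thus the one prescribed
    by some set containing the point, everywhere and not just almost everywhere. *)
Lemma glue_closed (s : seq (set (R * R))) (F : set (R * R) -> R * R -> R) :
  (forall K, K \in s -> closed K) -> (forall K, continuous (F K)) ->
  exists h : R * R -> R, [/\ meas2 h,
    forall r, exists M, forall x, `|x| <= r -> `|h x| <= M &
    forall x, (exists2 K, K \in s & K x) -> exists2 K, K \in s & K x /\ h x = F K x].
Proof.
elim: s => [|K s IH] cs cF.
  exists (cst 0); split; first exact: measurable_cst.
    by move=> r; exists 0 => x _; rewrite normr0.
  by move=> x [].
have [|h [mh bh hs]] := IH _ cF; first by move=> L Ls; apply: cs; rewrite inE Ls orbT.
have mK : measurable (K : set mR2) by apply: closed_measurable2; apply: cs; exact: mem_head.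
have mi : meas2 (\1_K) by exact: measurable_indic.
exists (fun x => \1_K x * F K x + (1 - \1_K x) * h x); split.
- apply: measurable_funD; apply: measurable_funM => //; first exact: continuous_meas2.
  by apply: measurable_funB => //; exact: measurable_cst.
- move=> r; have [M hM] := bh r; have [N FN] := continuous_lbounded2 (cF K) r.
  exists (Num.max M N) => x xr; rewrite indicE; case: (x \in K) => /=.
    by rewrite mul1r subrr mul0r addr0 le_max FN// orbT.
  by rewrite mul0r add0r subr0 mul1r le_max hM.
- move=> x [L Ls Lx]; rewrite indicE; case: (boolP (x \in K)) => xK.
    exists K; first exact: mem_head.
    split; first by move: xK; rewrite inE.
    by rewrite mul1r subrr mul0r addr0.
  have [|L' L's [L'x hL']] := hs x.
    exists L => //; move: Ls; rewrite inE => /orP[/eqP LK|//].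
    by move: xK; rewrite -LK mem_set.
  exists L'; first by rewrite inE L's orbT.
  by rewrite mul0r add0r subr0 mul1r.
Qed.

Variables (Omega : set (R * R)) (rad : R) (T : set (set (R * R))).
Hypothesis oO : open Omega.
Hypothesis bO : forall x, Omega x -> `|x| <= rad.
Hypothesis fT : finite_set T.
Hypothesis tT : forall K, T K -> is_triangle K.
Hypothesis OT : Omega `<=` \bigcup_(K in T) K.

Let mO : measurable (Omega : set mR2). Proof. exact: open_measurable2. Qed.

Lemma smooth_poly2 k c : smooth (@poly2 R k c).
Proof. by rewrite poly2E; exact: smooth_pol. Qed.

Lemma piecewise_ae_all (P : set (R * R) -> R * R -> Prop) :
  (forall K, T K -> {ae leb2, forall x, P K x}) ->
  {ae leb2, forall x, forall K, T K -> P K x}.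
Proof.
move=> HP; have [s sT] := (finite_seqP T).1 fT.
have H : {ae leb2, forall x, forall K, K \in s -> P K x}.
  by apply: ae_all => K Ks; apply: HP; rewrite sT.
by apply: (ae_mono H) => x Hx K; rewrite sT; exact: Hx.
Qed.

Lemma glue_polys k (F : set (R * R) -> nat -> nat -> R) :
  exists h : R * R -> R, [/\ bcs2 h, forall x, ~ Omega x -> h x = 0 &
    forall x, Omega x -> exists2 K, T K & K x /\ h x = poly2 k (F K) x].
Proof.
have [s sT] := (finite_seqP T).1 fT.
have [||h [mh bh hs]] := @glue_closed s (fun K => poly2 k (F K)).
- by move=> K Ks; apply: (triangle_open_part _).1; apply: tT; rewrite sT.
- by move=> K; apply: smooth_continuous; exact: smooth_poly2.
exists (fun x => \1_Omega x * h x); split.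
- split; first by apply: measurable_funM => //; exact: measurable_indic.
  have [M hM] := bh rad; exists (Num.max M (Num.max rad 0)); split=> x.
    rewrite indicE; case: (boolP (x \in Omega)) => [|_]; last first.
      by rewrite mul0r normr0 !le_max lexx !orbT.
    by rewrite inE => Ox; rewrite mul1r le_max hM//; exact: bO.
  rewrite !gt_max => /andP[_ /andP[rx _]]; rewrite indicE.
  case: (boolP (x \in Omega)) => [|_]; last by rewrite mul0r.
  by rewrite inE => /bO; rewrite leNgt rx.
- by move=> x nO; rewrite indicE memNset// mul0r.
- move=> x Ox; have [|K Ks [Kx hK]] := hs x.
    by have [K TK Kx] := OT Ox; exists K => //; move: TK; rewrite sT.
  by exists K; [rewrite sT|split=> //; rewrite indicE mem_set// mul1r].
Qed.

Lemma Pk_coef k f : Pk Omega k T f -> exists F : set (R * R) -> nat -> nat -> R,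
  {ae leb2, forall x, forall K, T K -> Omega x -> K x -> f x = poly2 k (F K) x}.
Proof.
move=> [mf Hf].
have H K : exists c, T K -> {ae leb2, forall x, Omega x -> K x -> f x = poly2 k c x}.
  have [TK|nTK] := pselect (T K); last by exists (fun _ _ => 0).
  by have [c Hc] := Hf K TK; exists c.
exists (fun K => projT1 (cid (H K))); apply: piecewise_ae_all => K TK.
exact: (projT2 (cid (H K)) TK).
Qed.

(** An element of [Pk] is arbitrary outside [Omega] and on null sets. This representative may be
    integrated over the whole plane against test functions. *)
Lemma Pk_rep k f : Pk Omega k T f -> exists h : R * R -> R,
  [/\ bcs2 h, forall x, ~ Omega x -> h x = 0 &
      {ae leb2, forall x, Omega x -> f x = h x}].
Proof.
move=> /Pk_coef[F HF]; have [h [bh h0 hF]] := glue_polys k F.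
exists h; split => //; apply: (ae_mono HF) => x Hx Ox.
by have [K TK [Kx ->]] := hF x Ox; exact: Hx.
Qed.

Lemma Pk_L2 k f : Pk Omega k T f -> L2 Omega f.
Proof.
move=> Pf; have [h [bh _ fh]] := Pk_rep Pf.
by apply: (L2_ae mO _ (bcs2_L2 mO bh) fh); case: Pf.
Qed.

Lemma Xh_L2v k q : Xh Omega k T q -> L2v Omega q.
Proof. by move=> [q1 q2]; split; [exact: Pk_L2 q1|exact: Pk_L2 q2]. Qed.

Lemma poly2_lin k a c d x : @poly2 R k (fun i j => a * c i j + d i j) x =
  a * poly2 k c x + poly2 k d x.
Proof.
rewrite /poly2 mulr_sumr -big_split; apply: eq_bigr => i _ /=.
rewrite mulr_sumr -big_split; apply: eq_bigr => j _ /=; ring.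
Qed.

Lemma poly2_cst k m : @poly2 R k (fun i j => if (i == 0%N) && (j == 0%N) then m else 0) = cst m.
Proof.
apply/funext => x; rewrite /poly2 big_ord_recl/= [X in _ + X]big1 ?addr0; last first.
  by move=> i _; rewrite big1// => j _; rewrite !mul0r.
rewrite subn0 big_ord_recl/= [X in _ + X]big1 ?addr0 ?expr0 ?mulr1//.
by move=> i _; rewrite !mul0r.
Qed.

Lemma Pk_lin k a f g : Pk Omega k T f -> Pk Omega k T g ->
  Pk Omega k T (fun x => a * f x + g x).
Proof.
move=> [mf Hf] [mg Hg]; split.
  by apply: measurable_funD => //; apply: measurable_funM => //; exact: measurable_cst.
move=> K TK; have [c Hc] := Hf K TK; have [d Hd] := Hg K TK.
exists (fun i j => a * c i j + d i j); apply: (ae_mono (ae_and Hc Hd)) => x [cx dx] Ox Kx.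
by rewrite poly2_lin cx// dx.
Qed.

Lemma Pk_cst k m : Pk Omega k T (cst m).
Proof.
split; first exact: measurable_cst.
move=> K _; exists (fun i j => if (i == 0%N) && (j == 0%N) then m else 0).
by apply: aeW => x _ _; rewrite poly2_cst.
Qed.

Lemma Xh_lin k a (u v : R * R -> R * R) : Xh Omega k T u -> Xh Omega k T v ->
  Xh Omega k T (a *: u + v).
Proof. by move=> [u1 u2] [v1 v2]; split; exact: Pk_lin. Qed.

Lemma Xh_0 k : Xh Omega k T 0.
Proof. by split; exact: Pk_cst. Qed.

Lemma Pk_ae k f g : measurable_on Omega g -> Pk Omega k T f ->
  {ae leb2, forall x, Omega x -> g x = f x} -> Pk Omega k T g.
Proof.
move=> mg [mf Hf] gf; split=> // K TK; have [c Hc] := Hf K TK; exists c.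
by apply: (ae_mono (ae_and gf Hc)) => x [gx fx] Ox Kx; rewrite gx// fx.
Qed.

Lemma kernel_row (m n : nat) (A : 'M[R]_(m, n)) : (n < m)%N ->
  exists2 u : 'rV[R]_m, u != 0 & u *m A = 0.
Proof.
move=> nm; have kn0 : kermx A != 0.
  by rewrite -mxrank_eq0 mxrank_ker subn_eq0 -ltnNge (leq_ltn_trans (rank_leq_col A)).
exists (nz_row (kermx A)); first by rewrite nz_row_eq0.
by apply/eqP; rewrite -sub_kermx nz_row_sub.
Qed.

Lemma poly2_sum k n (u : 'I_n -> R) (c : 'I_n -> nat -> nat -> R) x :
  poly2 k (fun a b => \sum_(i < n) u i * c i a b) x = \sum_(i < n) u i * poly2 k (c i) x.
Proof.
rewrite /poly2.
under [RHS]eq_bigr do rewrite mulr_sumr.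
rewrite exchange_big; apply: eq_bigr => a _ /=.
under [RHS]eq_bigr do rewrite mulr_sumr.
rewrite exchange_big; apply: eq_bigr => b _ /=.
by rewrite !mulr_suml; apply: eq_bigr => i _; rewrite !mulrA.
Qed.

(* Finite dimension up to a.e. equality, hence phrased through the seminorm. *)
Lemma Xh_finite_dim k : exists N, forall f : nat -> (R * R -> R * R),
  (forall i, Xh Omega k T (f i)) ->
  exists u : nat -> R, (exists2 i, (i < N.+1)%N & u i != 0) /\
    L2v_inner Omega (\sum_(0 <= i < N.+1) u i *: f i) (\sum_(0 <= i < N.+1) u i *: f i) = 0.
Proof.
have [s sT] := (finite_seqP T).1 fT.
(* One coefficient for each triangle, component and pair of exponents. The coefficient matrix of one
   field more has more rows than columns, hence a nontrivial row relation. *)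
pose J : finType := ('I_(size s) * bool * ('I_k.+1 * 'I_k.+1))%type.
exists #|J| => f Xf.
have H i : exists F : (set (R * R) -> nat -> nat -> R) * (set (R * R) -> nat -> nat -> R),
    {ae leb2, forall x, forall K, T K -> Omega x -> K x ->
       (f i x).1 = poly2 k (F.1 K) x /\ (f i x).2 = poly2 k (F.2 K) x}.
  have [F1 H1] := Pk_coef (Xf i).1; have [F2 H2] := Pk_coef (Xf i).2.
  exists (F1, F2); apply: (ae_mono (ae_and H1 H2)) => x [h1 h2] K TK Ox Kx.
  by split; [exact: h1|exact: h2].
pose F i := projT1 (cid (H i)); have HF i := projT2 (cid (H i)).
pose co i (j : J) : R := (if j.1.2 then (F i).1 else (F i).2) (nth set0 s j.1.1) j.2.1 j.2.2.
pose A : 'M[R]_(#|J|.+1, #|J|) := \matrix_(i, j) co i (enum_val j).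
have [u un0 uA] := @kernel_row _ _ A (ltnSn #|J|).
have uco (j : J) : \sum_(i < #|J|.+1) u 0 i * co i j = 0.
  have := congr1 (fun M : 'rV_#|J| => M 0 (enum_rank j)) uA; rewrite !mxE => E.
  by rewrite -[RHS]E; apply: eq_bigr => i _; rewrite mxE enum_rankK.
pose v i := u 0 (inord i).
exists v; split.
  have /rV0Pn[i ui] := un0; exists i; first exact: ltn_ord.
  by rewrite /v inord_val.
set S := \sum_(0 <= i < _) _.
have SE x : S x = \sum_(i < #|J|.+1) u 0 i *: f i x.
  rewrite /S big_mkord fct_sumE; apply: eq_bigr => i _; rewrite /v inord_val //.
suff S0 : {ae leb2, forall x, Omega x -> S x = 0}.
  rewrite /L2v_inner /Rintegral (@ae_eq_integral _ _ _ leb2 Omega (cst 0%E)).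
  - by rewrite integral_cst// mul0e.
  - exact: mO.
  - have XS : Xh Omega k T S.
      rewrite /S; elim: (#|J|.+1) => [|m IH]; first by rewrite big_geq//; exact: Xh_0.
      by rewrite big_nat_recr//= addrC; exact: Xh_lin.
    by case/integrableP: (integrable_dot mO (Xh_L2v XS) (Xh_L2v XS)).
  - exact: measurable_cst.
  - by apply: (ae_mono S0) => x Sx Ox; rewrite Sx// /dot /= !mulr0 addr0.
have Hs : {ae leb2, forall x, forall i, i \in iota 0 #|J|.+1 ->
    forall K, T K -> Omega x -> K x ->
       (f i x).1 = poly2 k ((F i).1 K) x /\ (f i x).2 = poly2 k ((F i).2 K) x}.
  by apply: ae_all => i _; exact: HF.
apply: (ae_mono Hs) => x Hx Ox; have [K TK Kx] := OT Ox.
have Ks : K \in s by move: TK; rewrite sT.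
pose jK := Ordinal (etrans (index_mem K s) Ks).
have hx (i : 'I_(#|J|.+1)) : (f i x).1 = poly2 k ((F i).1 K) x /\
    (f i x).2 = poly2 k ((F i).2 K) x.
  by apply: Hx => //; rewrite mem_iota add0n ltn_ord.
have comp b : \sum_(i < #|J|.+1) u 0 i * poly2 k ((if b then (F i).1 else (F i).2) K) x = 0.
  rewrite -poly2_sum /poly2 big1// => p _; rewrite big1// => q _.
  have qk : (q < k.+1)%N by rewrite (leq_trans (ltn_ord q))// leq_subr.
  have := uco (jK, b, (p, Ordinal qk)); rewrite /co /= nth_index// => ->.
  by rewrite !mul0r.
rewrite SE [LHS]surjective_pairing.
have fstE : (\sum_(i < #|J|.+1) u 0 i *: f i x).1 = \sum_(i < #|J|.+1) u 0 i * (f i x).1.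
  by apply: (big_ind2 (fun (a : R * R) (b : R) => a.1 = b)) => // y1 ? y2 ? <- <-.
have sndE : (\sum_(i < #|J|.+1) u 0 i *: f i x).2 = \sum_(i < #|J|.+1) u 0 i * (f i x).2.
  by apply: (big_ind2 (fun (a : R * R) (b : R) => a.2 = b)) => // y1 ? y2 ? <- <-.
rewrite fstE sndE; congr (_, _).
  rewrite -[RHS](comp true); apply: eq_bigr => i _; by rewrite (hx i).1.
rewrite -[RHS](comp false); apply: eq_bigr => i _; by rewrite (hx i).2.
Qed.

(** Finite dimension, being a property of families, is inherited by every subspace [Z]; both [Xh]
    itself and the projected gradients of test functions occur as [Z]. *)
Lemma Xh_projection k (Z : set (R * R -> R * R)) g :
  Z `<=` Xh Omega k T -> Z 0 -> (forall a u v, Z u -> Z v -> Z (a *: u + v)) ->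
  L2v Omega g -> exists p, L2_projection Omega Z g p.
Proof.
move=> ZX Z0 ZL Lg; have [N HN] := Xh_finite_dim k.
have DL a u v : L2v Omega u -> L2v Omega v -> L2v Omega (a *: u + v) by exact: L2v_lin.
have BC u v : L2v Omega u -> L2v Omega v -> L2v_inner Omega u v = L2v_inner Omega v u.
  by move=> _ _; exact: L2v_innerC.
have B0 u : L2v Omega u -> 0 <= L2v_inner Omega u u by move=> _; exact: L2v_inner_ge0.
have ZD : Z `<=` L2v Omega by move=> q /ZX; exact: Xh_L2v.
have Zfin f : (forall i, Z (f i)) -> _ := fun Zf => HN f (fun i => ZX _ (Zf i)).
have [p Zp Hp] := projection_exists (L2v_0 Omega) DL BC (L2v_innerL mO) B0 ZD Z0 ZL Zfin Lg.
by exists p; split.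
Qed.

End PiecewisePolynomials.

(** * The potential of a discrete divergence-free field *)

Section Localization.
Context {R : realType}.

Lemma smooth_step (a b : R) : a < b -> exists2 s : R -> R, smooth1 s &
  (forall t, t <= a -> s t = 0) /\ (forall t, b <= t -> s t = 1).
Proof.
move=> ab; have [eta te Ie] := exists_unit_test1 ab.
have [se [a' [b' [aa bb e0]]]] := te.
have be := test1_bcs te.
have ce := smooth1_continuous se.
exists (prim eta); first by apply: (smooth1_prim _ se); exact: primP.
split=> t tt.
  apply: prim_left => u ut; apply: e0; rewrite negb_and -!ltNge.
  by rewrite (le_lt_trans ut) ?(le_lt_trans tt).
rewrite prim_right// => u tu; apply: e0; rewrite negb_and -!ltNge.
by rewrite (lt_trans bb) ?orbT// (le_lt_trans tt).
Qed.

Lemma plateau1 (a a1 b1 b : R) : a < a1 -> a1 < b1 -> b1 < b ->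
  exists2 f : R -> R, test1 a b f & forall t, a1 <= t <= b1 -> f t = 1.
Proof.
move=> aa ab bb; pose a2 := (a + a1) / 2; pose b2 := (b + b1) / 2.
have [|s1 ss1 [s10 s11]] := @smooth_step a2 a1; first by rewrite /a2; lra.
have [|s2 ss2 [s20 s21]] := @smooth_step b1 b2; first by rewrite /b2; lra.
exists (fun t => s1 t * (1 + (-1) * s2 t)).
  split.
    apply: smooth1M => //; apply: smooth1D; first exact: smooth1_cst.
    exact: smooth1Z.
  exists a2, b2; split; [by rewrite /a2; lra|by rewrite /b2; lra|].
  move=> t; rewrite negb_and -!ltNge => /orP[ta|tb].
    by rewrite s10 ?mul0r// ltW.
  by rewrite s21 ?mulN1r ?subrr ?mulr0// ltW.
by move=> t /andP[ta tb]; rewrite s11// s20// mulr0 addr0 mulr1.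
Qed.

Lemma plateau (x : R * R) r : 0 < r -> exists chi : R * R -> R,
  test_function (ball x r) chi /\ forall y, ball x (r / 2) y -> chi y = 1.
Proof.
move=> r0.
have [|||f tf f1] := @plateau1 (x.1 - r) (x.1 - r / 2) (x.1 + r / 2) (x.1 + r); [lra..|].
have [|||g tg g1] := @plateau1 (x.2 - r) (x.2 - r / 2) (x.2 + r / 2) (x.2 + r); [lra..|].
exists (tens f g); split; first by rewrite ball_box; exact: test_tens.
by move=> y; rewrite ball_box => -[? ? ? ?]; rewrite /tens f1 ?g1 ?mulr1//; apply/andP; split; lra.
Qed.

(* The filter of lists containing a given finite list turns near_covering into
   the finite subcover property, which the library only states for pointed
   topological spaces. *)
Lemma compact_finite_subcover (K A : set (R * R)) (r : R * R -> R) :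
  compact K -> K `<=` A -> (forall x, A x -> 0 < r x) ->
  exists2 s : seq (R * R), (forall x, x \in s -> A x) &
    forall y, K y -> exists2 x, x \in s & ball x (r x) y.
Proof.
move=> /compact_near_coveringP cK KA r0.
pose F : set_system (seq (R * R)) := [set B | exists2 s0 : seq (R * R),
  (forall x, x \in s0 -> A x) &
  forall s : seq (R * R), {subset s0 <= s} -> (forall x, x \in s -> A x) -> B s].
have FF : Filter F.
  split.
  - by exists [::].
  - move=> B C [s sA sB] [t tA tC]; exists (s ++ t).
      by move=> x; rewrite mem_cat => /orP[/sA|/tA].
    move=> u stu uA; split; [apply: sB|apply: tC] => // x xs; apply: stu;
      by rewrite mem_cat xs ?orbT.
  - move=> B C BC [s sA sB]; exists s => // u su uA; apply: BC; exact: sB.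
have [|s sA sB] := cK _ F (fun s y => exists2 x, x \in s & ball x (r x) y) FF.
  move=> x Kx; have Ax := KA _ Kx.
  exists (ball x (r x), [set s : seq (R * R) | x \in s]).
    split; first exact: (nbhsx_ballx x (r x) (r0 x Ax)).
    exists [:: x]; first by move=> y; rewrite inE => /eqP ->.
    by move=> u su _; apply: su; rewrite inE.
  by move=> [y u] [/= xy xu]; exists x.
exists s => // y Ky; exact: (sB s _ sA y Ky).
Qed.

(** A partition of unity built one ball at a time. With a plateau function [chi] equal to 1 on the
    half ball, [chi * phi] is supported in the ball and the remainder vanishes on the half ball, so
    the list of half balls covering the support shrinks. *)
Lemma test_localization (Omega : set (R * R)) (r : R * R -> R)
    (L : (R * R -> R) -> R) :
  (forall x, Omega x -> 0 < r x) ->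
  (forall phi psi, test_function Omega phi -> test_function Omega psi ->
     L (fun x => phi x + psi x) = L phi + L psi) ->
  L (cst 0) = 0 ->
  (forall x phi, Omega x -> test_function Omega phi -> test_function (ball x (r x)) phi -> L phi = 0) ->
  forall phi, test_function Omega phi -> L phi = 0.
Proof.
move=> r0 LD L0 Lloc phi tphi.
have H (s : seq (R * R)) : (forall x, x \in s -> Omega x) -> forall phi,
    test_function Omega phi ->
    (forall y, (forall x, x \in s -> ~ ball x (r x / 2) y) -> phi y = 0) -> L phi = 0.
  elim: s => [|x s IH] sO psi tpsi psi0.
    by rewrite (_ : psi = cst 0)//; apply/funext => y; apply: psi0.
  have Ox : Omega x by apply: sO; exact: mem_head.
  have [chi [tchi chi1]] := plateau x (r0 x Ox).
  have sc := test_smooth tchi; have sp := test_smooth tpsi.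
  have s1c : smooth (fun y => 1 + (-1) * chi y).
    by apply: smoothD; [exact: smooth_cst|exact: smoothZ].
  have t1 : test_function Omega (fun y => chi y * psi y) by exact: test_M.
  have t2 : test_function Omega (fun y => (1 + (-1) * chi y) * psi y) by exact: test_M.
  rewrite (_ : psi = fun y => chi y * psi y + (1 + (-1) * chi y) * psi y); last first.
    by apply/funext => y; ring.
  rewrite LD// (Lloc x)//; last first.
    have := test_M sp tchi; congr test_function.
    by apply/funext => y; rewrite mulrC.
  rewrite add0r; apply: IH => //.
    by move=> y ys; apply: sO; rewrite inE ys orbT.
  move=> y ys; have [xy|xy] := pselect (ball x (r x / 2) y).
    by rewrite chi1// mulr1 subrr mul0r.
  by rewrite psi0 ?mulr0// => z; rewrite inE => /orP[/eqP ->//|]; exact: ys.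
have [sp [K [cK KO phi0]]] := tphi.
have [|s sO KD] := @compact_finite_subcover K Omega (fun x => r x / 2) cK KO.
  by move=> x Ox; rewrite divr_gt0// r0.
apply: (H s) => // y yD; apply: phi0 => Ky; have [x xs xy] := KD y Ky.
exact: (yD x).
Qed.

End Localization.

(** * Weak derivatives on open sets *)

Section WeakDerivatives.
Context {R : realType}.
Local Notation mR2 := (measurableTypeR R * measurableTypeR R)%type.
Implicit Types (u v f phi : R * R -> R) (A B O : set (R * R)).

(** Wide enough to contain the polynomials on the whole plane, which are to be compared with the
    bounded local potentials. *)
Definition lbmeas u : Prop :=
  meas2 u /\ forall r, exists M, forall x, `|x| <= r -> `|u x| <= M.

Lemma bmeas_lbmeas u : bmeas u -> lbmeas u.
Proof. by move=> [mu_ [M uM]]; split=> // r; exists M. Qed.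

Lemma bcs2_bmeas u : bcs2 u -> bmeas u.
Proof. by move=> [mu_ [M [uM _]]]; split=> //; exists M. Qed.

Lemma smooth_lbmeas u : smooth u -> lbmeas u.
Proof.
move=> /smooth_continuous cu; split; first exact: continuous_meas2.
exact: continuous_lbounded2.
Qed.

Lemma lbmeas_lin a u v : lbmeas u -> lbmeas v -> lbmeas (fun x : R * R => u x + a * v x).
Proof.
move=> [mu_ bu] [mv bv]; split.
  by apply: measurable_funD => //; apply: measurable_funM => //; exact: measurable_cst.
move=> r; have [M uM] := bu r; have [N vN] := bv r; exists (M + `|a| * N) => x xr.
by rewrite (le_trans (ler_normD _ _))// lerD ?uM// normrM ler_wpM2l// vN.
Qed.

Lemma lbmeasM u v : lbmeas u -> bcs2 v -> bcs2 (fun x : R * R => u x * v x).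
Proof. by move=> [mu_ bu]; exact: bcs2M. Qed.

Lemma box_bounded (a b c d : R) : exists M, forall x, box a b c d x -> `|x| <= M.
Proof.
exists (`|a| + `|b| + `|c| + `|d|) => x [xa xb xc xd].
have := ler_norm a; have := ler_norm b; have := ler_norm c; have := ler_norm d.
have := ler_norm (- a); have := ler_norm (- b); have := ler_norm (- c); have := ler_norm (- d).
rewrite !normrN norm2E ge_max !ler_norml => *; apply/andP; split; apply/andP; split; lra.
Qed.

Lemma lbmeas_integrable_box (a b c d : R) u : lbmeas u ->
  leb2.-integrable (box a b c d) (EFin \o u).
Proof.
move=> [mu_ bu]; have [M BM] := box_bounded a b c d; have [N uN] := bu M.
apply: (@measurable_bounded_integrable _ mR2 R leb2 u (box a b c d)).
- exact: measurable_box.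
- exact: leb2_box_lty.
- exact: measurable_funTS.
- by exists N; split; [exact: num_real|move=> P NP x /BM/uN/le_trans; apply; exact: ltW].
Qed.

Lemma Rintegral_support A B u : A `<=` B -> (forall x, ~ A x -> u x = 0) ->
  \int[leb2]_(x in B) u x = \int[leb2]_(x in A) u x.
Proof.
move=> AB u0; rewrite !I2_setE// => x nB; apply: u0 => /AB; exact: nB.
Qed.

Lemma open_ball_sub O x : open O -> O x -> exists2 r : R, 0 < r & ball x r `<=` O.
Proof.
by move=> oO Ox; have /nbhs_ballP[r /= r0 rO] := open_nbhs_nbhs (conj oO Ox); exists r.
Qed.

(** Balls of the maximum norm are squares, so their intersection is a single box and one constant
    serves all of it. *)
Lemma ball2_const (x y : R * R) r s v : ball x r `&` ball y s !=set0 -> lbmeas v ->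
  (forall phi, test_function (ball x r) phi -> test_function (ball y s) phi ->
    I2 (fun p => v p * 'D_e1 phi p) = 0) ->
  (forall phi, test_function (ball x r) phi -> test_function (ball y s) phi ->
    I2 (fun p => v p * 'D_e2 phi p) = 0) ->
  exists m, {ae leb2, forall z, ball x r z -> ball y s z -> v z = m}.
Proof.
move=> [z0]; rewrite !ball_box => Bz bv v1 v2; have := boxI.
move: v1 v2 Bz; set a := _ - r; set b := _ + r; set c := _ - r; set d := _ + r.
set a' := _ - s; set b' := _ + s; set c' := _ - s; set d' := _ + s => v1 v2 Bz bI.
move: Bz; rewrite bI => Bz.
have sub : box (Num.max a a') (Num.min b b') (Num.max c c') (Num.min d d') `<=`
   box a b c d `&` box a' b' c' d' by rewrite bI.
have [||||| m H] := @zero_gradient_const _ (Num.max a a') (Num.min b b') (Num.max c c') (Num.min d d') v.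
- by case: Bz => h1 h2 _ _; exact: lt_trans h1 h2.
- by case: Bz => _ _ h1 h2; exact: lt_trans h1 h2.
- exact: lbmeas_integrable_box.
- move=> phi tp; rewrite I2_setE ?v1//.
  + by apply: test_sub tp => w /sub[].
  + by apply: test_sub tp => w /sub[].
  + by move=> w nB; rewrite (test_out (test_D e1_in tp))// mulr0.
- move=> phi tp; rewrite I2_setE ?v2//.
  + by apply: test_sub tp => w /sub[].
  + by apply: test_sub tp => w /sub[].
  + by move=> w nB; rewrite (test_out (test_D e2_in tp))// mulr0.
- exists m; apply: (ae_mono H) => w Hw wx wy; apply: Hw; rewrite -bI; by split.
Qed.

(** A test function of integral 1 supported in [O] would vanish almost everywhere. *)
Lemma open_not_negligible O x : open O -> O x -> {ae leb2, forall y, ~ O y} -> False.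
Proof.
move=> oO Ox O0; have [r r0 rO] := open_ball_sub oO Ox.
have [|f tf If] := @exists_unit_test1 _ (x.1 - r) (x.1 + r); first by lra.
have [|g tg Ig] := @exists_unit_test1 _ (x.2 - r) (x.2 + r); first by lra.
have bf := test1_bcs tf; have bg := test1_bcs tg.
have := I2_tens bf bg; rewrite If Ig mulr1.
have b0 : bcs2 (fun p => 0 * tens f g p) by apply: bcs2Z; exact: bcs2_tens.
rewrite (ae_I2 (bcs2_tens bf bg) b0); last first.
  apply: (ae_mono O0) => y nO; rewrite mul0r; apply: (test_out (test_tens tf tg)).
  by rewrite -ball_box => /rO.
by rewrite I2Z ?mul0r; [move=> /esym/eqP; rewrite oner_eq0|exact: bcs2_tens].
Qed.

Lemma ae_eq_cst_open O x (m n : R) : open O -> O x ->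
  {ae leb2, forall y, O y -> m = n} -> m = n.
Proof.
move=> oO Ox H; apply: contrapT => mn; apply: (open_not_negligible oO Ox).
by apply: (ae_mono H) => y Hy /Hy.
Qed.

Lemma fundamental_open O u : open O -> leb2.-integrable O (EFin \o u) ->
  (forall phi, test_function O phi -> \int[leb2]_(x in O) (u x * phi x) = 0) ->
  {ae leb2, forall x, O x -> u x = 0}.
Proof.
move=> oO iu u0; apply: ae_local => p Op; have [r r0 rO] := open_ball_sub oO Op.
exists r => //.
suff H : {ae leb2, forall x, ball p r x -> u x = 0} by apply: (ae_mono H) => x Hx xp _; exact: Hx.
rewrite ball_box in rO *; apply: fundamental.
  by apply: integrableS iu => //; [exact: open_measurable2|exact: measurable_box].
move=> f g tf tg; have tt := test_tens tf tg.
rewrite -(u0 _ (test_sub rO tt)); apply/esym/Rintegral_support => // x nB.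
by rewrite (test_out tt)// mulr0.
Qed.

Lemma continuous_ae_eq0 O u : open O -> continuous u ->
  {ae leb2, forall x, O x -> u x = 0} -> forall x, O x -> u x = 0.
Proof.
move=> oO cu u0 x Ox; apply: contrapT => /eqP ux.
pose O' := O `&` (u @^-1` [set~ 0]).
have oO' : open O'.
  by apply: openI => //; apply: open_comp; [move=> y _; exact: cu|exact/closed_openC/closed_eq].
apply: (@open_not_negligible O' x) => //; first by split=> //; exact/eqP.
by apply: (ae_mono u0) => y uy [Oy]; apply; exact: uy.
Qed.

End WeakDerivatives.

(** * Local potentials that agree on overlaps *)

Section GlobalPotential.
Context {R : realType}.

Lemma ball_convex (x y z : R * R) r : ball x r y -> ball x r z -> segment y z `<=` ball x r.
Proof.
rewrite ball_box => -[y1 y2 y3 y4] [z1 z2 z3 z4] _ [t [t0 t1 ->]].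
have conv (a b : R) : 0 < a -> 0 < b -> 0 < (1 - t) * a + t * b.
  move=> a0 b0; have [t12|t12] := leP t 2^-1.
    by apply: ltr_pwDl; [rewrite mulr_gt0//|rewrite mulr_ge0// ltW]; lra.
  by apply: ltr_wpDl; [rewrite mulr_ge0//; [lra|exact: ltW]|rewrite mulr_gt0//; lra].
split; rewrite /= /GRing.scale /=; rewrite -subr_gt0.
- by have := conv (y.1 - (x.1 - r)) (z.1 - (x.1 - r)); nra.
- by have := conv (x.1 + r - y.1) (x.1 + r - z.1); nra.
- by have := conv (y.2 - (x.2 - r)) (z.2 - (x.2 - r)); nra.
- by have := conv (x.2 + r - y.2) (x.2 + r - z.2); nra.
Qed.

Variables (Omega : set (R * R)) (w1 w2 : R * R -> R).
Hypothesis oO : open Omega.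
Hypothesis scO : simply_connected Omega.
Hypothesis bw1 : bmeas w1.
Hypothesis bw2 : bmeas w2.
Hypothesis div0 : forall phi, test_function Omega phi ->
  I2 (fun p => w1 p * 'D_e1 phi p + w2 p * 'D_e2 phi p) = 0.

(** The weak form of Curl u = (w1, w2): the derivative of [u] along [e2] is [w1], the one along [e1]
    is [- w2]. *)
Definition potential (A : set (R * R)) (u : R * R -> R) : Prop :=
  (forall phi, test_function A phi ->
     I2 (fun p => u p * 'D_e2 phi p) = - I2 (fun p => w1 p * phi p)) /\
  (forall phi, test_function A phi ->
     I2 (fun p => u p * 'D_e1 phi p) = I2 (fun p => w2 p * phi p)).

Lemma potential_sub (A B : set (R * R)) u : A `<=` B -> potential B u -> potential A u.
Proof. by move=> AB [u1 u2]; split=> phi /(test_sub AB) tp; [exact: u1|exact: u2]. Qed.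

Lemma potential_diff (x y : R * R) r s u v : ball x r `&` ball y s !=set0 ->
  lbmeas u -> lbmeas v -> potential (ball x r) u -> potential (ball y s) v ->
  exists m, {ae leb2, forall z, ball x r z -> ball y s z -> u z + -1 * v z = m}.
Proof.
move=> ne bu bv [u2 u1] [v2 v1]; apply: ball2_const => //; first exact: lbmeas_lin.
- move=> phi tx ty; have bp := test_D1_bcs tx.
  rewrite (_ : (fun p => _) = fun p => u p * 'D_e1 phi p + -1 * (v p * 'D_e1 phi p)); last first.
    by apply/funext => p; ring.
  rewrite I2D; [|exact: lbmeasM|by apply: bcs2Z; exact: lbmeasM].
  by rewrite I2Z ?u1 ?v1 ?mulN1r ?subrr//; exact: lbmeasM.
- move=> phi tx ty; have bp := test_D2_bcs tx.
  rewrite (_ : (fun p => _) = fun p => u p * 'D_e2 phi p + -1 * (v p * 'D_e2 phi p)); last first.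
    by apply/funext => p; ring.
  rewrite I2D; [|exact: lbmeasM|by apply: bcs2Z; exact: lbmeasM].
  by rewrite I2Z ?u2 ?v2 ?mulN1r ?subrr//; exact: lbmeasM.
Qed.

(** On overlapping balls [beta y - beta x] is a constant [h x y]. For fixed [x] this is a function
    of the centre [y], and as such it is fed into the monodromy lemma; the resulting [gamma]
    satisfies [h x y = gamma y - gamma x], so that subtracting [gamma x] from [beta x] removes the
    discrepancies. *)
Lemma coherent_potentials : exists (r : R * R -> R) (b : R * R -> R * R -> R),
  (forall x, Omega x -> [/\ 0 < r x, ball x (r x) `<=` Omega, bmeas (b x) &
     potential (ball x (r x)) (b x)]) /\
  (forall x y, Omega x -> Omega y ->
     {ae leb2, forall z, ball x (r x) z -> ball y (r y) z -> b x z = b y z}).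
Proof.
have H x : exists rb : R * (R * R -> R), Omega x -> [/\ 0 < rb.1, ball x rb.1 `<=` Omega,
    bmeas rb.2 & potential (ball x rb.1) rb.2].
  have [Ox|nO] := pselect (Omega x); last by exists (0, cst 0).
  have [r r0 rO] := open_ball_sub oO Ox.
  have [|||beta [bb b2 b1]] := @local_potential _ (x.1 - r) (x.1 + r) (x.2 - r) (x.2 + r) w1 w2 _ _ bw1 bw2.
  - lra.
  - lra.
  - by move=> phi tp; apply: div0; apply: test_sub tp; rewrite -ball_box.
  - by exists (r, beta) => _; split => //; split; rewrite ball_box.
pose r x := (projT1 (cid (H x))).1; pose beta x := (projT1 (cid (H x))).2.
have HH x : Omega x -> [/\ 0 < r x, ball x (r x) `<=` Omega, bmeas (beta x) &
    potential (ball x (r x)) (beta x)] by exact: (projT2 (cid (H x))).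
clearbody r beta; clear H.
pose U x := ball x (r x).
have oU x : open (U x) by exact: ball_open.
have Uxx x : Omega x -> U x x by move=> /HH[r0 _ _ _]; exact: ballxx.
have J x y : exists m, Omega x -> Omega y -> U x `&` U y !=set0 ->
    {ae leb2, forall z, U x z -> U y z -> beta y z - beta x z = m}.
  have [[Ox [Oy ne]]|no] := pselect (Omega x /\ Omega y /\ U x `&` U y !=set0); last first.
    by exists 0 => Ox Oy ne; exfalso; exact: no.
  have [_ _ bx px] := HH x Ox; have [_ _ by_ py] := HH y Oy.
  have [m Hm] := potential_diff ne (bmeas_lbmeas bx) (bmeas_lbmeas by_) px py.
  exists (- m) => _ _ _; apply: (ae_mono Hm) => z Hz xz yz.
  by rewrite -(Hz xz yz); ring.
have [h Hh] : exists h : R * R -> R * R -> R, forall x y, Omega x -> Omega y ->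
    U x `&` U y !=set0 -> {ae leb2, forall z, U x z -> U y z -> beta y z - beta x z = h x y}.
  by exists (fun x y => projT1 (cid (J x y))) => x y; exact: (projT2 (cid (J x y))).
have [|||| gamma Hg] := @monodromy _ Omega U h scO Uxx.
- by [].
- by move=> x /HH[_ sub _ _].
- by move=> x y z _; exact: ball_convex.
- move=> x x' y z Ox Ox' xy xz x'y x'z.
  have UO w v : Omega w -> U w v -> Omega v by move=> /HH[_ sub _ _] /sub.
  have ne w : U x w -> U x' w -> U x `&` U x' !=set0 by move=> ? ?; exists w.
  (* Three constants are compared on a nonempty open set common to the three balls, where both sides
     equal [beta x' - beta x] almost everywhere. *)
  have near w : U x w -> U x' w -> h x w - h x' w = h x x'.
    move=> xw x'w; have Ow := UO _ _ Ox xw.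
    apply: (@ae_eq_cst_open _ (U x `&` U x' `&` U w) w).
    + by apply: openI => //; exact: openI.
    + by split=> //; exact: Uxx.
    + have A1 := Hh x w Ox Ow (ex_intro _ w (conj xw (Uxx w Ow))).
      have A2 := Hh x' w Ox' Ow (ex_intro _ w (conj x'w (Uxx w Ow))).
      have A3 := Hh x x' Ox Ox' (ne w xw x'w).
      apply: (ae_mono (ae_and A1 (ae_and A2 A3))) => v [a1 [a2 a3]] [[xv x'v] wv].
      by rewrite -(a1 xv wv) -(a2 x'v wv) -(a3 xv x'v); ring.
  by have := near y xy x'y; have := near z xz x'z; lra.
have hxx x : Omega x -> h x x = 0.
  move=> Ox; apply: (@ae_eq_cst_open _ (U x) x) => //; first exact: Uxx.
  have A := Hh x x Ox Ox (ex_intro _ x (conj (Uxx x Ox) (Uxx x Ox))).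
  by apply: (ae_mono A) => v Hv xv; rewrite -(Hv xv xv) subrr.
have hg x y : Omega x -> U x y -> h x y = gamma y - gamma x.
  by move=> Ox xy; rewrite (Hg x Ox x y (Uxx x Ox) xy) hxx// subr0.
have lb u (m : R) : bmeas u -> bmeas (fun z : R * R => u z - m).
  by move=> bu; apply: bmeasD => //; exact: bmeas_cst.
exists r, (fun x z => beta x z - gamma x); split.
  move=> x Ox; have [r0 rO bx [p2 p1]] := HH x Ox; split => //; first exact: lb.
  split=> phi tp.
  - rewrite -p2// (_ : (fun p => _) = fun p => beta x p * 'D_e2 phi p + (- gamma x) * 'D_e2 phi p); last first.
      by apply/funext => p; ring.
    have bp := test_D2_bcs tp.
    by rewrite I2D ?I2Z ?(I2_D2_eq0 tp) ?mulr0 ?addr0//; [exact: bmeasM|exact: bcs2Z].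
  - rewrite -p1// (_ : (fun p => _) = fun p => beta x p * 'D_e1 phi p + (- gamma x) * 'D_e1 phi p); last first.
      by apply/funext => p; ring.
    have bp := test_D1_bcs tp.
    by rewrite I2D ?I2Z ?(I2_D1_eq0 tp) ?mulr0 ?addr0//; [exact: bmeasM|exact: bcs2Z].
(* The formula for [h] is available only if one centre lies in the ball of the other. Two balls that
   merely overlap are compared near each common point [p], through the potential centred at [p]. *)
have center x p : Omega x -> U x p ->
    {ae leb2, forall z, U x z -> U p z -> beta x z - gamma x = beta p z - gamma p}.
  move=> Ox xp; have Op : Omega p by have [_ sub _ _] := HH x Ox; exact: sub.
  have A := Hh x p Ox Op (ex_intro _ p (conj xp (Uxx p Op))).
  apply: (ae_mono A) => z Hz xz pz; have := Hz xz pz; rewrite hg// => e.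
  by lra.
move=> x y Ox Oy.
have L : {ae leb2, forall z, (U x `&` U y) z -> beta x z - gamma x = beta y z - gamma y}.
  apply: ae_local => p [xp yp]; have Op : Omega p by have [_ sub _ _] := HH x Ox; exact: sub.
  exists (r p); first by case: (HH p Op).
  apply: (ae_mono (ae_and (center x p Ox xp) (center y p Oy yp))) => z [h1 h2] pz [xz yz].
  by rewrite h1// h2.
by apply: (ae_mono L) => z Hz xz yz; apply: Hz.
Qed.

End GlobalPotential.

(** * The potential is polynomial on each triangle *)

Section PolynomialPotential.
Context {R : realType}.

(** The segment is divided so finely that consecutive points lie in a common ball [ball x (r x)];
    both values then equal [kappa x]. *)
Lemma locally_constant_convex (O : set (R * R)) (kappa : R * R -> R) (r : R * R -> R) :
  (forall p q, O p -> O q -> segment p q `<=` O) -> (forall p, O p -> 0 < r p) ->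
  (forall p q, O p -> O q -> ball p (r p) q -> kappa q = kappa p) ->
  forall p q, O p -> O q -> kappa q = kappa p.
Proof.
move=> cO r0 loc p q Op Oq.
pose H (t : R^o) : R * R := (1 - t) *: p + t *: q.
have HO (t : R^o) : `[0, 1]%classic t -> O (H t).
  by rewrite /= in_itv/= => /andP[t0 t1]; apply: (cO p q) => //; exists t.
have cH : continuous H.
  move=> t; apply: cvgD; last by apply: cvgZr_tmp; exact: cvg_id.
  by apply: cvgZr_tmp; apply: cvgB; [exact: cvg_cst|exact: cvg_id].
have [||||| N HN] := @lebesgue_number _ R^o `[0, 1]%classic H O (fun x => ball x (r x)).
- exact: segment_compact.
- exact: continuous_subspaceT.
- exact: HO.
- by move=> x /r0 ?; exact: ballxx.
- by move=> x _; exact: ball_open.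
have mem i : (i <= N.+1)%N -> `[0, 1]%classic (i%:R / N.+1%:R : R^o).
  by move=> iN; rewrite /= in_itv/= divr_ge0//= ler_pdivrMr// mul1r ler_nat.
have step i : (i <= N.+1)%N -> kappa (H (i%:R / N.+1%:R)) = kappa p.
  elim: i => [_|i IH iN]; first by rewrite mul0r /H subr0 scale1r scale0r addr0.
  rewrite -IH ?(ltnW iN)//.
  have [x Ox Hx] := HN N (leqnn N) _ (mem i (ltnW iN)).
  rewrite (loc x)//; first last.
  - apply: Hx; first exact: mem.
    by rewrite -mulrBl -natr1 opprD addrA subrr add0r mulN1r normrN ger0_norm.
  - by apply: HO; exact: mem.
  rewrite (loc x _ _ (HO _ (mem i (ltnW iN))))//; apply: Hx; first exact: mem i (ltnW iN).
  by rewrite subrr normr0.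
by have := step N.+1 (leqnn _); rewrite divff// /H subrr scale0r add0r scale1r.
Qed.

Variables (Omega : set (R * R)) (w1 w2 : R * R -> R).
Hypothesis bw1 : bmeas w1.
Hypothesis bw2 : bmeas w2.
Hypothesis div0 : forall phi, test_function Omega phi ->
  I2 (fun p => w1 p * 'D_e1 phi p + w2 p * 'D_e2 phi p) = 0.
Variables (r : R * R -> R) (b : R * R -> R * R -> R).
Hypothesis Hb : forall x, Omega x -> [/\ 0 < r x, ball x (r x) `<=` Omega, bmeas (b x) &
  potential w1 w2 (ball x (r x)) (b x)].
Hypothesis bb : forall x y, Omega x -> Omega y ->
  {ae leb2, forall z, ball x (r x) z -> ball y (r y) z -> b x z = b y z}.

(** The field is polynomial on [O], so it has a polynomial potential there. It differs from each
    local potential by a constant, and agreement of the local potentials together with convexity of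
    [O] makes these constants equal. One polynomial thus serves for all balls meeting [O]. *)
Lemma polynomial_potential k ca cb (O : set (R * R)) : open O -> O !=set0 -> O `<=` Omega ->
  (forall p q, O p -> O q -> segment p q `<=` O) ->
  {ae leb2, forall x, O x -> w1 x = poly2 k ca x /\ w2 x = poly2 k cb x} ->
  exists c, forall x, Omega x ->
    {ae leb2, forall y, ball x (r x) y -> O y -> b x y = poly2 k.+1 c y}.
Proof.
move=> oO [x0 Ox0] OO cO wae.
have sm m c : smooth (@poly2 R m c) by rewrite poly2E; exact: smooth_pol.
have w1E phi : test_function O phi -> I2 (fun p => w1 p * phi p) = I2 (fun p => poly2 k ca p * phi p).
  move=> tp; have bp := test_bcs tp; apply: ae_I2; [exact: bmeasM|exact: smooth_bcsM (sm _ _) tp|].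
  apply: (ae_mono wae) => x wx; have [/wx[-> _]//|nO] := pselect (O x).
  by rewrite (test_out tp)// !mulr0.
have w2E phi : test_function O phi -> I2 (fun p => w2 p * phi p) = I2 (fun p => poly2 k cb p * phi p).
  move=> tp; have bp := test_bcs tp; apply: ae_I2; [exact: bmeasM|exact: smooth_bcsM (sm _ _) tp|].
  apply: (ae_mono wae) => x wx; have [/wx[_ ->]//|nO] := pselect (O x).
  by rewrite (test_out tp)// !mulr0.
(* Vanishing of the divergence on one small square is enough, since it determines the
   coefficients. *)
have [s s0 sO] := open_ball_sub oO Ox0.
pose dv x := 'D_e1 (poly2 k ca) x + 'D_e2 (poly2 k cb) x.
have sdv : smooth dv by apply: smoothD; apply: smooth_D; rewrite ?e1_in ?e2_in//; exact: sm.
have dv0 x : ball x0 s x -> dv x = 0.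
  apply: continuous_ae_eq0; [exact: ball_open|exact: smooth_continuous|].
  apply: fundamental_open; first exact: ball_open.
    by rewrite ball_box; apply: lbmeas_integrable_box; exact: smooth_lbmeas.
  move=> phi tp; have tO := test_sub sO tp.
  rewrite I2_setE; last by move=> y nB; rewrite (test_out tp)// mulr0.
  have d1 := smooth_D e1_in (sm k ca); have d2 := smooth_D e2_in (sm k cb).
  rewrite (_ : (fun x => _) = fun x => 'D_e1 (poly2 k ca) x * phi x + 'D_e2 (poly2 k cb) x * phi x); last first.
    by apply/funext => y; rewrite /dv mulrDl.
  rewrite I2D; [|exact: smooth_bcsM tp|exact: smooth_bcsM tp].
  have i1 := ibp1 (sm k ca) tp; have i2 := ibp2 (sm k cb) tp.
  have dO := div0 (test_sub OO tO).
  rewrite I2D in dO; [|exact: bmeasM (test_D1_bcs tp)|exact: bmeasM (test_D2_bcs tp)].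
  rewrite w1E in dO; last by apply: test_D tO; exact: e1_in.
  rewrite w2E in dO; last by apply: test_D tO; exact: e2_in.
  by move: dO; rewrite i1 i2 -opprD => /eqP; rewrite oppr_eq0 => /eqP.
have [|||c [c2 c1]] := @poly2_potential _ k ca cb (x0.1 - s) (x0.1 + s) (x0.2 - s) (x0.2 + s).
- lra.
- lra.
- by move=> x; rewrite -ball_box; exact: dv0.
have bP : lbmeas (poly2 k.+1 c) by apply: smooth_lbmeas.
have pP : potential w1 w2 O (poly2 k.+1 c).
  split=> phi tp; have smc := sm k.+1 c.
    rewrite (ibp2 smc tp) w1E//; congr (- I2 _); apply/funext => x.
    by congr (_ * _); exact: (congr1 (fun f => f x) c2).
  have E : (fun x => 'D_e1 (poly2 k.+1 c) x * phi x) = (fun x => -1 * (poly2 k cb x * phi x)).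
    apply/funext => x; rewrite (congr1 (fun f => f x) c1 : 'D_e1 (poly2 k.+1 c) x = _).
    by rewrite mulN1r mulNr.
  rewrite (ibp1 smc tp) E I2Z; last exact: smooth_bcsM tp.
  by rewrite w2E// mulN1r opprK.
have K p : exists sm : R * R, O p -> [/\ 0 < sm.1, ball p sm.1 `<=` O, ball p sm.1 `<=` ball p (r p) &
    {ae leb2, forall z, ball p sm.1 z -> b p z + -1 * poly2 k.+1 c z = sm.2}].
  have [Op|nO] := pselect (O p); last by exists (0, 0).
  have [rp rO bp pp] := Hb (OO _ Op).
  have [t t0 tO] := @open_ball_sub _ (O `&` ball p (r p)) p
    (openI oO (ball_open p (r p))) (conj Op (ballxx p rp)).
  have [|||||m Hm] := @potential_diff _ w1 w2 p p t t (b p) (poly2 k.+1 c).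
  - by exists p; split; exact: ballxx.
  - exact: bmeas_lbmeas.
  - by [].
  - by apply: potential_sub pp => z /tO[].
  - by apply: potential_sub pP => z /tO[].
  exists (t, m) => _; split => //; [by move=> z /tO[]|by move=> z /tO[]|].
  by apply: (ae_mono Hm) => z Hz pz; exact: Hz.
have [t [kappa HK]] : exists (t kappa : R * R -> R), forall p, O p ->
    [/\ 0 < t p, ball p (t p) `<=` O, ball p (t p) `<=` ball p (r p) &
    {ae leb2, forall z, ball p (t p) z -> b p z + -1 * poly2 k.+1 c z = kappa p}].
  by exists (fun p => (projT1 (cid (K p))).1), (fun p => (projT1 (cid (K p))).2) => p; exact: (projT2 (cid (K p))).
clear K.
(* If [q] lies in the ball around [p], both constants are read off on a neighbourhood of [q], where
   [b p] and [b q] agree almost everywhere. *)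
have kc p q : O p -> O q -> kappa q = kappa p.
  apply: (@locally_constant_convex O kappa t cO); first by move=> x /HK[].
  move=> {}p {}q Op Oq pq; have [tp tpO tpr kp] := HK p Op; have [tq tqO tqr kq] := HK q Oq.
  apply: (@ae_eq_cst_open _ (ball p (t p) `&` ball q (t q)) q).
  - by apply: openI; exact: ball_open.
  - by split=> //; exact: ballxx.
  apply: (ae_mono (ae_and kp (ae_and kq (bb (OO _ Op) (OO _ Oq))))) => z [h1 [h2 h3]] [pz qz].
  by rewrite -(h1 pz) -(h2 qz) h3//; [exact: tpr|exact: tqr].
exists (fun i j => 1 * c i j + (if (i == 0%N) && (j == 0%N) then kappa x0 else 0)) => x Ox.
have -> : poly2 k.+1 (fun i j => 1 * c i j + (if (i == 0%N) && (j == 0%N) then kappa x0 else 0)) =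
    fun y => poly2 k.+1 c y + kappa x0.
  by apply/funext => y; rewrite poly2_lin poly2_cst mul1r.
have L : {ae leb2, forall y, (ball x (r x) `&` O) y -> b x y = poly2 k.+1 c y + kappa x0}.
  apply: ae_local => p [xp Op]; have [tp tpO tpr kp] := HK p Op; exists (t p) => //.
  apply: (ae_mono (ae_and kp (bb Ox (OO _ Op)))) => z [h1 h2] pz [xz Oz].
  rewrite h2//; last exact: tpr.
  by rewrite -(kc x0 p Ox0 Op) -(h1 pz); ring.
by apply: (ae_mono L) => y Hy xy Oy; exact: Hy.
Qed.

End PolynomialPotential.

(** * The glued piecewise polynomial potential *)

Section PiecewisePotential.
Context {R : realType}.

Variables (Omega : set (R * R)) (rad : R) (T : set (set (R * R))).
Hypothesis oO : open Omega.
Hypothesis bO : forall x, Omega x -> `|x| <= rad.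
Hypothesis fT : finite_set T.
Hypothesis tT : forall K, T K -> is_triangle K.
Hypothesis cT : closure Omega = \bigcup_(K in T) K.
Hypothesis regO : interior (closure Omega) `<=` Omega.

Lemma sub_triangulation : Omega `<=` \bigcup_(K in T) K.
Proof. by rewrite -cT; exact: subset_closure. Qed.

(** The open part of a triangle lies in the interior of the closure of [Omega], hence in [Omega]
    itself, where the field and the test functions live. *)
Lemma triangle_core K : T K -> exists O : set (R * R),
  [/\ open O, O !=set0, O `<=` Omega, (forall x y, O x -> O y -> segment x y `<=` O) &
      {ae leb2, forall x, K x <-> O x}].
Proof.
move=> TK; have [_ [ O [oO' nO OK cO KO]]] := triangle_open_part (tT TK).
exists O; split => //.
  move=> x Ox; apply: regO; have : O `<=` closure Omega.
    by move=> y Oy; rewrite cT; exists K => //; exact: OK.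
  by rewrite open_subsetE// => /(_ x Ox).
by apply: (ae_mono KO) => x Hx; split; [|exact: OK].
Qed.

(** The glued polynomial agrees almost everywhere with the local potential on each small ball,
    across edges as well. It inherits the weak identities for test functions supported in such
    balls, and localization extends them to all test functions. *)
Lemma piecewise_potential k (w1 w2 : R * R -> R) : simply_connected Omega ->
  bmeas w1 -> bmeas w2 -> Pk Omega k T w1 -> Pk Omega k T w2 ->
  (forall phi, test_function Omega phi ->
    I2 (fun p => w1 p * 'D_e1 phi p + w2 p * 'D_e2 phi p) = 0) ->
  exists beta, [/\ bcs2 beta, Pk Omega k.+1 T beta & potential w1 w2 Omega beta].
Proof.
move=> scO bw1 bw2 /(Pk_coef fT)[F1 HF1] /(Pk_coef fT)[F2 HF2] div0.
have [r [b [Hb bb]]] := coherent_potentials oO scO bw1 bw2 div0.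
have HK K : exists c, T K -> forall x, Omega x ->
    {ae leb2, forall y, ball x (r x) y -> K y -> b x y = poly2 k.+1 c y}.
  have [TK|nTK] := pselect (T K); last by exists (fun _ _ => 0).
  have [ O [oO' nO OO cO KO]] := triangle_core TK.
  have [|c Hc] := polynomial_potential (k := k) (ca := F1 K) (cb := F2 K) bw1 bw2 div0 Hb bb oO' nO OO cO.
    apply: (ae_mono (ae_and KO (ae_and HF1 HF2))) => x [KOx [H1 H2]] Ox.
    by split; [apply: H1|apply: H2] => //; [exact: OO|exact/KOx|exact: OO|exact/KOx].
  exists c => _ x Ox; apply: (ae_mono (ae_and KO (Hc x Ox))) => y [KOy H] xy Ky.
  by apply: H => //; exact/KOy.
have [c Hc] : exists c : set (R * R) -> nat -> nat -> R, forall K, T K -> forall x, Omega x ->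
    {ae leb2, forall y, ball x (r x) y -> K y -> b x y = poly2 k.+1 (c K) y}.
  by exists (fun K => projT1 (cid (HK K))) => K; exact: (projT2 (cid (HK K))).
have [h [bh h0 hF]] := glue_polys oO bO fT tT sub_triangulation k.+1 c.
have hb x : Omega x -> {ae leb2, forall y, ball x (r x) y -> Omega y ->
    h y = b x y /\ forall K, T K -> K y -> b x y = poly2 k.+1 (c K) y}.
  move=> Ox; have A := piecewise_ae_all fT (fun K TK => Hc K TK x Ox).
  apply: (ae_mono A) => y Hy xy Oy; split; last by move=> K TK Ky; exact: Hy.
  by have [K TK [Ky ->]] := hF y Oy; rewrite (Hy K).
exists h; split => //.
  split; first by apply: measurable_funTS; case: bh.
  move=> K TK; exists (c K).
  suff L : {ae leb2, forall y, Omega y -> K y -> h y = poly2 k.+1 (c K) y} by [].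
  apply: ae_local => x Ox; exists (r x); first by case: (Hb x Ox).
  apply: (ae_mono (hb x Ox)) => y Hy xy Oy Ky.
  by have [hy Hy2] := Hy xy Oy; rewrite hy; exact: Hy2.
have loc x u phi : Omega x -> test_function (ball x (r x)) phi -> bcs2 u ->
    (forall y, ~ ball x (r x) y -> u y = 0) ->
    I2 (fun p => h p * u p) = I2 (fun p => b x p * u p).
  move=> Ox tp bu u0; have [_ rO bx _] := Hb x Ox.
  apply: ae_I2; [exact: bmeasM (bcs2_bmeas bh) bu|exact: bmeasM|].
  apply: (ae_mono (hb x Ox)) => y Hy.
  have [xy|nxy] := pselect (ball x (r x) y); last by rewrite u0// !mulr0.
  by have [->] := Hy xy (rO _ xy).
have bhm := bcs2_bmeas bh.
split=> phi tphi.
- pose L phi := I2 (fun p => h p * 'D_e2 phi p) + I2 (fun p => w1 p * phi p).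
  suff : L phi = 0 by move=> /eqP; rewrite addr_eq0 => /eqP.
  apply: (@test_localization _ Omega r L) => //.
  + by move=> x /Hb[].
  + move=> f g tf tg; rewrite /L; have sf := test_smooth tf; have sg := test_smooth tg.
    have bf := bmeasM bhm (test_D2_bcs tf); have bg := bmeasM bhm (test_D2_bcs tg).
    have bf' := bmeasM bw1 (test_bcs tf); have bg' := bmeasM bw1 (test_bcs tg).
    have E1 : (fun p => h p * 'D_e2 (fun x => f x + g x) p) =
        (fun p => h p * 'D_e2 f p + h p * 'D_e2 g p).
      by apply/funext => p; rewrite (congr1 (fun u => u p) (derive_smoothD e2 sf sg)) mulrDr.
    have E2 : (fun p => w1 p * (f p + g p)) = (fun p => w1 p * f p + w1 p * g p).
      by apply/funext => p; rewrite mulrDr.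
    by rewrite E1 E2 !I2D// addrACA.
  + rewrite /L (_ : (fun p => _) = cst 0); last first.
      by apply/funext => p; rewrite derive_cst mulr0.
    rewrite [X in _ + I2 X](_ : _ = cst 0); last by apply/funext => p; rewrite mulr0.
    by rewrite /I2 /Rintegral integral0 addr0.
  + move=> x f Ox tO tb; have [_ _ _ [p2 _]] := Hb x Ox.
    rewrite /L (loc x _ f)// ?p2// ?addNr//; first exact: test_D2_bcs tb.
    by move=> y nB; exact: (test_out (test_D e2_in tb)).
- pose L phi := I2 (fun p => h p * 'D_e1 phi p) + -1 * I2 (fun p => w2 p * phi p).
  suff : L phi = 0 by move=> /eqP; rewrite addr_eq0 mulN1r opprK => /eqP.
  apply: (@test_localization _ Omega r L) => //.
  + by move=> x /Hb[].
  + move=> f g tf tg; rewrite /L; have sf := test_smooth tf; have sg := test_smooth tg.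
    have bf := bmeasM bhm (test_D1_bcs tf); have bg := bmeasM bhm (test_D1_bcs tg).
    have bf' := bmeasM bw2 (test_bcs tf); have bg' := bmeasM bw2 (test_bcs tg).
    have E1 : (fun p => h p * 'D_e1 (fun x => f x + g x) p) =
        (fun p => h p * 'D_e1 f p + h p * 'D_e1 g p).
      by apply/funext => p; rewrite (congr1 (fun u => u p) (derive_smoothD e1 sf sg)) mulrDr.
    have E2 : (fun p => w2 p * (f p + g p)) = (fun p => w2 p * f p + w2 p * g p).
      by apply/funext => p; rewrite mulrDr.
    by rewrite E1 E2 !I2D// mulrDr addrACA.
  + rewrite /L (_ : (fun p => _) = cst 0); last first.
      by apply/funext => p; rewrite derive_cst mulr0.
    rewrite [X in _ * I2 X](_ : _ = cst 0); last by apply/funext => p; rewrite mulr0.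
    by rewrite /I2 /Rintegral integral0 mulr0 addr0.
  + move=> x f Ox tO tb; have [_ _ _ [_ p1]] := Hb x Ox.
    rewrite /L (loc x _ f)// ?p1// ?mulN1r ?subrr//; first exact: test_D1_bcs tb.
    by move=> y nB; exact: (test_out (test_D e1_in tb)).
Qed.

End PiecewisePotential.

(** * The discrete Helmholtz decomposition *)

Section WeakGradients.
Context {R : realType}.
Local Notation mR2 := (measurableTypeR R * measurableTypeR R)%type.
Implicit Types (u v f g phi beta : R * R -> R).

Lemma ibp (Omega : set (R * R)) d phi g : d \in [:: e1; e2] -> smooth g -> test_function Omega phi ->
  I2 (fun x => g x * 'D_d phi x) = - I2 (fun x => 'D_d g x * phi x).
Proof.
by rewrite !inE => /orP[]/eqP-> sg tp; [exact: (ibp1 sg tp)|exact: (ibp2 sg tp)].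
Qed.

Lemma smooth_eq_tests (h1 h2 : R * R -> R) : smooth h1 -> smooth h2 ->
  (forall (a b c d : R) (f g : R -> R), test1 a b f -> test1 c d g ->
     I2 (fun x => h1 x * tens f g x) = I2 (fun x => h2 x * tens f g x)) -> h1 = h2.
Proof.
move=> s1 s2 H; apply/funext => x.
pose u x := h1 x + -1 * h2 x.
have su : smooth u by exact: (smoothD s1 (smoothZ (-1) s2)).
suff : u x = 0 by rewrite /u mulN1r => /eqP; rewrite subr_eq0 => /eqP.
apply: (@continuous_ae_eq0 _ (ball x 1)) (ballxx x ltr01) => //; first exact: ball_open.
  exact: smooth_continuous.
rewrite ball_box; apply: fundamental.
  by apply: lbmeas_integrable_box; exact: smooth_lbmeas.
move=> f g tf tg; have tt := test_tens tf tg.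
rewrite I2_setE; last by move=> y nB; rewrite (test_out tt)// mulr0.
rewrite (_ : (fun y => _) = (fun y => h1 y * tens f g y + -1 * (h2 y * tens f g y))); last first.
  by apply/funext => y; rewrite /u; ring.
have b1 := smooth_bcsM s1 tt; have b2 := smooth_bcsM s2 tt.
rewrite I2D//; last exact: bcs2Z.
by rewrite I2Z// (H _ _ _ _ f g tf tg) mulN1r subrr.
Qed.

(** Two integrations by parts, whose signs cancel; note that the order of the derivatives is
    reversed on [psi]. *)
Lemma second_derivative_parts d d' phi : d \in [:: e1; e2] -> d' \in [:: e1; e2] ->
  smooth phi -> exists h, [/\ h = 'D_d ('D_d' phi), smooth h &
    forall (A : set (R * R)) psi, test_function A psi ->
      I2 (fun x => h x * psi x) = I2 (fun x => phi x * 'D_d' ('D_d psi) x)].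
Proof.
move=> dd dd' sp; have s1 := smooth_D dd' sp; have s2 := smooth_D dd s1.
exists ('D_d ('D_d' phi)); split=> // A psi tp.
have F1 := ibp dd s1 tp; have F2 := ibp dd' sp (test_D dd tp).
by apply: oppr_inj; exact: (etrans (esym F1) (etrans (esym (opprK _)) (congr1 -%R (esym F2)))).
Qed.

(* Both mixed derivatives have the same distribution, since tensor products
   satisfy the identity by inspection. *)
Lemma schwarz phi : smooth phi -> 'D_e1 ('D_e2 phi) = 'D_e2 ('D_e1 phi).
Proof.
move=> sp.
have [h12 [e12 s12 F12]] := second_derivative_parts e1_in e2_in sp.
have [h21 [e21 s21 F21]] := second_derivative_parts e2_in e1_in sp.
apply: (etrans (esym e12)); apply: etrans e21.
apply: smooth_eq_tests => // a b c d f g tf tg.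
have tt := test_tens tf tg; apply: (etrans (F12 _ _ tt)); apply: (etrans _ (esym (F21 _ _ tt))).
have [df tf'] := test1_derive tf; have [dg tg'] := test1_derive tg.
have E1 : 'D_e1 (tens f g) = tens (derive1 f) g.
  by apply: derive_tens1 => t; apply: ex_derive.
have E2 : 'D_e2 (tens f g) = tens f (derive1 g).
  by apply: derive_tens2 => t; apply: ex_derive.
have E21 : 'D_e2 (tens (derive1 f) g) = tens (derive1 f) (derive1 g).
  by apply: derive_tens2 => t; apply: ex_derive.
have E12 : 'D_e1 (tens f (derive1 g)) = tens (derive1 f) (derive1 g).
  by apply: derive_tens1 => t; apply: ex_derive.
have M1 := etrans (congr1 (fun h : R * R -> R => 'D_e2 h) E1) E21.
have M2 := etrans (congr1 (fun h : R * R -> R => 'D_e1 h) E2) E12.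
have G h k : h = k -> I2 (fun x : R * R => phi x * h x) = I2 (fun x => phi x * k x) by move=> ->.
exact: (etrans (G _ _ M1) (esym (G _ _ M2))).
Qed.

Variables (Omega : set (R * R)) (rad : R).
Hypothesis oO : open Omega.
Hypothesis bO : forall x, Omega x -> `|x| <= rad.

Let mO : measurable (Omega : set mR2). Proof. exact: open_measurable2. Qed.

Lemma indic_bcs2 : bcs2 (\1_Omega : R * R -> R).
Proof.
split; first exact: measurable_indic.
exists (Num.max 1 rad); split=> x; rewrite indicE.
  by case: (x \in Omega); rewrite ?normr1 ?normr0 le_max ?lexx ?ler01.
rewrite gt_max => /andP[_]; case: (boolP (x \in Omega)) => //.
by rewrite inE => /bO; rewrite leNgt => /negbTE ->.
Qed.

(** [Omega] is bounded, so its indicator is square-integrable as well. *)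
Lemma L2_integrable f : L2 Omega f -> leb2.-integrable Omega (EFin \o f).
Proof.
move=> Lf; have := L2_integrableM mO Lf (bcs2_L2 mO indic_bcs2).
apply: eq_integrable => // x; rewrite inE => Ox.
by rewrite /= indicE mem_set// mulr1.
Qed.

Lemma test_L2 phi : test_function Omega phi -> L2 Omega phi.
Proof. by move=> /test_bcs; exact: bcs2_L2. Qed.

Lemma weak_partial_unique d v f g : weak_partial Omega d v f -> weak_partial Omega d v g ->
  {ae leb2, forall x, Omega x -> f x = g x}.
Proof.
move=> [Lf wf] [Lg wg].
have Lfg : L2 Omega (fun x => -1 * g x + f x) by exact: L2_lin.
have H : {ae leb2, forall x, Omega x -> -1 * g x + f x = 0}.
  apply: fundamental_open => //; first exact: L2_integrable.
  move=> phi tp; have Lp := test_L2 tp.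
  have If := L2_integrableM mO Lf Lp; have Ig := L2_integrableM mO Lg Lp.
  transitivity (\int[leb2]_(x in Omega) (f x * phi x) - \int[leb2]_(x in Omega) (g x * phi x)).
    by rewrite -RintegralB//; apply: eq_Rintegral => x _; ring.
  by apply/eqP; rewrite subr_eq0; apply/eqP/oppr_inj; rewrite -wf// wg.
by apply: (ae_mono H) => x Hx Ox; have := Hx Ox; lra.
Qed.

Lemma weak_gradient_unique v (p q : R * R -> R * R) : weak_gradient Omega v p -> weak_gradient Omega v q ->
  {ae leb2, forall x, Omega x -> p x = q x}.
Proof.
move=> [p1 p2] [q1 q2].
apply: (ae_mono (ae_and (weak_partial_unique p1 q1) (weak_partial_unique p2 q2))) => x [h1 h2] Ox.
by rewrite [p x]surjective_pairing [q x]surjective_pairing h1// h2.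
Qed.

Lemma weak_gradient_L2v v p : weak_gradient Omega v p -> L2v Omega p.
Proof. by move=> [[? _] [? _]]; split. Qed.

Lemma test_weak_partial d phi : d \in [:: e1; e2] -> test_function Omega phi ->
  weak_partial Omega d phi ('D_d phi).
Proof.
move=> de tp; split; first by apply: test_L2; exact: test_D.
move=> psi tq; rewrite !I2_setE.
- exact: ibp (test_smooth tp) tq.
- by move=> x nO; rewrite (test_out tq)// mulr0.
- by move=> x nO; rewrite (test_out (test_D de tq))// mulr0.
Qed.

Definition grad phi (x : R * R) : R * R := ('D_e1 phi x, 'D_e2 phi x).

Lemma grad_L2v phi : test_function Omega phi -> L2v Omega (grad phi).
Proof.
by move=> tp; split; apply: test_L2; [exact: (test_D e1_in)|exact: (test_D e2_in)].
Qed.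

Lemma grad_test_H10 phi : test_function Omega phi -> grad_H10 Omega (grad phi).
Proof.
move=> tp; have w : weak_gradient Omega phi (grad phi).
  by split; apply: test_weak_partial => //; [exact: e1_in|exact: e2_in].
have z u : (fun _ : nat => \int[leb2]_(x in Omega) ((u x - u x) ^+ 2)) @ \oo --> (0 : R).
  rewrite (_ : (fun _ => _) = cst 0); first exact: cvg_cst.
  apply/funext => n; transitivity (\int[leb2]_(x in Omega) (0 : R)).
    by apply: eq_Rintegral => x _; rewrite subrr expr0n.
  by rewrite Rintegral_cst// mul0r.
exists phi => //; split; first exact: test_L2.
exists (grad phi); split=> //; exists (fun=> phi); split=> //; exact: z.
Qed.

Lemma young (t a b : R) : 0 < t -> `|a * b| <= t^-1 * a ^+ 2 + t * b ^+ 2.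
Proof.
move=> t0; rewrite -(ler_pM2l t0) mulrDr mulrA mulfV ?gt_eqF// mul1r.
have -> : t * (t * b ^+ 2) = (t * b) ^+ 2 by ring.
have -> : t * `|a * b| = `|a * (t * b)| by rewrite !normrM (gtr0_norm t0); ring.
exact: L2_sqr_bound.
Qed.

Lemma inner_young t f g : 0 < t -> L2 Omega f -> L2 Omega g ->
  `|\int[leb2]_(x in Omega) (f x * g x)| <=
    t^-1 * \int[leb2]_(x in Omega) (f x ^+ 2) + t * \int[leb2]_(x in Omega) (g x ^+ 2).
Proof.
move=> t0 Lf Lg; have Ifg := L2_integrableM mO Lf Lg.
have [_ If] := Lf; have [_ Ig] := Lg.
have If' := integrable_mull t^-1 mO If; have Ig' := integrable_mull t mO Ig.
rewrite -!RintegralZl// -RintegralD//.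
apply: le_trans (le_normr_Rintegral _ _) _ => //.
apply: le_Rintegral => //.
- exact: (integrable_norm Ifg).
- exact: (integrableD mO If' Ig').
- by move=> x _; exact: young.
Qed.

Lemma small_eq0 (c A : R) : (forall t : R, 0 < t -> `|c| <= t * A) -> c = 0.
Proof.
move=> H; apply/eqP; rewrite -normr_le0; apply/ler_addgt0Pr => e e0; rewrite add0r.
have A1 : 0 < `|A| + 1 by rewrite ltr_wpDl.
apply: le_trans (H (e / (`|A| + 1)) _) _; first by rewrite divr_gt0.
rewrite mulrAC ler_pdivrMr// ler_wpM2l ?ltW//.
by rewrite (le_lt_trans (ler_norm A))// ltrDl.
Qed.

(** The partial derivatives of [phi] are themselves test functions, so they may be inserted into the
    definition of the weak derivatives of [beta]; the two mixed derivatives then cancel. *)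
Lemma test_grad_curl beta G phi : weak_Curl Omega beta G -> test_function Omega phi ->
  L2v_inner Omega (grad phi) G = 0.
Proof.
move=> [[LG1 w2] [LG2 w1]] tp.
have t1 := test_D e1_in tp; have t2 := test_D e2_in tp.
have i1 := L2_integrableM mO (test_L2 t1) LG1; have i2 := L2_integrableM mO (test_L2 t2) LG2.
transitivity (\int[leb2]_(x in Omega) ((G x).1 * 'D_e1 phi x) -
    \int[leb2]_(x in Omega) (- (G x).2 * 'D_e2 phi x)).
  rewrite -RintegralB//.
  - by apply: eq_Rintegral => x _; rewrite /dot /grad /=; ring.
  - by apply: eq_integrable i1 => // x _ /=; rewrite mulrC.
  - by apply: eq_integrable i2 => // x _ /=; rewrite mulrC.
apply/eqP; rewrite subr_eq0; apply/eqP/oppr_inj.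
apply: (etrans (esym (w2 _ t1))); apply: (etrans _ (w1 _ t2)).
have E (h k : R * R -> R) : h = k -> \int[leb2]_(x in Omega) (beta x * h x) =
    \int[leb2]_(x in Omega) (beta x * k x) by move=> ->.
exact: (E _ _ (esym (schwarz (test_smooth tp)))).
Qed.

(* Young's inequality with parameter t replaces the Cauchy-Schwarz inequality in
   the passage to the limit. *)
Lemma grad_H10_curl (g : R * R -> R * R) beta G : grad_H10 Omega g -> weak_Curl Omega beta G -> L2v Omega G ->
  L2v_inner Omega g G = 0.
Proof.
move=> [v [Lv [g' [wg' [phi [tp _ c1 c2]]]]] wg] wG LG.
have Lg' := weak_gradient_L2v wg'.
(* [H10] supplies its own weak gradient [g'], the limit of the approximating gradients; it equals
   [g] almost everywhere. *)
rewrite (L2v_inner_ae mO (weak_gradient_L2v wg) Lg' LG (weak_gradient_unique wg wg')).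
have [Lg1 Lg2] := Lg'; have [LG1 LG2] := LG.
apply: (@small_eq0 _ (\int[leb2]_(x in Omega) ((G x).1 ^+ 2) + \int[leb2]_(x in Omega) ((G x).2 ^+ 2))) => t t0.
pose a1 n := \int[leb2]_(x in Omega) (('D_e1 (phi n) x - (g' x).1) ^+ 2).
pose a2 n := \int[leb2]_(x in Omega) (('D_e2 (phi n) x - (g' x).2) ^+ 2).
set C := _ + _.
have B n : `|L2v_inner Omega g' G| <= t^-1 * (a1 n + a2 n) + t * C.
  have Lp := grad_L2v (tp n); have [Lp1 Lp2] := Lp.
  have Ld1 : L2 Omega (fun x => 'D_e1 (phi n) x - (g' x).1).
    by have := L2_lin mO (-1) Lg1 Lp1; congr L2; apply/funext => x; rewrite /grad/=; ring.
  have Ld2 : L2 Omega (fun x => 'D_e2 (phi n) x - (g' x).2).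
    by have := L2_lin mO (-1) Lg2 Lp2; congr L2; apply/funext => x; rewrite /grad/=; ring.
  have J1 := inner_young t0 Ld1 LG1; have J2 := inner_young t0 Ld2 LG2.
  have -> : L2v_inner Omega g' G = - (\int[leb2]_(x in Omega) (('D_e1 (phi n) x - (g' x).1) * (G x).1) +
      \int[leb2]_(x in Omega) (('D_e2 (phi n) x - (g' x).2) * (G x).2)).
    have J1' := L2_integrableM mO Ld1 LG1; have J2' := L2_integrableM mO Ld2 LG2.
    have := test_grad_curl wG (tp n); have Ip := integrable_dot mO Lp LG.
    have Ig := integrable_dot mO Lg' LG.
    rewrite -RintegralD// => p0; rewrite -[LHS]subr0 -p0 /L2v_inner -RintegralB//.
    rewrite -mulN1r -RintegralZl//; last exact: (integrableD mO J1' J2').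
    by apply: eq_Rintegral => x _; rewrite /dot /grad /=; ring.
  rewrite normrN (le_trans (ler_normD _ _))// (le_trans (lerD J1 J2))//.
  by rewrite /C /a1 /a2 !mulrDr le_eqVlt; apply/orP; left; apply/eqP; ring.
have cv : (fun n => t^-1 * (a1 n + a2 n) + t * C) @ \oo --> t^-1 * (0 + 0) + t * C.
  by apply: cvgD; [apply: cvgMl_tmp; exact: cvgD|exact: cvg_cst].
rewrite addr0 mulr0 add0r in cv.
by apply: (cvgr_to_ge cv); apply: nearW => n; exact: B.
Qed.

End WeakGradients.

(** * Discrete divergence-free fields and projected gradients *)

Section DiscreteHelmholtz.
Context {R : realType}.
Local Notation mR2 := (measurableTypeR R * measurableTypeR R)%type.

Variables (Omega : set (R * R)) (rad : R) (T : set (set (R * R))).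
Hypothesis oO : open Omega.
Hypothesis bO : forall x, Omega x -> `|x| <= rad.
Hypothesis nO : Omega !=set0.
Hypothesis fT : finite_set T.
Hypothesis tT : forall K, T K -> is_triangle K.
Hypothesis cT : closure Omega = \bigcup_(K in T) K.
Hypothesis regO : interior (closure Omega) `<=` Omega.

Let mO : measurable (Omega : set mR2). Proof. exact: open_measurable2. Qed.
Let OT : Omega `<=` \bigcup_(K in T) K. Proof. exact: sub_triangulation. Qed.

(** Test functions supported in the open part of a triangle identify the weak derivative with the
    classical one there. Hence any representative of the Curl of a discrete function lies in [Xh]
    and can be tested against projections. *)
Lemma Pk_weak_partial k d v f : d \in [:: e1; e2] -> Pk Omega k.+1 T v ->
  weak_partial Omega d v f -> Pk Omega k T f.
Proof.
move=> de [mv Pv] [Lf wf]; split; first by case: Lf.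
move=> K TK; have [c Hc] := Pv K TK; have [c' Ec'] : exists c', 'D_d (poly2 k.+1 c) = poly2 k c'.
  have [c1 [c2 [E1 E2]]] := poly2_D k c.
  by move: de; rewrite !inE => /orP[]/eqP->; [exists c1|exists c2].
exists c'; have [ O [oO' _ OO _ KO]] := triangle_core tT cT regO TK.
have sP := @smooth_poly2 R k.+1 c; have sQ := @smooth_poly2 R k c'.
have mO' : measurable (O : set mR2) by exact: open_measurable2.
suff H : {ae leb2, forall x, O x -> f x - poly2 k c' x = 0}.
  apply: (ae_mono (ae_and KO H)) => x [[KOx _] Hx] Ox /KOx/Hx/eqP.
  by rewrite subr_eq0 => /eqP.
have iQ : leb2.-integrable Omega (EFin \o poly2 k c').
  have b := lbmeasM (smooth_lbmeas sQ) (indic_bcs2 oO bO).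
  have := integrableS _ mO (@subsetT _ _) (bcs2_integrable b) => /(_ measurableT).
  by apply: eq_integrable => // x; rewrite inE => Ox; rewrite /= indicE mem_set// mulr1.
have if_ := L2_integrable oO bO Lf.
apply: fundamental_open => //.
  have := integrableS mO mO' OO (integrableB mO if_ iQ); exact.
move=> phi tp; have tO := test_sub OO tp; have tD := test_D de tO.
rewrite -(Rintegral_support OO); last by move=> x nx; rewrite (test_out tp)// mulr0.
transitivity (\int[leb2]_(x in Omega) (f x * phi x) - \int[leb2]_(x in Omega) (poly2 k c' x * phi x)).
  rewrite -RintegralB//.
  - by apply: eq_Rintegral => x _; rewrite mulrBl.
  - exact: integrable_mul_bounded if_ (test_bcs tp).
  - exact: integrable_mul_bounded iQ (test_bcs tp).
apply/eqP; rewrite subr_eq0; apply/eqP/oppr_inj; rewrite -wf//.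
rewrite [X in - X]I2_setE; last by move=> x nx; rewrite (test_out tO)// mulr0.
rewrite -Ec' -(ibp de sP tO).
rewrite -(@I2_setE _ Omega); last by move=> x nx; rewrite (test_out tD)// mulr0.
congr fine; apply: ae_eq_integral => //.
- apply/measurable_EFinP; apply: measurable_funM => //.
  by apply: measurable_funTS; case: (test_bcs tD).
- apply/measurable_EFinP/measurable_funTS.
  by case: (smooth_bcsM sP tD).
- apply: (ae_mono (ae_and KO Hc)) => x [[_ OKx] Hx] Ox.
  have [xO|xO] := pselect (O x); first by rewrite /= Hx//; exact: OKx.
  by rewrite /= (test_out (test_D de tp) xO) !mulr0.
Qed.

(** The mean is a quotient by the measure of [Omega], which is finite by boundedness and nonzero
    because [Omega] is open and nonempty. *)
Lemma mean_correction f : L2 Omega f ->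
  exists m, \int[leb2]_(x in Omega) (m + f x) = 0.
Proof.
move=> Lf; have iF := L2_integrable oO bO Lf.
have fin : (leb2 Omega < +oo)%E.
  have := leb2_itv (- rad) rad; apply: le_lt_trans; apply: le_measure; rewrite ?inE//.
    by apply: measurableX; exact: measurable_itv.
  move=> x /bO; rewrite norm2E ge_max !ler_norml => /andP[x1 x2].
  by split; rewrite /= in_itv.
have fn : leb2 Omega \is a fin_num by rewrite ge0_fin_numE.
have A0 : fine (leb2 Omega) != 0.
  apply/eqP => A; have [x Ox] := nO; apply: (open_not_negligible oO Ox).
  exists Omega; split=> //; first by rewrite -[LHS]fineK// A.
  by move=> y /= /contrapT.
have ic m : leb2.-integrable Omega (EFin \o (cst m : R * R -> R)).
  apply: (@measurable_bounded_integrable _ mR2 R leb2 (cst m) Omega) => //.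
  by exists `|m|; split; [exact: num_real|move=> N mN x _; exact: ltW].
exists (- (\int[leb2]_(x in Omega) f x) / fine (leb2 Omega)).
rewrite (RintegralD mO (ic _) iF) Rintegral_cst// mulfVK//.
by rewrite addNr.
Qed.

Lemma L2v_innerB (u v w : R * R -> R * R) : L2v Omega u -> L2v Omega v -> L2v Omega w ->
  L2v_inner Omega (fun x => u x - v x) w = L2v_inner Omega u w - L2v_inner Omega v w.
Proof.
move=> Lu Lv Lw; rewrite addrC -mulN1r -L2v_innerL//.
by congr L2v_inner; apply/funext => x; rewrite [RHS]addrC /= scaleN1r.
Qed.

Lemma L2_projectionP (X : set (R * R -> R * R)) g p : X `<=` L2v Omega -> L2v Omega g ->
  L2_projection Omega X g p <->
  X p /\ forall q, X q -> L2v_inner Omega g q = L2v_inner Omega p q.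
Proof.
move=> XL Lg; split=> -[Xp Hp]; split=> // q Xq.
  by apply/eqP; rewrite -subr_eq0 -L2v_innerB ?Hp//; exact: XL.
by rewrite L2v_innerB ?Hp ?subrr//; exact: XL.
Qed.

Lemma test_cst0 : test_function Omega (cst 0).
Proof.
by split; [exact: smooth_cst|exists set0; split => //; exact: compact0].
Qed.

Lemma grad_cst0 : grad (cst 0 : R * R -> R) = 0.
Proof. by apply/funext => x; rewrite /grad !derive_cst. Qed.

Lemma grad_lin a (phi psi : R * R -> R) : smooth phi -> smooth psi ->
  grad (fun x => a * phi x + psi x) = a *: grad phi + grad psi.
Proof.
move=> s1 s2; have D d : 'D_d (fun x => a * phi x + psi x) = fun x => a * 'D_d phi x + 'D_d psi x.
  apply: (etrans (derive_smoothD d (smoothZ a s1) s2)); apply/funext => x; congr (_ + _).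
  exact: (congr1 (fun f => f x) (derive_smoothZ a d s1)).
apply/funext => x; rewrite /grad.
by rewrite (congr1 (fun f => f x) (D e1)) (congr1 (fun f => f x) (D e2)).
Qed.

Lemma Wh_projection k : simply_connected Omega ->
  Wh Omega k T = L2_projection_image Omega (Xh Omega k T) (grad_H10 Omega).
Proof.
move=> scO; have XL u : Xh Omega k T u -> L2v Omega u by exact: (Xh_L2v oO bO fT tT OT).
apply/seteqP; split => q; last first.
  move=> [g Hg [Xq orth]]; split=> // beta [Pb Yb] G wG.
  have [wG1 wG2] := wG.
  have XG : Xh Omega k T G.
    split; first exact: Pk_weak_partial e2_in Pb wG1.
    have := Pk_lin (-1) (Pk_weak_partial e1_in Pb wG2) (Pk_cst Omega T k 0).
    by congr Pk; apply/funext => x; rewrite addr0 mulN1r opprK.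
  have [v _ wg] := Hg; have Lg := weak_gradient_L2v wg.
  have := orth G XG; rewrite L2v_innerB//; [|exact: XL|exact: XL].
  by rewrite (grad_H10_curl oO bO Hg wG (XL _ XG)) sub0r => /eqP; rewrite oppr_eq0 => /eqP.
move=> [Xq Wq]; have Lq := XL _ Xq.
pose Z : set (R * R -> R * R) := [set p | exists2 phi, test_function Omega phi &
  L2_projection Omega (Xh Omega k T) (grad phi) p].
have ZX : Z `<=` Xh Omega k T by move=> p [phi _ []].
have X0 : Xh Omega k T 0 by exact: Xh_0.
have L0 := L2v_0 Omega; have gL phi := @grad_L2v _ Omega oO phi.
have Z0 : Z 0.
  exists (cst 0); first exact: test_cst0.
  by apply/(L2_projectionP _ XL); [exact: gL test_cst0|rewrite grad_cst0].
have ZL a u v : Z u -> Z v -> Z (a *: u + v).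
  move=> [phi tphi /(L2_projectionP _ XL (gL _ tphi))[Xu Hu]].
  move=> [psi tpsi /(L2_projectionP _ XL (gL _ tpsi))[Xv Hv]].
  have tap : test_function Omega (fun x => a * phi x + psi x).
    exact: (test_add (test_Z a tphi) tpsi).
  exists (fun x => a * phi x + psi x) => //.
  apply/(L2_projectionP _ XL (gL _ tap)); split; first exact: Xh_lin.
  move=> r Xr; rewrite (grad_lin a (test_smooth tphi) (test_smooth tpsi)).
  have Lr := XL _ Xr; have Lu := XL _ Xu; have Lv := XL _ Xv.
  rewrite (L2v_innerL mO a (gL _ tphi) (gL _ tpsi) Lr) (L2v_innerL mO a Lu Lv Lr).
  by rewrite Hu// Hv.
have [p [Zp Hp]] := Xh_projection oO bO fT tT OT ZX Z0 ZL Lq.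
have Xp := ZX _ Zp; have Lp := XL _ Xp.
pose w x := q x - p x.
have Xw : Xh Omega k T w.
  have := Xh_lin (-1) Xp Xq; congr Xh; apply/funext => x.
  by rewrite /w addrC /= scaleN1r.
have Lw := XL _ Xw.
(* As [w] is in [Xh], the gradient may be replaced by its projection, which belongs to [Z] and is
   thus orthogonal to [w]. *)
have w_grad phi : test_function Omega phi -> L2v_inner Omega (grad phi) w = 0.
  move=> tp; have [|z pz] := Xh_projection oO bO fT tT OT (@subset_refl _ (Xh Omega k T)) X0 _ (gL _ tp).
    by move=> a u v; exact: Xh_lin.
  have [Xz Hz] := (L2_projectionP z XL (gL _ tp)).1 pz.
  by rewrite Hz// L2v_innerC; apply: Hp; exists phi.
(* Bounded representatives vanishing outside [Omega] turn orthogonality to gradients into an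
   identity for integrals over the plane. *)
have [h1 [b1 z1 E1]] := Pk_rep oO bO fT tT OT Xw.1.
have [h2 [b2 z2 E2]] := Pk_rep oO bO fT tT OT Xw.2.
pose W x := (h1 x, h2 x).
have LW : L2v Omega W by split; exact: bcs2_L2.
have wW : {ae leb2, forall x, Omega x -> w x = W x}.
  apply: (ae_mono (ae_and E1 E2)) => x [e1' e2'] Ox.
  by rewrite [w x]surjective_pairing e1'// e2'.
have P1 : Pk Omega k T h1.
  by apply: (Pk_ae (measurable_funTS b1.1) Xw.1); apply: (ae_mono E1) => x Hx Ox; rewrite Hx.
have P2 : Pk Omega k T h2.
  by apply: (Pk_ae (measurable_funTS b2.1) Xw.2); apply: (ae_mono E2) => x Hx Ox; rewrite Hx.
have div0 phi : test_function Omega phi -> I2 (fun x => h1 x * 'D_e1 phi x + h2 x * 'D_e2 phi x) = 0.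
  move=> tp; rewrite -(@I2_setE _ Omega); last by move=> x nx; rewrite z1// z2// !mul0r addr0.
  rewrite -(w_grad _ tp) [RHS]L2v_innerC (L2v_inner_ae mO Lw LW (gL _ tp) wW).
  by [].
have [beta0 [bb Pb [pot2 pot1]]] := piecewise_potential oO bO fT tT cT regO scO
  (bcs2_bmeas b1) (bcs2_bmeas b2) P1 P2 div0.
have [m Hm] := mean_correction (bcs2_L2 mO bb).
pose beta x := m + beta0 x.
have Pbeta : Pk Omega k.+1 T beta.
  have := Pk_lin 1 Pb (Pk_cst Omega T k.+1 m); congr Pk; apply/funext => x.
  by rewrite mul1r addrC.
have shift d phi : d \in [:: e1; e2] -> test_function Omega phi ->
    \int[leb2]_(x in Omega) (beta x * 'D_d phi x) = I2 (fun x => beta0 x * 'D_d phi x).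
  move=> de tp; have tD := test_D de tp; have bD := test_bcs tD.
  rewrite I2_setE; last by move=> x nx; rewrite (test_out tD)// mulr0.
  rewrite (_ : (fun x => _) = fun x => m * 'D_d phi x + beta0 x * 'D_d phi x); last first.
    by apply/funext => x; rewrite mulrDl.
  rewrite I2D; [|exact: bcs2Z|exact: bmeasM (bcs2_bmeas bb) bD].
  rewrite I2Z// [X in m * X](_ : _ = 0) ?mulr0 ?add0r//.
  by move: de; rewrite !inE => /orP[]/eqP->; [exact: I2_D1_eq0 tp|exact: I2_D2_eq0 tp].
have c2 : weak_partial Omega e2 beta h1.
  split; first exact: bcs2_L2.
  move=> phi tp; apply: (etrans (shift _ _ e2_in tp)); apply: (etrans (pot2 _ tp)).
  by congr (- _); rewrite I2_setE// => x nx; rewrite z1// mul0r.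
have c1 : weak_partial Omega e1 beta (fun x => - h2 x).
  split; first by have := L2_Z mO (-1) (bcs2_L2 mO b2); under eq_fun do rewrite mulN1r.
  move=> phi tp; apply: (etrans (shift _ _ e1_in tp)); apply: (etrans (pot1 _ tp)).
  rewrite I2_setE; last by move=> x nx; rewrite z2// oppr0 mul0r.
  rewrite (_ : (fun x => - h2 x * phi x) = fun x => -1 * (h2 x * phi x)); last first.
    by apply/funext => x; rewrite mulN1r mulNr.
  by rewrite I2Z ?mulN1r ?opprK//; exact: bmeasM (bcs2_bmeas b2) (test_bcs tp).
have Ybeta : Yh Omega k T beta.
  have Lb := Pk_L2 oO bO fT tT OT Pbeta; split=> //; split; last by split.
  by split=> //; exists (fun x => (- h2 x, h1 x)).
have qW : L2v_inner Omega q W = 0 by apply: (Wq _ Ybeta); split.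
have qw : L2v_inner Omega q w = 0.
  by rewrite L2v_innerC (L2v_inner_ae mO Lw LW Lq wW) L2v_innerC.
have pw : L2v_inner Omega p w = 0 by rewrite L2v_innerC; exact: Hp.
have ww : L2v_inner Omega w w = 0 by rewrite {1}/w L2v_innerB// qw pw subrr.
have pq : {ae leb2, forall x, Omega x -> p x = q x}.
  apply: (ae_mono (L2v_inner_eq0 mO Lw ww)) => x Hx Ox; have := Hx Ox.
  by rewrite /w => /eqP; rewrite subr_eq0 => /eqP.
(* [p] is the projection of the gradient of a test function, and [q], being equal to it almost
   everywhere, represents the same projection. *)
have [phi tphi /(L2_projectionP _ XL (gL _ tphi))[_ Hphi]] := Zp.
exists (grad phi); first exact: grad_test_H10.
apply/(L2_projectionP _ XL (gL _ tphi)); split=> // r Xr.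
by rewrite Hphi//; apply: (L2v_inner_ae mO) => //; exact: XL.
Qed.

End DiscreteHelmholtz.

Theorem lemma3p12 (R : realType) (Omega : set (R * R)) (k : nat)
    (hOmega : simply_connected_polygonal_domain Omega)
    (T : set (set (R * R))) (hT : regular_triangulation Omega T) :
  Wh Omega k T = L2_projection_image Omega (Xh Omega k T) (grad_H10 Omega) /\
  (forall (e : set (R * R) -> set (R * R)) (Tstar : set (set (R * R))),
     refinement_edges T e ->
     admissible_refinement Omega T e Tstar ->
     L2_projection_image Omega (Xh Omega k T) (Wh Omega k Tstar)
     = Wh Omega k T).
Proof.
have [[nO oO _] scO [M [_ bM]] _ lip] := hOmega.
have bO x : Omega x -> `|x| <= M + 1 by apply: bM; rewrite ltrDl.
have regO := lipschitz_interior lip oO.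
have WhE T' : regular_triangulation Omega T' ->
    Wh Omega k T' = L2_projection_image Omega (Xh Omega k T') (grad_H10 Omega).
  by move=> [fT tT cT _]; exact: (Wh_projection oO bO nO fT tT cT regO).
split=> [|e Tstar _ ref]; first exact: WhE.
have hTs : regular_triangulation Omega Tstar by case: ref => ? [].
rewrite !WhE//.
have [fT tT cT _] := hT; have [fTs tTs cTs _] := hTs.
have XL u : Xh Omega k T u -> L2v Omega u by exact: (Xh_L2v oO bO fT tT (sub_triangulation cT)).
have XLs u : Xh Omega k Tstar u -> L2v Omega u by exact: (Xh_L2v oO bO fTs tTs (sub_triangulation cTs)).
(* Each refined triangle lies in one coarse triangle and inherits its polynomial. *)
have PP f : Pk Omega k T f -> Pk Omega k Tstar f.
  move=> [mf Hf]; split=> // K' /(refinement_subset ref)[K TK KK].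
  by have [c Hc] := Hf K TK; exists c; apply: (ae_mono Hc) => x Hx Ox /KK; exact: Hx.
have XX u : Xh Omega k T u -> Xh Omega k Tstar u by move=> [u1 u2]; split; exact: PP.
have GL g : grad_H10 Omega g -> L2v Omega g by move=> [v _]; exact: weak_gradient_L2v.
apply/seteqP; split=> p.
  move=> [ps [g Gg /(L2_projectionP oO ps XLs (GL _ Gg))[Xps Hps]]].
  move=> /(L2_projectionP oO p XL (XLs _ Xps))[Xp Hp].
  exists g => //; apply/(L2_projectionP oO p XL (GL _ Gg)); split=> // q Xq.
  by rewrite (Hps _ (XX _ Xq)) Hp.
move=> [g Gg /(L2_projectionP oO p XL (GL _ Gg))[Xp Hp]].
have [||ps pg] := Xh_projection oO bO fTs tTs (sub_triangulation cTs) (@subset_refl _ (Xh Omega k Tstar)) _ _ (GL _ Gg).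
- exact: Xh_0.
- by move=> a u v; exact: Xh_lin.
exists ps; first by exists g.
have [Xps Hps] := (L2_projectionP oO ps XLs (GL _ Gg)).1 pg.
apply/(L2_projectionP oO p XL (XLs _ Xps)); split=> // q Xq.
by rewrite -(Hps _ (XX _ Xq)) Hp.
Qed.
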